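(* For any nonnegative integer $k$, and $N\in\{2n,2n+1\}$, $$\mathrm{char}(S^{k}(\mathfrak{so}_{N}))=\sum_{\lambda\in\mathcal{P}_{n}}\ \sum_{\nu\in\mathcal{P}_{N}^{(1,1)}(2k)}b_{\nu,\lambda}^{\mathfrak{so}_{N}}\,s_{\lambda}^{\mathfrak{so}_{N}},\qquad \mathrm{char}(S^{k}(\mathfrak{sp}_{2n}))=\sum_{\lambda\in\mathcal{P}_{n}}\ \sum_{\nu\in\mathcal{P}_{2n}^{(2)}(2k)}b_{\nu,\lambda}^{\mathfrak{sp}_{2n}}\,s_{\lambda}^{\mathfrak{sp}_{2n}}.$$
   Context: $\mathcal{P}_m$ is the set of partitions with at most $m$ nonzero parts. $\mathcal{P}_m^{(2)}$ (resp. $\mathcal{P}_m^{(1,1)}$) is the subset of partitions all of whose rows (resp. all of whose columns) have even length, and $(2k)$ appended means restricting to partitions of size $2k$. Let $G=SO_{2n+1}$ ($n\ge2$), $Sp_{2n}$ ($n\ge2$) or $SO_{2n}$ ($n\ge4$) be the complex Lie group with Lie algebra $\mathfrak g\subset\mathfrak{gl}_N$, where $N=2n+1,2n,2n$ respectively. $S^k(\mathfrak g)$ is the $k$-th symmetric power of $\mathfrak g$ regarded as a $G$-module (adjoint representation), and $\mathrm{char}$ is the usual character in $\mathbb{Z}[x_1^{\pm1},\dots,x_n^{\pm1}]$, with $x_i=e^{\varepsilon_i}$, where $\varepsilon_i$ is the linear form sending a diagonal matrix to its $(i,i)$-coefficient. Each $\lambda=(\lambda_1,\dots,\lambda_n)\in\mathcal{P}_n$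 is identified with the dominant weight $\sum_{i=1}^n\lambda_i\varepsilon_i$; $V^{\mathfrak g}(\lambda)$ is the irreducible finite-dimensional representation of $G$ of highest weight $\lambda$, and $s_\lambda^{\mathfrak g}$ is its Weyl character. For $\nu\in\mathcal{P}_N$, $V^{\mathfrak{gl}_N}(\nu)$ is the irreducible finite-dimensional $\mathfrak{gl}_N$-module of highest weight $\nu$, and $V^{\mathfrak{gl}_N}(\nu)\downarrow_{\mathfrak g}^{\mathfrak{gl}_N}$ is its restriction to $\mathfrak g$. The branching coefficients $b_{\nu,\lambda}^{\mathfrak{so}_N}$ and $b_{\nu,\lambda}^{\mathfrak{sp}_{2n}}$ are defined by the decompositions $$V^{\mathfrak{gl}_N}(\nu)\downarrow_{\mathfrak{so}_N}^{\mathfrak{gl}_N}=\bigoplus_{\lambda\in\mathcal{P}_n}V^{\mathfrak{so}_N}(\lambda)^{\oplus b_{\nu,\lambda}^{\mathfrak{so}_N}},\qquad V^{\mathfrak{gl}_{2n}}(\nu)\downarrow_{\mathfrak{sp}_{2n}}^{\mathfrak{gl}_{2n}}=\bigoplus_{\lambda\in\mathcal{P}_n}V^{\mathfrak{sp}_{2n}}(\lambda)^{\oplus b_{\nu,\lambda}^{\mathfrak{sp}_{2n}}}.$$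
   Formalization: For N=2n the branching decomposition over P_n need not exist (e.g. Λ^4 C^8 contains V(1,1,1,-1)); the formula over P_n is stated when these decompositions exist, and a version with λ over all dominant weights of SO_{2n} is added. *)

(* Defs.v *)
From HB Require Import structures.
From mathcomp Require Import all_boot all_order all_algebra.
From mathcomp Require Export boolp classical_sets cardinality fsbigop reals.
From mathcomp Require Export complex.
From mathcomp Require Export freeg mpoly.
From mathcomp Require Import ring.

Set Implicit Arguments.
Unset Strict Implicit.
Unset Printing Implicit Defensive.

Import Order.TTheory GRing.Theory Num.Theory.

Local Open Scope classical_set_scope.
Local Open Scope ring_scope.

(* ------------------------------------------------------------------------ *)
(* Partitions: weakly decreasing m-tuples of naturals, padded with zeros.   *)

Definition parts (m : nat) : set (m.-tuple nat) :=
  [set nu : m.-tuple nat | sorted geq nu].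

(* P_m^{(2)}(s) *)
Definition parts_even_rows (m s : nat) : set (m.-tuple nat) :=
  [set nu : m.-tuple nat |
    [/\ sorted geq nu, sumn nu = s & forall r, r \in tval nu -> ~~ odd r]].

(* P_m^{(1,1)}(s); the j-th column (counted from 0) has length
   #{i | j < nu_i}.                                                         *)
Definition parts_even_cols (m s : nat) : set (m.-tuple nat) :=
  [set nu : m.-tuple nat |
    [/\ sorted geq nu, sumn nu = s &
        forall j : nat, ~~ odd (count (fun r => (j < r)%N) nu)]].

(* The tuple mu stands for the weight \sum_i mu_i eps_i. *)
Definition weight_of (m : nat) (nu : m.-tuple nat) : m.-tuple int :=
  map_tuple Posz nu.

(* All the dominant weights of SO_{2n}: mu_1 >= ... >= mu_{n-1} >= |mu_n|. *)
Definition dominantD (n : nat) : set (n.-tuple int) :=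
  [set mu : n.-tuple int |
    forall i j : 'I_n, (i < j)%N -> `|tnth mu j| <= tnth mu i].

Arguments parts : clear implicits.
Arguments parts_even_rows : clear implicits.
Arguments parts_even_cols : clear implicits.
Arguments dominantD : clear implicits.

(* ------------------------------------------------------------------------ *)

Definition brmx (C : fieldType) (N : nat) (x y : 'M[C]_N) : 'M[C]_N :=
  x *m y - y *m x.

Record mxLie (C : fieldType) (N : nat) := MxLie {
  mxlie_space :> {vspace 'M[C]_N};
  mxlie_closed : {in mxlie_space &, forall x y, brmx x y \in mxlie_space}
}.

Definition gl (C : fieldType) (N : nat) : mxLie C N :=
  @MxLie C N fullv (fun x y _ _ => memvf (brmx x y)).

Section FormLie.
Variables (C : fieldType) (N : nat) (J : 'M[C]_N).

Definition form_space : {vspace 'M[C]_N} :=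
  lker (linfun ((mulmxr J \o @trmx C N N) \+ mulmx J)).

Lemma form_spaceP (x : 'M[C]_N) :
  reflect (x^T *m J + J *m x = 0) (x \in form_space).
Proof. by rewrite memv_ker lfunE; apply: eqP. Qed.

Lemma form_space_closed : {in form_space &, forall x y, brmx x y \in form_space}.
Proof.
move=> x y /form_spaceP hx /form_spaceP hy; apply/form_spaceP.
have ex : x^T *m J = - (J *m x) by apply/eqP; rewrite -addr_eq0 hx.
have ey : y^T *m J = - (J *m y) by apply/eqP; rewrite -addr_eq0 hy.
have exy (a b : 'M[C]_N) : a^T *m J = - (J *m a) -> b^T *m J = - (J *m b) ->
    (a *m b)^T *m J = J *m (b *m a).
  move=> ea eb; rewrite trmx_mul -mulmxA ea mulmxN (mulmxA b^T) eb.
  by rewrite mulNmx opprK mulmxA.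
rewrite /brmx linearB /= mulmxBl mulmxBr !exy // addrC.
by rewrite addrA subrK subrr.
Qed.

Definition form_lie : mxLie C N := MxLie form_space_closed.

End FormLie.

(* The forms are antidiagonal, so that the diagonal matrices of so_N and
   sp_{2n} form a Cartan subalgebra diag(h_1, ..., h_n, (0,) -h_n, ..., -h_1)
   and the upper triangular ones a Borel subalgebra.                        *)
Definition so (C : fieldType) (N : nat) : mxLie C N :=
  form_lie (\matrix_(i, j) (j == rev_ord i)%:R).

Definition sp (C : fieldType) (n : nat) : mxLie C (2 * n)%N :=
  form_lie (\matrix_(i, j) ((-1) ^+ (n <= i)%N *+ (j == rev_ord i))).

(* ------------------------------------------------------------------------ *)
(* Finite-dimensional modules; mod_act is only meaningful on g.             *)

Record lieMod (C : fieldType) (N : nat) (g : mxLie C N) := LieMod {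
  mod_space :> vectType C;
  mod_act : 'M[C]_N -> 'End(mod_space);
  mod_lin : {in g &, forall x y, forall a : C,
    mod_act (a *: x + y) = a *: mod_act x + mod_act y};
  mod_br : {in g &, forall x y,
    mod_act (brmx x y)
      = ((mod_act x \o mod_act y) - (mod_act y \o mod_act x))%VF}
}.

(* Restriction of a gl_N-module to g. *)
Definition restrict (C : fieldType) (N : nat) (g : mxLie C N)
    (V : lieMod (gl C N)) : lieMod g :=
  @LieMod C N g (mod_space V) (@mod_act _ _ _ V)
    (fun x y _ _ a => mod_lin V (memvf x) (memvf y) a)
    (fun x y _ _ => mod_br V (memvf x) (memvf y)).

Section Modules.
Variables (C : fieldType) (N : nat) (g : mxLie C N).

Definition irreducible_mod (V : lieMod g) : Prop :=
  fullv != 0%VS :> {vspace V} /\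
  forall U : {vspace V}, {in g, forall x, (mod_act V x @: U <= U)%VS} ->
    U = 0%VS \/ U = fullv.

Definition equivariant (V W : lieMod g) (f : 'Hom(V, W)) : Prop :=
  {in g, forall x, (f \o mod_act V x = mod_act W x \o f)%VF}.

(* V is isomorphic to the direct sum over w in P of L(w)^{b(w)}: the sequence
   s lists the summands, each w in P occurring b(w) times.                  *)
Definition decomposes_as (W : choiceType) (P : set W) (L : W -> lieMod g)
    (b : W -> nat) (V : lieMod g) : Prop :=
  exists (s : seq W)
         (f : forall i : 'I_(size s), 'Hom(L (tnth (in_tuple s) i), V)),
    [/\ forall w, w \in s -> P w,
        forall w, P w -> count_mem w s = b w,
        forall i, equivariant (f i) /\ lker (f i) = 0%VS,
        directv (\sum_i limg (f i)) &
        (\sum_i limg (f i))%VS = fullv].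

Definition cartan : {vspace 'M[C]_N} :=
  (g :&: <<[seq delta_mx i i | i : 'I_N]>>)%VS.

(* \sum_i mu_i eps_i, where eps_i(h) is the i-th diagonal coefficient of h
   and mu is padded with zeros up to N.                                     *)
Definition weight_form (mu : seq int) (h : 'M[C]_N) : C :=
  \sum_(i < N) (mu`_i)%:~R * h i i.

Definition weight_space (V : lieMod g) (mu : seq int) : {vspace V} :=
  (\bigcap_(h <- vbasis cartan)
      lker (mod_act V h - weight_form mu h *: \1%VF))%VS.

Definition highest_weight_vector (V : lieMod g) (mu : seq int) (v : V) : Prop :=
  [/\ v != 0, v \in weight_space V mu &
      {in g, forall x : 'M[C]_N,
        (forall i j : 'I_N, (j <= i)%N -> x i j = 0) -> mod_act V x v = 0}].

Definition irreducible_of_highest_weight (V : lieMod g) (mu : seq int) : Prop :=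
  irreducible_mod V /\ exists v : V, highest_weight_vector mu v.

(* Elements of Z[x_1^{+-1}, ..., x_n^{+-1}] as finitely supported functions on
   the exponents; << c *g mu >> is the term c x^mu.                   *)
Definition char (n : nat) (V : lieMod g) : {freeg (n.-tuple int) / int} :=
  \sum_(mu \in [set: n.-tuple int])
    << (\dim (weight_space V mu))%:Z *g mu >>.

End Modules.

(* ------------------------------------------------------------------------ *)

Section Adjoint.
Variables (C : fieldType) (N : nat) (g : mxLie C N).

Definition ad_fun (x : 'M[C]_N) (y : subvs_of g) : subvs_of g :=
  vsproj g (brmx x (vsval y)).

Lemma ad_fun_is_linear x : linear (ad_fun x).
Proof.
move=> a y z; rewrite /ad_fun -[RHS]linearP /=; congr (vsproj g _).
rewrite /brmx !(mulmxDr, mulmxDl) -scalemxAr -scalemxAl.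
by apply/matrixP => i j; rewrite !mxE; ring.
Qed.

HB.instance Definition _ x :=
  GRing.isLinear.Build C (subvs_of g) (subvs_of g) _ (ad_fun x)
    (ad_fun_is_linear x).

Lemma ad_lin : {in g &, forall x y, forall a : C,
  linfun (ad_fun (a *: x + y)) = a *: linfun (ad_fun x) + linfun (ad_fun y)}.
Proof.
move=> x y _ _ a; apply/lfunP => z.
rewrite add_lfunE scale_lfunE !lfunE /= /ad_fun -[RHS]linearP /=; congr (vsproj g _).
rewrite /brmx !(mulmxDr, mulmxDl) -scalemxAr -scalemxAl.
by apply/matrixP => i j; rewrite !mxE; ring.
Qed.

Lemma ad_br : {in g &, forall x y, linfun (ad_fun (brmx x y)) =
  ((linfun (ad_fun x) \o linfun (ad_fun y))
   - (linfun (ad_fun y) \o linfun (ad_fun x)))%VF}.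
Proof.
move=> x y gx gy; apply/lfunP => z.
rewrite add_lfunE opp_lfunE !comp_lfunE !lfunE /=.
apply: val_inj; rewrite /= /ad_fun.
have gz := subvsP z.
have [gyz gxz gxy] : [/\ brmx y (vsval z) \in g, brmx x (vsval z) \in g &
   brmx x y \in g] by split; apply: mxlie_closed.
rewrite !vsprojK ?mxlie_closed // /brmx.
rewrite !(mulmxBr, mulmxBl) !mulmxA !opprB.
by apply/matrixP => i j; rewrite !mxE; ring.
Qed.

Definition adjoint : lieMod g :=
  @LieMod C N g (subvs_of g) (fun x => linfun (ad_fun x)) ad_lin ad_br.

End Adjoint.

(* ------------------------------------------------------------------------ *)
(* Homogeneous polynomials of degree k. The library only declares the vector
   space structure when the number of variables is a successor.             *)

Definition hompoly (d : nat) (C : fieldType) (k : nat) := dhomog d C k.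

HB.instance Definition _ (d : nat) (C : fieldType) (k : nat) :=
  GRing.Lmodule.on (hompoly d C k).
HB.instance Definition _ (d : nat) (C : fieldType) (k : nat) :=
  SubType.on (hompoly d C k).

Definition hompoly_dim (d k : nat) : nat :=
  if d is d'.+1 then 'C(k + d', k) else (k == 0)%N.

Lemma hompoly_vecaxiom d (C : fieldType) k :
  Vector.axiom (hompoly_dim d k) (hompoly d C k).
Proof.
case: d => [|d]; last exact: dhomog_vecaxiom.
have m0 (m : 'X_{1..0}) : m = 0%MM by apply/mnmP; case.
exists (fun p : hompoly 0 C k => const_mx p@_0%MM).
  by move=> a p q; apply/matrixP => i j; rewrite !mxE mcoeffD mcoeffZ.
have hh (r : 'rV[C]_(hompoly_dim 0 k)) : (\sum_j r 0 j)%:MP_[0] \is k.-homog.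
  case: k r => [|k] r; last by rewrite big_ord0 mpolyC0 rpred0.
  by rewrite -alg_mpolyC rpredZ // dhomog1.
exists (fun r => DHomog (hh r)).
  move=> p; apply: val_inj; apply/mpolyP => m /=.
  rewrite (m0 m) mcoeffC eqxx mulr1; under eq_bigr do rewrite mxE.
  case: k {hh} p => [|k] p; first by rewrite big_ord1.
  rewrite big_ord0; apply/esym/(dhomog_nemf_coeff (dhomog_is_dhomog p)).
  by rewrite /= mdeg0.
move=> r; apply/rowP => i; rewrite mxE /= mcoeffC eqxx mulr1.
by case: k {hh} r i => [|k] r i; [rewrite big_ord1 (ord1 i) | case: i].
Qed.

HB.instance Definition _ (d : nat) (C : fieldType) (k : nat) :=
  Lmodule_hasFinDim.Build C (hompoly d C k) (@hompoly_vecaxiom d C k).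

Section SymPower.
Variables (C : fieldType) (N : nat) (g : mxLie C N) (V : lieMod g).

(* The symmetric algebra of V is the polynomial ring on the vectors e_i of a
   basis of V, and x in g acts on it by the derivation extending its action
   on V.                                                                    *)
Local Notation d := (\dim {:V}).
Local Notation e := (vbasis {:V}).

Definition sym_lin (v : V) : {mpoly C[d]} := \sum_(j < d) coord e j v *: 'X_j.

Definition sym_der (x : 'M[C]_N) (p : {mpoly C[d]}) : {mpoly C[d]} :=
  \sum_(i < d) sym_lin (mod_act V x e`_i) * p^`M(i).

Lemma sym_der_homog k x (p : {mpoly C[d]}) :
  p \is k.-homog -> sym_der x p \is k.-homog.
Proof.
move=> hp; apply: rpred_sum => i _; rewrite mulr_suml rpred_sum // => j _.
rewrite -scalerAl rpredZ // [p]mpolyE raddf_sum mulr_sumr big_seq.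
apply: rpred_sum => m hm; rewrite /= mderivZ -scalerAr rpredZ //.
rewrite mderivX -scalerAr; have [->|mi_gt0] := posnP (m i).
  by rewrite scale0r rpred0.
have Ule : (U_(i) <= m)%MM.
  by apply/mnm_lepP => l; rewrite mnm1E; case: eqP => // <-.
rewrite rpredZ // -mpolyXD dhomogX /= mdegD mdeg1.
by rewrite -(dhomog_mf hp hm) /= -{2}(submK Ule) mdegD mdeg1 addnC.
Qed.

Definition sym_fun k (x : 'M[C]_N) (p : hompoly d C k) : hompoly d C k :=
  DHomog (sym_der_homog x (dhomog_is_dhomog p)).

Lemma sym_fun_is_linear k x : linear (@sym_fun k x).
Proof.
move=> a p q; apply: val_inj => /=.
rewrite /sym_der scaler_sumr -big_split /=; apply: eq_bigr => i _.
by rewrite linearP mulrDr scalerAr.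
Qed.

HB.instance Definition _ k x :=
  GRing.isLinear.Build C (hompoly d C k) (hompoly d C k) _ (@sym_fun k x)
    (@sym_fun_is_linear k x).

Lemma sym_lin_is_linear : linear sym_lin.
Proof.
move=> a v w; rewrite /sym_lin scaler_sumr -big_split /=.
by apply: eq_bigr => j _; rewrite linearP /= scalerDl scalerA.
Qed.

HB.instance Definition _ :=
  GRing.isLinear.Build C V {mpoly C[d]} _ sym_lin sym_lin_is_linear.

Lemma sym_der_lin x v : sym_der x (sym_lin v) = sym_lin (mod_act V x v).
Proof.
rewrite {2}(coord_vbasis (memvf v)) !linear_sum /=.
apply: eq_bigr => i _; rewrite !linearZ /= -mul_mpolyC mulrC; congr (_ * _).
rewrite /sym_lin raddf_sum (bigD1 i) //= mderivZ mderivX mnm1E eqxx.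
have -> : (U_(i) - U_(i))%MM = 0%MM :> 'X_{1..d}.
  by apply/mnmP => l; rewrite mnmBE subnn mnm0E.
rewrite scale1r mpolyX0 big1 ?addr0 => [|j ji].
  by rewrite -mul_mpolyC mulr1.
by rewrite mderivZ mderivX mnm1E (negPf ji) scale0r scaler0.
Qed.

Lemma sym_der_comp x y p : sym_der x (sym_der y p) =
  \sum_(j < d) sym_lin (mod_act V x (mod_act V y e`_j)) * p^`M(j)
  + \sum_(i < d) \sum_(j < d) sym_lin (mod_act V x e`_i)
      * sym_lin (mod_act V y e`_j) * p^`M(j)^`M(i).
Proof.
under [X in _ = X + _]eq_bigr do rewrite -sym_der_lin /sym_der mulr_suml.
rewrite exchange_big -big_split /=; apply: eq_bigr => i _.
rewrite -big_split /= raddf_sum mulr_sumr /=.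
by apply: eq_bigr => j _; rewrite mderivM mulrDr !mulrA.
Qed.

Lemma sym_lin_mod k : {in g &, forall x y, forall a : C,
  linfun (@sym_fun k (a *: x + y))
    = a *: linfun (@sym_fun k x) + linfun (@sym_fun k y)}.
Proof.
move=> x y gx gy a; apply/lfunP => p; rewrite add_lfunE scale_lfunE !lfunE /=.
apply: val_inj; rewrite /= /sym_der mod_lin // scaler_sumr -big_split /=.
apply: eq_bigr => i _.
by rewrite add_lfunE scale_lfunE linearP mulrDl scalerAl.
Qed.

Lemma sym_br k : {in g &, forall x y, linfun (@sym_fun k (brmx x y)) =
  ((linfun (@sym_fun k x) \o linfun (@sym_fun k y))
   - (linfun (@sym_fun k y) \o linfun (@sym_fun k x)))%VF}.
Proof.
move=> x y gx gy; apply/lfunP => p.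
rewrite add_lfunE opp_lfunE !comp_lfunE !lfunE /=.
apply: val_inj; rewrite /= !sym_der_comp opprD addrACA.
rewrite [X in _ = _ + X](_ : _ = 0) ?addr0.
  rewrite -sumrB /sym_der; apply: eq_bigr => i _.
  by rewrite mod_br // add_lfunE opp_lfunE !comp_lfunE linearB mulrBl.
apply/eqP; rewrite subr_eq0 exchange_big /=; apply/eqP.
apply: eq_bigr => i _; apply: eq_bigr => j _.
by rewrite mderiv_comm [sym_lin _ * sym_lin _]mulrC.
Qed.

Definition sym_power (k : nat) : lieMod g :=
  @LieMod C N g (hompoly d C k) (fun x => linfun (@sym_fun k x))
    (sym_lin_mod k) (sym_br k).

End SymPower.

(* Main.v *)
(* Let V be the Lie algebra g of a nondegenerate form J on C^N, which is
   Lambda^2 C^N (orthogonal case) or S^2 C^N (symplectic case) as a g-module;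
   x . y = x y + y J^-1 x^T J extends its adjoint action to gl_N.  So W = S^k(g)
   is the restriction of a gl_N-module, and it suffices to decompose W over gl_N
   without multiplicities, V(nu) occurring for nu with even columns (resp. rows).

   W carries a positive definite Hermitian form for which E_ij and E_ji are
   adjoint (the Fischer form of polynomials in the entries of y J^-1).  Hence W is
   the orthogonal sum of copies of V(nu), one for each line of highest weight
   vectors of weight nu: the submodule of V(nu) x W generated by the pair of
   highest weight vectors is the graph of an embedding.

   Highest weight vectors are orthogonal to the image of the lowering operators,
   and modulo this image every monomial straightens to a monomial in x_12, x_34, ...
   (resp. x_11, x_22, ...).  These have distinct weights, so each weight has at most
   one highest weight vector up to scalars, and the products of leading Pfaffians
   (resp. leading minors) realise all the weights that can occur. *)
From HB Require Import structures.
Require Import Defs.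
From mathcomp Require Import all_boot all_order all_algebra all_fingroup ring zify.
Import Order.TTheory GRing.Theory Num.Theory passmx.
Local Open Scope classical_set_scope.
Local Open Scope ring_scope.

Set Implicit Arguments.
Unset Strict Implicit.
Unset Printing Implicit Defensive.

(** * Weight spaces and decompositions *)

(** Positivity takes the place of complete reducibility. Suppose that the submodule generated by a
    pair (v, w) of highest weight vectors contains (0, y). Its coefficient along (v, w) vanishes and
    its other components have other eigenvalues of a grading element, so y is orthogonal to w;
    moving lowering operators across the form makes y orthogonal to every second component, in
    particular to itself.

    The scalar [eta] treats both cases at once: J^T = - eta J, with eta = 1 symplectic and eta = -1
    orthogonal, so z = y J^-1 satisfies z^T = eta z. The entries of z are therefore dependent, and
    the Fischer form is taken on polynomials in N^2 independent variables x_ab, into which S(g)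
    embeds; there E_ij is the sum of the x_ib d/dx_jb and the x_ai d/dx_aj, and its adjoint is
    visibly E_ji.

    Straightening bounds the highest weights from above. The bound from below needs minors and
    Pfaffians to be nonzero, which is seen by evaluating them at one matrix. Over g only characters
    are compared, through dimensions of weight spaces. *)

(** A subspace of maximal dimension inside [P] absorbs every vector of [P]. This lets submodules be
    handled as mere predicates. *)
Lemma vspace_of_closed (F : fieldType) (V : vectType F) (P : V -> Prop) :
  P 0 -> (forall a x y, P x -> P y -> P (a *: x + y)) ->
  exists U : {vspace V}, forall x, x \in U <-> P x.
Proof.
move=> P0 Plin.
pose Q (m : nat) := `[< exists U : {vspace V},
   (forall x, x \in U -> P x) /\ \dim U = m >].
have exQ : exists m, Q m.
  exists 0%N; apply/asboolP; exists 0%VS; split; last exact: dimv0.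
  by move=> x; rewrite memv0 => /eqP ->.
have bQ m : Q m -> (m <= \dim {:V})%N.
  by move=> /asboolP[U [_ <-]]; apply/dimvS/subvf.
case: (ex_maxnP exQ bQ) => m /asboolP[U [UP dU]] mmax.
exists U => x; split=> [/UP//|Px].
have/mmax : Q (\dim (U + <[x]>)%VS).
  apply/asboolP; exists (U + <[x]>)%VS; split=> // y /memv_addP[u uU [v]].
  by move=> /vlineP[a ->] ->; rewrite addrC; apply: Plin => //; apply: UP.
rewrite -dU => le_dim.
have /eqP eqU : U == (U + <[x]>)%VS by rewrite eqEdim addvSl le_dim.
by rewrite eqU; apply: subvP (addvSr _ _) _ _; rewrite memv_line.
Qed.

Lemma memv_bigcap_seq (F : fieldType) (V : vectType F) (I : Type) (s : seq I)
    (U : I -> {vspace V}) v :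
  (v \in \bigcap_(i <- s) U i)%VS = all (fun i => v \in U i) s.
Proof.
elim: s => [|i s IHs]; first by rewrite big_nil memvf.
by rewrite big_cons memv_cap IHs.
Qed.

Section WeightSpaces.
Variables (C : fieldType) (N : nat) (g : mxLie C N).
Implicit Types V : lieMod g.

Lemma mod_act0 V : mod_act V 0 = 0.
Proof.
have := mod_lin V (mem0v g) (mem0v g) 1; rewrite !scale1r addr0 => /eqP.
by rewrite -subr_eq0 opprD addrA subrr add0r oppr_eq0 => /eqP.
Qed.

Lemma mod_actZD V a x y : x \in g -> y \in g ->
  mod_act V (a *: x + y) = a *: mod_act V x + mod_act V y.
Proof. by move=> gx gy; exact: mod_lin. Qed.

Lemma cartan_sub h : h \in cartan g -> h \in g.
Proof. by rewrite memv_cap => /andP[]. Qed.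

Lemma weight_formZD mu a (x y : 'M[C]_N) :
  weight_form mu (a *: x + y) = a * weight_form mu x + weight_form mu y.
Proof.
rewrite /weight_form mulr_sumr -big_split /=; apply: eq_bigr => i _.
by rewrite !mxE mulrDr mulrCA.
Qed.

(** The definition tests only a basis of the Cartan subalgebra; the elements that act on [v] by the
    prescribed scalar form a subspace [U], so the basis suffices. *)
Lemma weight_spaceP V mu v : v \in weight_space V mu <->
  forall h, h \in cartan g -> mod_act V h v = weight_form mu h *: v.
Proof.
have [||U UP] := @vspace_of_closed C 'M[C]_N
  (fun h => h \in cartan g /\ mod_act V h v = weight_form mu h *: v).
- rewrite mem0v mod_act0 lfunE /=; split=> //.
  by rewrite /weight_form big1 ?scale0r // => i _; rewrite mxE mulr0.
- move=> a x y [cx ex] [cy ey]; split; first by rewrite memvD ?memvZ.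
  rewrite mod_actZD ?cartan_sub // add_lfunE scale_lfunE ex ey.
  by rewrite weight_formZD scalerDl scalerA.
rewrite /weight_space memv_bigcap_seq; split=> [/allP hv|hv].
  suff sub : (cartan g <= U)%VS by move=> h /(subvP sub)/UP[].
  rewrite -(span_basis (vbasisP (cartan g))); apply/span_subvP => x xb.
  apply/UP; split; first exact: vbasis_mem.
  have := hv x xb.
  by rewrite memv_ker !(add_lfunE, opp_lfunE, scale_lfunE) id_lfunE subr_eq0 => /eqP.
apply/allP => x /vbasis_mem xb; rewrite memv_ker.
by rewrite !(add_lfunE, opp_lfunE, scale_lfunE) id_lfunE hv // subrr.
Qed.

Lemma equivariant_weight_space (V W : lieMod g) (f : 'Hom(V, W)) mu :
  equivariant f -> (f @: weight_space V mu <= weight_space W mu)%VS.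
Proof.
move=> ef; apply/subvP => _ /memv_imgP[v hv ->].
apply/weight_spaceP => h hc; rewrite -comp_lfunE -ef ?cartan_sub // comp_lfunE.
by move/weight_spaceP: hv => ->; rewrite ?linearZ.
Qed.

End WeightSpaces.

Section Decompositions.
Variables (C : fieldType) (N : nat) (g : mxLie C N).

(** Applying h - mu(h) to the components of a weight vector gives vectors of the summands with sum
    zero; directness kills each of them, so every component is a weight vector. *)
Lemma dim_weight_space_decomposes (W : choiceType) (L : W -> lieMod g) (V : lieMod g) (s : seq W)
    (f : forall i : 'I_(size s), 'Hom(L (tnth (in_tuple s) i), V)) mu :
  (forall i, equivariant (f i) /\ lker (f i) = 0%VS) ->
  directv (\sum_i limg (f i)) -> (\sum_i limg (f i))%VS = fullv ->
  \dim (weight_space V mu) = \sum_(w <- s) \dim (weight_space (L w) mu).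
Proof.
move=> fP fdir ffull.
have eqV : weight_space V mu
    = (\sum_i (f i @: weight_space (L (tnth (in_tuple s) i)) mu))%VS.
  apply/eqP; rewrite eqEsubv; apply/andP; split; last first.
    by apply/subv_sumP => i _; apply: equivariant_weight_space; case: (fP i).
  apply/subvP => v hv.
  have : v \in (\sum_i limg (f i))%VS by rewrite ffull memvf.
  move=> /memv_sumP[u /= u_in ev].
  rewrite ev; apply: memv_sumr => i _.
  have [x _ ex] := memv_imgP (u_in i isT).
  rewrite ex; apply: memv_img; apply/weight_spaceP => h hc.
  have uW : mod_act V h (u i) = weight_form mu h *: u i.
    move/directv_sum_independent: fdir.
    move=> /(_ (fun i => mod_act V h (u i) - weight_form mu h *: u i)) H.
    apply/eqP; rewrite -subr_eq0; apply/eqP; apply: H => // [j _|].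
      have [y _ ->] := memv_imgP (u_in j isT).
      rewrite memvB ?memvZ ?memv_img ?memvf //.
      by rewrite -comp_lfunE -(fP j).1 ?cartan_sub // comp_lfunE memv_img ?memvf.
    rewrite sumrB -linear_sum -scaler_sumr -ev.
    by move/weight_spaceP: hv => /= -> //; rewrite subrr.
  have /eqP/lker0P := (fP i).2; apply.
  rewrite -comp_lfunE (fP i).1 ?cartan_sub // comp_lfunE -ex uW ex.
  by rewrite linearZ.
rewrite eqV (directvP _) /=; last first.
  apply/directv_sum_independent => u uP u0 i _.
  move/directv_sum_independent: fdir; apply=> // j _.
  by have := uP j isT; apply/subvP/limgS/subvf.
rewrite (big_tnth _ _ s); apply: eq_bigr => i _.
by rewrite limg_dim_eq // (fP i).2 capv0.
Qed.

End Decompositions.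

(** * Finiteness of weights and additivity of characters *)

Section CharDecomposition.
Variables (C : numFieldType) (N : nat) (g : mxLie C N) (n : nat).

Lemma finite_leigenvalue (V : vectType C) (f : 'End(V)) :
  finite_set [set a : C | leigenvalue f a].
Proof.
pose e := vbasis {:V}; have eb : basis_of fullv e := vbasisP _.
pose p := char_poly (mxof e e f).
apply: contrapT => /(@infinite_set_fset _ _ (size p))[B BA leB].
have p0 : p != 0 by rewrite monic_neq0 // char_poly_monic.
have : (size (finmap.enum_fset B) < size p)%N.
  apply: (max_poly_roots p0); last exact: finmap.fset_uniq.
  apply/allP => a /BA /= fa; rewrite -eigenvalue_root_char /eigenvalue; apply: contraNneq fa => fa0.
  by rewrite /leigenvalue (leigenspaceE eb) fa0 vsof0.
by rewrite ltnNge leB.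
Qed.

Hypothesis separated : forall i : 'I_n, exists2 h, h \in cartan g &
  forall mu : n.-tuple int, weight_form mu h = (tnth mu i)%:~R.

(** The sum defining [char] has its intended value only if finitely many weights occur. By
    [separated], each coordinate of a weight is an eigenvalue of one fixed operator, so it has
    finitely many values. *)
Lemma finite_weights (V : lieMod g) :
  finite_set [set mu : n.-tuple int | weight_space V mu != 0%VS].
Proof.
have fin i : exists s : seq int, forall mu : n.-tuple int,
    weight_space V mu != 0%VS -> tnth mu i \in s.
  have [h hc hP] := separated i.
  have [|s es] := (finite_seqP [set z : int | leigenvalue (mod_act V h) z%:~R]).1.
    have := finite_leigenvalue (mod_act V h).
    move=> /(finite_preimage (f := fun z : int => z%:~R)); apply.
    by move=> x y _ _ /eqP; rewrite eqr_int => /eqP.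
  exists s => mu mu0.
  have : [set` s] (tnth mu i); last by [].
  rewrite -es /= /leigenvalue; apply: contraNneq mu0 => e0.
  rewrite -subv0 -e0; apply/subvP => v /weight_spaceP/(_ _ hc) ev.
  by rewrite memv_ker add_lfunE opp_lfunE scale_lfunE id_lfunE ev hP subrr.
have [s sP] := choice fin.
(* All possible coordinates are pooled in one list [t], and a weight is encoded by the positions of
   its coordinates in it. *)
pose t := flatten [seq s i | i : 'I_n].
pose F (k : {ffun 'I_n -> 'I_(size t)}) := [tuple t`_(k i) | i < n].
apply: (sub_finite_set (B := range F)); last exact/finite_image/finite_finset.
move=> mu /= mu0.
have mut i : tnth mu i \in t by apply/flatten_imageP; exists i => //; apply: sP.
have ltt i : (index (tnth mu i) t < size t)%N by rewrite index_mem.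
exists [ffun i => Ordinal (ltt i)] => //.
by apply: eq_from_tnth => i; rewrite tnth_mktuple ffunE /= nth_index.
Qed.

Lemma coeff_char (V : lieMod g) (mu : n.-tuple int) :
  coeff mu (char n V) = (\dim (weight_space V mu))%:Z.
Proof.
have [s es] := (finite_seqP _).1 (finite_weights V).
pose t := undup (mu :: s).
have -> : char n V
    = \sum_(nu <- t) << (\dim (weight_space V nu))%:Z *g nu >>.
  rewrite fsbig_seq ?undup_uniq //; apply/esym/fsbig_widen => // nu [_ /= nt].
  suff /eqP -> : weight_space V nu == 0%VS by rewrite dimv0 freegU0.
  apply: contrapT => /negP nu0; apply: nt.
  have : [set` s] nu by rewrite -es.
  by move=> /= nus; rewrite /= mem_undup inE nus orbT.
rewrite raddf_sum /= (bigD1_seq mu) ?undup_uniq ?mem_undup ?mem_head //=.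
rewrite coeffU eqxx mulr1 big1 ?addr0 // => nu /negPf nu_mu.
by rewrite coeffU nu_mu mulr0.
Qed.

Lemma char_decomposes (W : choiceType) (P : set W) (L : W -> lieMod g) b
    (V : lieMod g) : decomposes_as P L b V ->
  char n V = \sum_(w \in P) char n (L w) *+ b w.
Proof.
move=> [s [f [sP sb fP fdir ffull]]].
have -> : char n V = \sum_(w <- s) char n (L w).
  apply/eqP/freeg_eqP => mu; rewrite coeff_char raddf_sum /=.
  rewrite (dim_weight_space_decomposes mu fP fdir ffull).
  rewrite -natz natr_sum; apply: eq_bigr => w _.
  by rewrite coeff_char natz.
have -> : \sum_(w <- s) char n (L w)
    = \sum_(w <- undup s) char n (L w) *+ count_mem w s.
  by rewrite -[LHS]big_undup_iterop_count.
rewrite fsbig_seq ?undup_uniq //.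
rewrite (eq_fsbigr (fun w => char n (L w) *+ b w)) => [|w]; last first.
  by move=> /set_mem /=; rewrite mem_undup => /sP/sb ->.
apply: fsbig_widen => [w /=|w [/= wP]]; first by rewrite mem_undup => /sP.
move/negP; rewrite mem_undup => ws; rewrite -sb // (count_memPn ws).
by rewrite mulr0n.
Qed.

(** The two sums can be exchanged only over finite sets, and [P] may be infinite. Hence [P] is cut
    down to the set [P'] of labels that occur in the restriction of some [M a] with [a] in [Q]. *)
Lemma char_restrict (W : choiceType) (P : set W) (L : W -> lieMod g)
    (A : choiceType) (Q : set A) (M : A -> lieMod (gl C N))
    (b : A -> W -> nat) (V : lieMod (gl C N)) :
  finite_set Q ->
  decomposes_as Q M (fun=> 1%N) V ->
  (forall a, Q a -> decomposes_as P L (b a) (restrict g (M a))) ->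
  char n (restrict g V) = \sum_(w \in P) \sum_(a \in Q) char n (L w) *+ b a w.
Proof.
move=> finQ [s [f [sQ s1 fP fdir ffull]]] dec.
have -> : char n (restrict g V) = \sum_(a \in Q) char n (restrict g (M a)) *+ 1.
  apply: (@char_decomposes A Q (fun a => restrict g (M a)) (fun=> 1%N)).
  exists s, f; split=> // i; split; last by case: (fP i).
  by move=> x xg; rewrite [LHS](fP i).1 // memvf.
rewrite (eq_fsbigr (fun a => \sum_(w \in P) char n (L w) *+ b a w)); last first.
  by move=> a /set_mem /dec/char_decomposes; rewrite mulr1n.
have [t et] := (finite_seqP _).1 finQ.
have /choice[c cP] a : exists c : seq W, Q a ->
    forall w, P w -> w \notin c -> b a w = 0%N.
  have [Qa|nQa] := pselect (Q a); last by exists [::].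
  have [r [_ [_ rb _ _ _]]] := dec a Qa.
  by exists r => _ w Pw wr; rewrite -rb // (count_memPn wr).
pose P' := P `&` [set` flatten [seq c a | a <- t]].
have P'0 a w : Q a -> (P `\` P') w -> char n (L w) *+ b a w = 0.
  move=> Qa [Pw nw]; rewrite (cP a) // ?mulr0n //; apply/negP => wc; apply: nw.
  split=> //=; apply/flatten_mapP; exists a => //.
  by have -> : (a \in t) = [set` t] a :> Prop by []; rewrite -et.
have finP' : finite_set P' by apply/finite_setIr/finite_seq.
rewrite (eq_fsbigr (fun a => \sum_(w \in P') char n (L w) *+ b a w)); last first.
  move=> a /set_mem Qa; apply/esym/fsbig_widen => [w []//|w Pw].
  exact: P'0.
rewrite exchange_fsbig //; apply: fsbig_widen => [w []//|w Pw].
by apply: fsbig1 => a Qa; apply: P'0.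
Qed.

End CharDecomposition.

(** * Highest weight vectors of gl_N-modules *)

Section LinearExtension.
Variables (F : fieldType) (V W : vectType F) (c : 'I_(\dim {:V}) -> W).

Definition lincomb (u : V) : W := \sum_i coord (vbasis {:V}) i u *: c i.

Lemma lincomb_is_linear : linear lincomb.
Proof.
move=> a x y; rewrite /lincomb scaler_sumr -big_split /=.
by apply: eq_bigr => i _; rewrite linearP scalerDl scalerA.
Qed.

HB.instance Definition _ :=
  GRing.isLinear.Build F V W _ lincomb lincomb_is_linear.

End LinearExtension.

(** Values are chosen on a basis only and extended linearly; the extension stays inside [G] because
    [G] is closed under linear combinations. *)
Lemma lfun_of_relation (F : fieldType) (V W : vectType F) (G : V -> W -> Prop) :
  G 0 0 ->
  (forall a x y x' y', G x x' -> G y y' -> G (a *: x + y) (a *: x' + y')) ->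
  (forall x, exists x', G x x') -> exists f : 'Hom(V, W), forall x, G x (f x).
Proof.
move=> G0 GD /choice[g gP].
exists (linfun (lincomb (fun i => g (vbasis {:V})`_i))) => x.
rewrite lfunE /= {1}(coord_vbasis (memvf x)) /lincomb.
apply: (big_ind2 G) => // [y y' z z' Gy Gz|i _].
  by rewrite -[y]scale1r -[y']scale1r; apply: GD.
by rewrite -[_ *: _]addr0 -[X in G _ X]addr0; apply: GD.
Qed.

Section GlModules.
Variables (C : numFieldType) (N : nat).
Implicit Types V W : lieMod (gl C N).

Definition elt V (i j : 'I_N) : 'End(V) := mod_act V (delta_mx i j).

Lemma gl_actD V x y v :
  mod_act V (x + y) v = mod_act V x v + mod_act V y v.
Proof.
by rewrite -[x]scale1r mod_actZD ?memvf // add_lfunE scale_lfunE !scale1r.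
Qed.

Lemma gl_actZ V a x v : mod_act V (a *: x) v = a *: mod_act V x v.
Proof.
rewrite -[a *: x]addr0 mod_actZD ?memvf // add_lfunE scale_lfunE mod_act0.
by rewrite lfunE /= addr0.
Qed.

Lemma gl_act_elt V x v :
  mod_act V x v = \sum_i \sum_j x i j *: elt V i j v.
Proof.
have act_sum I (r : seq I) (F : I -> 'M[C]_N) :
    mod_act V (\sum_(i <- r) F i) v = \sum_(i <- r) mod_act V (F i) v.
  elim: r => [|i r IHr]; first by rewrite !big_nil mod_act0 lfunE.
  by rewrite !big_cons gl_actD IHr.
rewrite {1}[x]matrix_sum_delta act_sum; apply: eq_bigr => i _.
by rewrite act_sum; apply: eq_bigr => j _; rewrite gl_actZ.
Qed.

Lemma elt_comm V i j k l v :
  elt V i j (elt V k l v) = elt V k l (elt V i j v)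
    + ((elt V i l v) *+ (j == k) - (elt V k j v) *+ (l == i)).
Proof.
have := mod_br V (memvf (delta_mx i j)) (memvf (delta_mx k l)).
move/lfunP/(_ v); rewrite add_lfunE opp_lfunE !comp_lfunE => /eqP.
rewrite eq_sym subr_eq addrC => /eqP ->; congr (_ + _).
rewrite /brmx !mul_delta_mx_cond /elt.
by do 2 case: eqP => _;
  rewrite ?(mulr0n, mulr1n, subr0, sub0r, subrr, mod_act0, lfunE) //=
     -?scaleN1r ?gl_actD ?gl_actZ.
Qed.

Lemma equivariant_elt V W (f : 'Hom(V, W)) :
  (forall i j v, f (elt V i j v) = elt W i j (f v)) -> equivariant f.
Proof.
move=> fE x _; apply/lfunP => v; rewrite !comp_lfunE !gl_act_elt linear_sum.
apply: eq_bigr => i _; rewrite linear_sum; apply: eq_bigr => j _.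
by rewrite linearZ /= fE.
Qed.

Definition hwv V (m : 'I_N -> nat) (v : V) : Prop :=
  (forall i, elt V i i v = (m i)%:R *: v) /\
  (forall i j : 'I_N, (i < j)%N -> elt V i j v = 0).

Lemma hwv_of_highest_weight V (nu : N.-tuple nat) (v : V) :
  highest_weight_vector (weight_of nu) v -> hwv (tnth nu) v.
Proof.
move=> [_ /weight_spaceP vW v0]; split=> [i|i j ij].
  rewrite /elt vW; last first.
    by rewrite memv_cap memvf memv_span //; apply/imageP; exists i.
  congr (_ *: _); rewrite /weight_form (bigD1 i) //= big1 => [|j ji]; last first.
    by rewrite mxE (negPf ji) mulr0.
  rewrite mxE !eqxx mulr1 addr0 (nth_map 0%N) ?size_tuple //.
  by rewrite (tnth_nth 0%N).
apply: v0 => [|k l lk]; first exact: memvf.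
rewrite mxE; case: eqP => //= ki; case: eqP => //= lj; move: ij.
by rewrite -ki -lj ltnNge lk.
Qed.

(* Lowering operators strictly decrease the eigenvalue of this element, so it
   separates a highest weight vector from everything below it. *)
Definition grading V : 'End(V) := \sum_(i < N) (N - i)%:R *: elt V i i.

Lemma gradingE V v : grading V v = \sum_(i < N) (N - i)%:R *: elt V i i v.
Proof. by rewrite sum_lfunE; apply: eq_bigr => i _; rewrite scale_lfunE. Qed.

(** The commutator of the grading element with E_ji is ((N - j) - (N - i)) E_ji. *)
Lemma grading_low V (i j : 'I_N) v (c : C) : (i < j)%N -> grading V v = c *: v ->
  grading V (elt V j i v) = (c - (j - i)%:R) *: elt V j i v.
Proof.
move=> ij gv.
have -> : grading V (elt V j i v) = elt V j i (grading V v)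
    + \sum_(k < N) (N - k)%:R *: (elt V k i v *+ (k == j) - elt V j k v *+ (i == k)).
  rewrite !gradingE linear_sum -big_split /=; apply: eq_bigr => k _.
  by rewrite elt_comm linearZ /= scalerDr.
rewrite gv linearZ scalerBl /=; congr (_ + _).
rewrite (eq_bigr (fun k : 'I_N => (N - k)%:R *: elt V j i v *+ (k == j)
  - (N - k)%:R *: elt V j i v *+ (k == i))) => [|k _]; last first.
  rewrite scalerBr !scalerMnr; congr (_ - _); last by rewrite eq_sym; case: eqP => // ->.
  by case: eqP => // ->.
rewrite sumrB (bigD1 j) //= [X in _ + X - _]big1 => [|k /negPf ->]; last by rewrite mulr0n.
rewrite (bigD1 i) //= [X in _ - (_ + X)]big1 => [|k /negPf ->]; last by rewrite mulr0n.
rewrite !eqxx !addr0 -scalerBl -scaleNr; congr (_ *: _).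
rewrite -opprB -natrB; last by apply: leq_sub2l; apply: ltnW.
congr (- _%:R); rewrite subnBA 1?ltnW // addnC addnBA 1?ltnW //.
by rewrite subnAC addnK.
Qed.

(** Induction on the number of terms: f - a kills the term of eigenvalue a, rescales the others and
    multiplies [u] by c - a, which is nonzero. Eigenvalues may repeat in [s]. *)
Lemma eigenvector_sum_eq0 (V : vectType C) (f : 'End(V)) (c : C)
    (s : seq (C * V)) (u : V) :
  (forall p, p \in s -> p.1 != c /\ f p.2 = p.1 *: p.2) ->
  f u = c *: u -> u = \sum_(p <- s) p.2 -> u = 0.
Proof.
have [n] := ubnP (size s); elim: n s u => // n IHn [|[a x] s] u /= ltn sP fu.
  by rewrite big_nil.
rewrite big_cons /= => eu.
have [ac fx] := sP (a, x) (mem_head _ _).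
pose s1 := [seq (p.1, (p.1 - a) *: p.2) | p <- s].
suff e0 : (c - a) *: u = 0.
  move/eqP: e0; rewrite scaler_eq0 subr_eq0 eq_sym (negPf ac) /=.
  by move=> /eqP.
apply: (IHn s1) => [|p /mapP[q qs ->] /=||].
- by rewrite size_map.
- have [qc fq] := sP q (mem_behead (s := (a, x) :: s) qs).
  by split=> //; rewrite linearZ /= fq !scalerA mulrC.
- by rewrite linearZ /= fu !scalerA mulrC.
rewrite big_map scalerBl -fu eu linearD /= fx scalerDr opprD addrACA subrr add0r.
rewrite linear_sum scaler_sumr -sumrB big_seq [RHS]big_seq.
apply: eq_bigr => q qs; rewrite scalerBl /=.
by have [_ /= ->] := sP q (mem_behead (s := (a, x) :: s) qs).
Qed.

End GlModules.

(** * Embedding irreducible modules into unitary ones *)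

Section HighestWeightGraph.
Variables (C : numFieldType) (N : nat).
Implicit Types V W : lieMod (gl C N).

(* The submodule of V x W generated by (v, w), as a relation. *)
Inductive hwgraph V W (v : V) (w : W) : V -> W -> Prop :=
| hwgraph_zero : hwgraph v w 0 0
| hwgraph_top : hwgraph v w v w
| hwgraph_low (i j : 'I_N) x y : (i < j)%N -> hwgraph v w x y ->
    hwgraph v w (elt V j i x) (elt W j i y)
| hwgraph_lin a x y x' y' : hwgraph v w x y -> hwgraph v w x' y' ->
    hwgraph v w (a *: x + x') (a *: y + y').

Section Graph.
Variables (V W : lieMod (gl C N)) (m : 'I_N -> nat) (v : V) (w : W).
Hypotheses (hv : hwv m v) (hw : hwv m w).
Local Notation G := (hwgraph v w).

Lemma hwgraphZ a x y : G x y -> G (a *: x) (a *: y).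
Proof.
by move=> gxy; rewrite -[a *: x]addr0 -[a *: y]addr0; apply: hwgraph_lin => //;
   apply: hwgraph_zero.
Qed.

Lemma hwgraphD x y x' y' : G x y -> G x' y' -> G (x + x') (y + y').
Proof. by rewrite -[X in G (X + _)]scale1r -[X in G _ (X + _)]scale1r; apply: hwgraph_lin. Qed.

Lemma hwgraphB x y x' y' : G x y -> G x' y' -> G (x - x') (y - y').
Proof.
move=> g1 g2; apply: hwgraphD => //.
by rewrite -[- x']scaleN1r -[- y']scaleN1r; apply: hwgraphZ.
Qed.

Lemma hwgraphMb (b : bool) x y : G x y -> G (x *+ b) (y *+ b).
Proof. by case: b => // _; apply: hwgraph_zero. Qed.

(** Only lowering operators are built into [hwgraph]. Any E_ij is commuted past the outermost
    lowering operator until it meets the top pair, where both vectors have the same weight [m]. *)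
Lemma hwgraph_elt i j x y : G x y -> G (elt V i j x) (elt W i j y).
Proof.
move=> gxy; elim: gxy i j => {x y} [|| k l x y kl gxy IH|a x y x' y' _ IH1 _ IH2] i j.
- by rewrite !linear0; apply: hwgraph_zero.
- have [ji|ij|/val_inj <-] := ltngtP j i.
  + by apply: hwgraph_low => //; apply: hwgraph_top.
  + by rewrite hv.2 // hw.2 //; apply: hwgraph_zero.
  + by rewrite hv.1 hw.1; apply/hwgraphZ/hwgraph_top.
- rewrite [elt V i j _]elt_comm [elt W i j _]elt_comm.
  apply: hwgraphD; first exact: hwgraph_low (IH i j).
  by apply: hwgraphB; apply/hwgraphMb/IH.
- by rewrite !linearP /=; apply: hwgraph_lin.
Qed.

Definition hw_level : C := \sum_(i < N) (N - i)%:R * (m i)%:R.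

Lemma grading_hwv (X : lieMod (gl C N)) (u : X) : hwv m u -> grading X u = hw_level *: u.
Proof.
move=> hu; rewrite gradingE scaler_suml; apply: eq_bigr => i _.
by rewrite hu.1 scalerA.
Qed.

(** Each lowering operator E_ji adds j - i to the depth [p.1]. The point is that the same
    coefficient [a] of the top occurs in both components. *)
Lemma hwgraph_split x y : G x y -> exists a (s : seq (nat * (V * W))),
  [/\ forall p, p \in s ->
        [/\ (0 < p.1)%N, grading V p.2.1 = (hw_level - p.1%:R) *: p.2.1
          & grading W p.2.2 = (hw_level - p.1%:R) *: p.2.2],
      x = a *: v + \sum_(p <- s) p.2.1 & y = a *: w + \sum_(p <- s) p.2.2].
Proof.
elim=> {x y} [||i j x y ij _ [a [s [sP -> ->]]]
  |c x y x' y' _ [a [s [sP -> ->]]] _ [a' [s' [sP' -> ->]]]].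
- by exists 0, [::]; split; rewrite ?big_nil ?scale0r ?addr0.
- by exists 1, [::]; split; rewrite ?big_nil ?scale1r ?addr0.
- exists 0, ((j - i, (a *: elt V j i v, a *: elt W j i w))%N
     :: [seq (p.1 + (j - i), (elt V j i p.2.1, elt W j i p.2.2))%N | p <- s]).
  split.
  + move=> p; rewrite inE => /predU1P[->|/mapP[q /sP[q0 q1 q2] ->]] /=.
      rewrite subn_gt0 ij !linearZ /= (grading_low ij (grading_hwv hv)).
      by rewrite (grading_low ij (grading_hwv hw)) !scalerA mulrC.
    rewrite addn_gt0 q0 (grading_low ij q1) (grading_low ij q2).
    by rewrite natrD opprD addrA.
  + rewrite scale0r add0r big_cons big_map /= linearD linearZ /=.
    by rewrite linear_sum.
  + rewrite scale0r add0r big_cons big_map /= linearD linearZ /=.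
    by rewrite linear_sum.
- exists (c * a + a'), ([seq (p.1, (c *: p.2.1, c *: p.2.2)) | p <- s] ++ s').
  split.
  + move=> p; rewrite mem_cat => /orP[/mapP[q /sP[q0 q1 q2] ->] /=|/sP' //].
    by rewrite q0 !linearZ /= q1 q2 !scalerA !(mulrC c).
  + rewrite big_cat big_map /= scalerDr scaler_sumr scalerDl scalerA.
    by rewrite addrACA.
  + rewrite big_cat big_map /= scalerDr scaler_sumr scalerDl scalerA.
    by rewrite addrACA.
Qed.

Lemma level_neq (d : nat) : (0 < d)%N -> hw_level - d%:R != hw_level.
Proof.
by move=> d0; rewrite -subr_eq0 addrAC subrr sub0r oppr_eq0 pnatr_eq0 -lt0n.
Qed.

End Graph.
End HighestWeightGraph.

Section Unitary.
Variables (C : numClosedFieldType) (N : nat) (W : lieMod (gl C N)).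
Variable H : W -> W -> C.
Hypothesis H_lin : forall a x y z, H (a *: x + y) z = a * H x z + H y z.
Hypothesis H_conj : forall x y, H y x = (H x y)^*.
Hypothesis H_pos : forall x, x != 0 -> 0 < H x x.
Hypothesis H_adj : forall i j x y, H (elt W i j x) y = H x (elt W j i y).

Lemma hermD x y z : H (x + y) z = H x z + H y z.
Proof. by have := H_lin 1 x y z; rewrite scale1r mul1r. Qed.

Lemma herm0l z : H 0 z = 0.
Proof. by apply: (addrI (H 0 z)); rewrite -hermD !addr0. Qed.

Lemma hermZ a x z : H (a *: x) z = a * H x z.
Proof. by have := H_lin a x 0 z; rewrite herm0l !addr0. Qed.

Lemma herm_suml I (r : seq I) (F : I -> W) z :
  H (\sum_(i <- r) F i) z = \sum_(i <- r) H (F i) z.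
Proof. by elim: r => [|i r IHr]; rewrite ?big_nil ?herm0l // !big_cons hermD IHr. Qed.

Lemma herm_lin_r a x y z : H z (a *: x + y) = a^* * H z x + H z y.
Proof. by rewrite !(H_conj _ z) H_lin rmorphD rmorphM. Qed.

Lemma herm0r z : H z 0 = 0.
Proof. by rewrite H_conj herm0l conjC0. Qed.

Lemma herm_eq0 x : H x x = 0 -> x = 0.
Proof.
by move=> Hx; apply/eqP; apply: contraTT isT => /H_pos; rewrite Hx ltxx.
Qed.

Lemma herm_eigen_orth (f : W -> W) (a b : C) x y :
  (forall x y, H (f x) y = H x (f y)) -> b \is Num.real -> a != b ->
  f x = a *: x -> f y = b *: y -> H x y = 0.
Proof.
move=> fH br ab fx fy; have := fH x y.
rewrite fx fy hermZ -[b *: y]addr0 herm_lin_r herm0r addr0 (CrealP br).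
move/eqP; rewrite -subr_eq0 -mulrBl mulf_eq0 subr_eq0 (negPf ab) /=.
by move/eqP.
Qed.

Lemma hwv_orth m m' (x y : W) : hwv m x -> hwv m' y -> (exists i, m i != m' i) ->
  H x y = 0.
Proof.
move=> hx hy [i mi]; apply: herm_eigen_orth (hx.1 i) (hy.1 i).
- exact: H_adj.
- exact: realn.
- by rewrite eqr_nat.
Qed.

(** The squared norm of E_ji x is (m_i - m_j) times that of x, and it cannot be negative. *)
Lemma hwv_dominant m (x : W) (i j : 'I_N) : x != 0 -> hwv m x -> (i < j)%N ->
  (m j <= m i)%N.
Proof.
move=> x0 hx ij.
have : 0 <= H (elt W j i x) (elt W j i x).
  have [->|/H_pos/ltW//] := eqVneq (elt W j i x) 0; by rewrite herm0l.
rewrite -H_adj elt_comm hx.2 // linear0 add0r !eqxx !hx.1 -scalerBl hermZ.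
by rewrite pmulr_lge0 ?H_pos // subr_ge0 ler_nat.
Qed.

(** Pairing with a basis of [S] is an injective linear map into row vectors of length \dim S, so the
    dimension of W is at most that of S. *)
Lemma complement_full (S : {vspace W}) :
  (forall x, (forall y, y \in S -> H x y = 0) -> x = 0) -> S = fullv.
Proof.
move=> S0.
pose phi (x : W) : 'rV[C]_(\dim S) := \row_i H x (vbasis S)`_i.
have phi_lin : linear phi.
  by move=> a x y; apply/rowP => i; rewrite !mxE H_lin.
pose phiL := GRing.isLinear.Build _ _ _ _ phi phi_lin.
pose philin : {linear W -> 'rV[C]_(\dim S)} := HB.pack phi phiL.
have ker0 : lker (linfun philin) = 0%VS.
  apply/eqP; rewrite -subv0; apply/subvP => x; rewrite memv_ker lfunE /=.
  move=> /eqP/rowP phix; rewrite memv0; apply/eqP/S0 => y /coord_vbasis ->.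
  rewrite H_conj herm_suml big1 ?conjC0 // => i _.
  by have := phix i; rewrite !mxE hermZ => phi0; rewrite H_conj phi0 conjC0 mulr0.
apply/eqP; rewrite eqEdim subvf /=.
have := limg_ker_dim (linfun philin) fullv.
rewrite ker0 capv0 dimv0 add0n => <-.
by apply: leq_trans (dimvS (subvf _)) _; rewrite dimvf /dim /= mul1n.
Qed.

Section Embedding.
Variables (V : lieMod (gl C N)) (m : 'I_N -> nat) (v : V) (w : W).
Hypotheses (irrV : irreducible_mod V) (v0 : v != 0) (hv : hwv m v).
Hypotheses (w0 : w != 0) (hw : hwv m w).
Local Notation G := (hwgraph v w).

Lemma irreducible_pred (P : V -> Prop) : P 0 ->
  (forall a x y, P x -> P y -> P (a *: x + y)) ->
  (forall i j x, P x -> P (elt V i j x)) ->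
  (forall x, P x -> x = 0) \/ (forall x, P x).
Proof.
move=> P0 Plin PE; have [U UP] := vspace_of_closed P0 Plin.
have [] := irrV.2 U.
- move=> x _; apply/subvP => _ /memv_imgP[y /UP Py ->]; apply/UP.
  rewrite gl_act_elt.
  have Psum (F : 'I_N -> V) : (forall i, P (F i)) -> P (\sum_i F i).
    by move=> PF; apply: big_ind => // y1 y2 P1 P2; rewrite -[y1]scale1r; apply: Plin.
  apply/Psum => i; apply/Psum => j; rewrite -[_ *: _]addr0; apply: Plin => //; exact: PE.
- by move=> U0; left=> x /UP; rewrite U0 memv0 => /eqP.
- by move=> Uf; right=> x; apply/UP; rewrite Uf memvf.
Qed.

Lemma hwgraph_total x : exists y, G x y.
Proof.
have [||||] := @irreducible_pred (fun x => exists y, G x y) => //.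
- by exists 0; apply: hwgraph_zero.
- by move=> a x1 x2 [y1 G1] [y2 G2]; exists (a *: y1 + y2); apply: hwgraph_lin.
- by move=> i j x1 [y1 G1]; exists (elt W i j y1); apply: hwgraph_elt hv hw _ _ _ _ G1.
move=> /(_ v) vz; move/eqP: v0; case; apply: vz; exists w; exact: hwgraph_top.
Qed.

(** A vector related to 0 is orthogonal to all second components, by induction on how these are
    generated: a lowering operator moves across [H] as a raising operator, under which the relation
    is stable. Such a vector is orthogonal to itself. *)
Lemma hwgraph_fun y : G 0 y -> y = 0.
Proof.
suff orth y' : G 0 y' -> forall x z, G x z -> H y' z = 0.
  by move=> Gy; apply/herm_eq0/(orth _ Gy 0).
move=> Gy' x z Gxz; elim: Gxz y' Gy' => {x z} [||i j x z ij Gxz IH|a x z x' z' _ IH1 _ IH2] y' Gy'.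
- exact: herm0r.
- have [a [s [sP es ey]]] := hwgraph_split hv hw Gy'.
  (* Otherwise [v] would be a sum of eigenvectors of [grading] whose eigenvalues all differ from its
     own. *)
  have a0 : a = 0.
    apply/eqP; apply: contraTT isT => a0; move: (v0).
    rewrite (@eigenvector_sum_eq0 _ _ (grading V) (hw_level C m)
      [seq (hw_level C m - p.1%:R, (- a^-1) *: p.2.1) | p <- s] v) ?eqxx //.
    + move=> _ /mapP[q /sP[q0 q1 q2] ->] /=; split; first exact: level_neq.
      by rewrite linearZ /= q1 !scalerA mulrC.
    + exact: grading_hwv.
    + rewrite big_map -scaler_sumr /= scaleNr -scalerN.
      have -> : - (\sum_(p <- s) p.2.1) = a *: v.
        by apply/eqP; rewrite eq_sym -addr_eq0 -es.
      by rewrite scalerA mulVf // scale1r.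
  rewrite ey a0 scale0r add0r herm_suml big_seq big1 // => p /sP[p0 _ p2].
  apply: herm_eigen_orth p2 (grading_hwv hw) => [x1 x2||].
  + rewrite !gradingE herm_suml H_conj herm_suml rmorph_sum.
    apply: eq_bigr => i _; rewrite !hermZ rmorphM /= -H_conj H_adj.
    by rewrite (CrealP (realn _ _)).
  + by apply: sum_real => i _; rewrite realM ?realn.
  + exact: level_neq.
- rewrite -H_adj; apply: IH.
  by rewrite -(linear0 (elt V i j)); apply: hwgraph_elt hv hw _ _ _ _ Gy'.
- by rewrite herm_lin_r IH1 // IH2 // mulr0 addr0.
Qed.

(** The vectors related to 0 form a submodule of the irreducible [V]. If it were all of [V], then
    subtracting (v, 0) from (v, w) would relate 0 to [w]. *)
Lemma hwgraph_inj x : G x 0 -> x = 0.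
Proof.
have [|||E|E] := @irreducible_pred (fun x => G x 0).
- exact: hwgraph_zero.
- by move=> a x1 x2 G1 G2; have := hwgraph_lin a G1 G2; rewrite scaler0 addr0.
- by move=> i j x1 G1; have := hwgraph_elt hv hw i j G1; rewrite linear0.
- exact: E.
have Gvw : G 0 w.
  have := hwgraph_lin (-1) (E v) (hwgraph_top v w).
  by rewrite scaleN1r addNr scaler0 add0r.
by move/eqP: w0; case; apply: hwgraph_fun.
Qed.

Lemma hw_embedding : exists f : 'Hom(V, W),
  [/\ equivariant f, lker f = 0%VS, f v = w & forall x, G x (f x)].
Proof.
have [|||f fG] := @lfun_of_relation _ V W G; [exact: hwgraph_zero| |exact: hwgraph_total|].
  by move=> *; apply: hwgraph_lin.
have uniq_f x y : G x y -> f x = y.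
  move=> Gxy; apply/eqP; rewrite -subr_eq0; apply/eqP/hwgraph_fun.
  have := hwgraph_lin (-1) Gxy (fG x).
  by rewrite !scaleN1r addNr addrC.
exists f; split=> //.
- apply: equivariant_elt => i j x; apply: uniq_f.
  exact: hwgraph_elt hv hw _ _ _ _ (fG x).
- apply/eqP; rewrite -subv0; apply/subvP => x; rewrite memv_ker memv0 => /eqP fx.
  by apply/eqP/hwgraph_inj; rewrite -fx.
- by apply/uniq_f/hwgraph_top.
Qed.

End Embedding.

End Unitary.

Section TorusShift.
Variables (C : numFieldType) (N : nat) (W : lieMod (gl C N)).

(* If these operators vanish for large [t], then the eigenvalues of E_ii are
   natural numbers; this replaces a weight space decomposition. *)
Fixpoint torus_falling (i : 'I_N) (t : nat) (x : W) : W :=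
  if t is t'.+1 then elt W i i (torus_falling i t' x) - t'%:R *: torus_falling i t' x
  else x.

Lemma torus_falling_lin i t a x y :
  torus_falling i t (a *: x + y) = a *: torus_falling i t x + torus_falling i t y.
Proof.
elim: t => //= t ->; rewrite linearP /= scalerDr scalerBr opprD addrACA.
by rewrite !scalerA mulrC.
Qed.

Lemma torus_falling_eq0 i t x (k : nat) : (k < t)%N -> elt W i i x = k%:R *: x ->
  torus_falling i t x = 0.
Proof.
move=> kt ex; have E u : elt W i i (torus_falling i u x) = k%:R *: torus_falling i u x.
  by elim: u => //= u IHu; rewrite linearB linearZ /= IHu linearZ /= IHu
    scalerBr !scalerA (mulrC u%:R).
elim: t kt => // t IHt; rewrite ltnS leq_eqVlt => /predU1P[<- /=|/IHt /= ->].
  by rewrite E subrr.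
by rewrite linear0 scaler0 subrr.
Qed.

End TorusShift.

Section UnitaryDecomposition.
Variables (C : numClosedFieldType) (N : nat) (W : lieMod (gl C N)).
Variable H : W -> W -> C.
Hypothesis H_lin : forall a x y z, H (a *: x + y) z = a * H x z + H y z.
Hypothesis H_conj : forall x y, H y x = (H x y)^*.
Hypothesis H_pos : forall x, x != 0 -> 0 < H x x.
Hypothesis H_adj : forall i j x y, H (elt W i j x) y = H x (elt W j i y).

Variable B : nat.
Hypothesis torus_bound : forall i (x : W), torus_falling i B x = 0.

Lemma torus_eigenvalue i (x : W) (c : C) : x != 0 -> elt W i i x = c *: x ->
  exists k : 'I_B, c = (k : nat)%:R.
Proof.
move=> x0 ex.
have E t : torus_falling i t x = (\prod_(u < t) (c - u%:R)) *: x.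
  elim: t => [|t IHt]; first by rewrite big_ord0 scale1r.
  rewrite /= IHt linearZ /= ex big_ord_recr /= mulrBr scalerBl !scalerA.
  by congr (_ - _ *: _); rewrite mulrC.
have /eqP := torus_bound i x; rewrite E scaler_eq0 (negPf x0) orbF.
by case/prodf_eq0 => k _; rewrite subr_eq0 => /eqP ->; exists k.
Qed.

(** [P] plays the role of a submodule. Among the joint torus eigenvectors in [P], one whose weight
    maximises [pot] is killed by all raising operators. *)
Lemma exists_hwv (P : W -> Prop) x : x != 0 -> P x ->
  (forall a x y, P x -> P y -> P (a *: x + y)) ->
  (forall i j x, P x -> P (elt W i j x)) ->
  exists m y, [/\ y != 0, P y & hwv m y].
Proof.
move=> x0 Px Plin PE.
have torus_ev (s : seq 'I_N) : exists y, [/\ y != 0, P y &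
    forall i, i \in s -> exists2 k, (k < B)%N & elt W i i y = k%:R *: y].
  elim: s => [|i s [y [y0 Py sy]]]; first by exists x.
  (* If the falling product vanishes at t + 1 but not at t, then its value at t is an eigenvector of
     E_ii for the eigenvalue t. *)
  pose Q t := torus_falling i t y != 0.
  have exQ : exists t, Q t by exists 0%N.
  have bQ t : Q t -> (t <= B)%N.
    move=> Qt; rewrite leqNgt; apply: contraNN Qt => /ltnW Bt.
    rewrite -(subnKC Bt); elim: (t - B)%N => [|u /eqP IHu].
      by rewrite addn0 torus_bound.
    by rewrite addnS /= IHu linear0 scaler0 subrr.
  case: (ex_maxnP exQ bQ) => t Qt tmax; exists (torus_falling i t y).
  have Pt u : P (torus_falling i u y).
    by elim: u => //= u IHu; rewrite addrC -scaleNr; apply: Plin => //; apply: PE.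
  have tB : (t < B)%N.
    rewrite ltn_neqAle (bQ _ Qt) andbT; apply: contraNneq Qt => ->.
    by rewrite torus_bound.
  split=> // j; rewrite inE => /predU1P[->|js].
    exists t => //; apply/eqP; rewrite -subr_eq0.
    by apply: contraT => Qt1; have := tmax t.+1 Qt1; rewrite ltnn.
  have [k kB ek] := sy j js; exists k => //.
  elim: {Qt tmax tB Pt} t => //= u IHu.
  rewrite linearB linearZ /= IHu elt_comm IHu.
  have [->|ji] := eqVneq j i; last by rewrite mulr0n subrr addr0 linearZ scalerBr !scalerA mulrC.
  by rewrite subrr addr0 linearZ scalerBr !scalerA mulrC.
(* E_ij with i < j raises [pot] by j - i; since eigenvalues stay below [B], [pot] is bounded. *)
pose pot (m : {ffun 'I_N -> 'I_B}) := (\sum_(i < N) (N - i) * m i)%N.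
pose Q t := `[< exists (m : {ffun 'I_N -> 'I_B}) (y : W), [/\ y != 0, P y,
  forall i, elt W i i y = (m i : nat)%:R *: y
  & pot m = t] >].
have exQ : exists t, Q t.
  have [y [y0 Py /= ty]] := torus_ev (enum 'I_N).
  have /choice[k kP] i : exists k : 'I_B, elt W i i y = (k : nat)%:R *: y.
    by have [|k kB ky] := ty i; rewrite ?mem_enum //; exists (Ordinal kB).
  exists (pot (finfun k)); apply/asboolP; exists (finfun k), y.
  by split=> // i; rewrite ffunE.
have bQ t : Q t -> (t <= \sum_(i < N) N * B)%N.
  move=> /asboolP[m [y [_ _ _ <-]]]; apply: leq_sum => i _.
  by rewrite leq_mul ?leq_subr // ltnW.
case: (ex_maxnP exQ bQ) => t /asboolP[m [y [y0 Py my <-]]] tmax.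
exists (fun i => m i), y; split=> //; split=> // i j ij.
apply/eqP; apply: contraT => ey0.
have mE k : elt W k k (elt W i j y) = ((m k)%:R + (k == i)%:R - (k == j)%:R) *: elt W i j y.
  rewrite elt_comm my linearZ /= scalerBl scalerDl -addrA; congr (_ + (_ - _)).
    by case: eqP => [->|_]; rewrite ?scale1r ?scale0r.
  by rewrite eq_sym; case: eqP => [->|_]; rewrite ?scale1r ?scale0r.
have /choice[m' m'P] k := torus_eigenvalue ey0 (mE k).
have : Q (pot (finfun m')).
  apply/asboolP; exists (finfun m'), (elt W i j y); split=> // [|k].
    exact: PE.
  by rewrite ffunE -m'P mE.
move/tmax; rewrite leqNgt => /negP[]; rewrite -(ltr_nat C) /pot !natr_sum.
rewrite [ltRHS](_ : _ = \sum_(k < N) (N - k)%:R * (m k)%:R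
   + \sum_(k < N) ((N - k)%:R *+ (k == i) - (N - k)%:R *+ (k == j))); last first.
  rewrite -big_split /=; apply: eq_bigr => k _.
  by rewrite natrM ffunE -m'P -addrA mulrDr mulrBr !mulr_natr.
under eq_bigr do rewrite natrM.
rewrite ltrDl sumrB.
rewrite (bigD1 i) //= big1 => [|k /negPf ->]; last by rewrite mulr0n.
rewrite (bigD1 j) //= big1 => [|k /negPf ->]; last by rewrite mulr0n.
by rewrite !eqxx !addr0 subr_gt0 ltr_nat ltn_sub2l.
Qed.

Variables (Q : seq (N.-tuple nat)) (Vgl : N.-tuple nat -> lieMod (gl C N)).
Hypothesis Q_uniq : uniq Q.
Hypothesis Vgl_hw : forall nu, nu \in Q ->
  irreducible_of_highest_weight (Vgl nu) (weight_of nu).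
Hypothesis hw_exists : forall nu, nu \in Q -> exists2 w : W, w != 0 & hwv (tnth nu) w.
Hypothesis hw_weights : forall m (x : W), x != 0 -> hwv m x ->
  (forall i j : 'I_N, (i < j)%N -> (m j <= m i)%N) ->
  exists2 nu, nu \in Q & m =1 tnth nu.
Hypothesis hw_unique : forall m (x y : W), x != 0 -> hwv m x -> hwv m y ->
  exists c, y = c *: x.

(** The images of the V(nu) are mutually orthogonal. If their sum had a nonzero orthogonal
    complement, this would contain a highest weight vector, which by [hw_weights] and [hw_unique]
    lies in one of the images: it would be orthogonal to itself. *)
Lemma unitary_decomposition (A : set (N.-tuple nat)) :
  (forall nu, A nu <-> nu \in Q) -> decomposes_as A Vgl (fun=> 1%N) W.
Proof.
move=> AQ.
(* The zero map is a default outside [Q], so that [F] can be chosen as a total function. *)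
have fex nu : exists f : 'Hom(Vgl nu, W), nu \in Q ->
    [/\ equivariant f, lker f = 0%VS & exists v w,
      [/\ w != 0, hwv (tnth nu) w, f v = w & forall x, hwgraph v w x (f x)]].
  have [nuQ|nuQ] := boolP (nu \in Q); last by exists 0.
  have [irr [v vP]] := Vgl_hw nuQ.
  have v0 : v != 0 by case: vP.
  have hv := hwv_of_highest_weight vP.
  have [w w0 hw] := hw_exists nuQ.
  have [f [f1 f2 f3 f4]] := hw_embedding H_lin H_conj H_pos H_adj irr v0 hv w0 hw.
  by exists f => _; split=> //; exists v, w.
pose F nu := projT1 (cid (fex nu)).
have FP nu : nu \in Q -> [/\ equivariant (F nu), lker (F nu) = 0%VS &
    exists v w, [/\ w != 0, hwv (tnth nu) w, F nu v = w
      & forall x, hwgraph v w x (F nu x)]].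
  exact: projT2 (cid (fex nu)).
have FE nu i j x : nu \in Q -> F nu (elt (Vgl nu) i j x) = elt W i j (F nu x).
  by move=> /FP[+ _ _] => /(_ _ (memvf (delta_mx i j))) eF; rewrite -!comp_lfunE eF.
have F_orth nu nu' x y : nu \in Q -> nu' \in Q -> nu != nu' ->
    H (F nu x) (F nu' y) = 0.
  move=> nuQ nuQ' nn.
  have [_ _ [v [w [w0 hw _ Gx]]]] := FP _ nuQ.
  have [_ _ [v' [w' [w0' hw' _ Gy]]]] := FP _ nuQ'.
  (* Lowering operators on the left become raising operators on w', which they kill; what remains is
     the orthogonality of highest weight vectors of distinct weights. *)
  have Hw' a b : hwgraph v w a b -> H b w' = 0.
    elim=> {a b} [||i j a b ij _ IH|c a b a' b' _ IH1 _ IH2].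
    - by rewrite (herm0l H_lin).
    - apply: (hwv_orth H_lin H_conj H_adj hw hw').
      apply: contrapT => nex; move/negP: nn; apply; apply/eqP/eq_from_tnth => i.
      by apply/eqP; apply: contrapT => /negP ni; apply: nex; exists i.
    - by rewrite H_adj hw'.2 // (herm0r H_lin H_conj).
    - by rewrite H_lin IH1 IH2 mulr0 addr0.
  elim: (Gy y) x => {y} [||i j a b ij _ IH|c a b a' b' _ IH1 _ IH2] x.
  - by rewrite (herm0r H_lin H_conj).
  - exact: Hw' (Gx x).
  - by rewrite -H_adj -FE // IH.
  - by rewrite (herm_lin_r H_lin H_conj) IH1 IH2 mulr0 addr0.
have inQ (i : 'I_(size Q)) : tnth (in_tuple Q) i \in Q by apply: mem_tnth.
have tn_neq (i j : 'I_(size Q)) : i != j ->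
    tnth (in_tuple Q) i != tnth (in_tuple Q) j.
  by rewrite !(tnth_nth [tuple of nseq N 0%N]) nth_uniq.
exists Q, (fun i => F (tnth (in_tuple Q) i)); split.
- by move=> nu /AQ.
- by move=> nu /AQ nuQ; rewrite count_uniq_mem // nuQ.
- by move=> i; have [] := FP _ (inQ i).
- apply/directv_sum_independent => u uF u0 i _.
  apply: (herm_eq0 H_pos); transitivity (H (\sum_j u j) (u i)); last first.
    by rewrite u0 (herm0l H_lin).
  rewrite (herm_suml H_lin) (bigD1 i) //= big1 ?addr0 // => j ji.
  have /memv_imgP[x _ ->] := uF i isT; have /memv_imgP[y _ ->] := uF j isT.
  by apply: F_orth => //; apply: tn_neq.
- apply: (complement_full H_lin H_conj) => x xS; apply/eqP.
  apply: contraT => x0.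
  have [|||m [y [y0 yS hy]]] := @exists_hwv (fun x => forall nu u, nu \in Q ->
    H x (F nu u) = 0) x x0.
  + move=> nu u nuQ; apply: xS.
    have /tnthP[i ei] : nu \in in_tuple Q by [].
    have sub : (limg (F nu) <= \sum_i limg (F (tnth (in_tuple Q) i)))%VS.
      by apply: (sumv_sup i); rewrite // ei subvv.
    by apply/(subvP sub); rewrite memv_img ?memvf.
  + by move=> a y z yS zS nu u nuQ; rewrite H_lin yS // zS // mulr0 addr0.
  + by move=> i j y yS nu u nuQ; rewrite H_adj -FE // yS.
  have [nu nuQ em] := hw_weights y0 hy (fun i j => hwv_dominant H_lin H_pos H_adj y0 hy).
  have [_ _ [v [w [w0 hw fv _]]]] := FP _ nuQ.
  have hw' : hwv m w by case: hw => hw1 hw2; split=> // i; rewrite hw1 em.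
  have [c ey] := hw_unique w0 hw' hy.
  have := yS nu v nuQ; rewrite fv {1}ey (hermZ H_lin) => /eqP.
  rewrite mulf_eq0 (gt_eqF (H_pos w0)) orbF => /eqP c0.
  by rewrite ey c0 scale0r eqxx in y0.
Qed.

End UnitaryDecomposition.

(** * The Fischer form *)

Section Fischer.
Variables (C : numClosedFieldType) (n : nat).
Implicit Types p q : {mpoly C[n]}.

Definition mnm_fact (m : 'X_{1..n}) : nat := (\prod_(i < n) (m i)`!)%N.

Definition fischer p q : C :=
  \sum_(m <- msupp p) p@_m * (q@_m)^* * (mnm_fact m)%:R.

Lemma fischer_widen (s : seq 'X_{1..n}) p q :
  uniq s -> {subset msupp p <= s} ->
  fischer p q = \sum_(m <- s) p@_m * (q@_m)^* * (mnm_fact m)%:R.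
Proof.
move=> us sub; rewrite [RHS](bigID (mem (msupp p))) /= [X in _ + X]big1 ?addr0.
  rewrite -big_filter; apply: perm_big; apply: uniq_perm.
  - exact: msupp_uniq.
  - exact: filter_uniq.
  - by move=> m; rewrite mem_filter; case: (boolP (m \in msupp p)) => // /sub ->.
by move=> m /memN_msupp_eq0 ->; rewrite !mul0r.
Qed.

Lemma fischer_lin a p p' q :
  fischer (a *: p + p') q = a * fischer p q + fischer p' q.
Proof.
pose s := undup (msupp (a *: p + p') ++ msupp p ++ msupp p').
have us : uniq s by apply: undup_uniq.
rewrite !(@fischer_widen s) //; try by
  move=> m hm; rewrite mem_undup !mem_cat hm ?orbT.
rewrite mulr_sumr -big_split /=; apply: eq_bigr => m _.
by rewrite mcoeffD mcoeffZ !mulrDl !mulrA.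
Qed.

Lemma fischerZ a p q : fischer (a *: p) q = a * fischer p q.
Proof.
have := fischer_lin a p 0 q; rewrite addr0 => ->.
by rewrite {2}/fischer msupp0 big_nil addr0.
Qed.

Lemma fischer_conj p q : fischer q p = (fischer p q)^*.
Proof.
pose s := undup (msupp p ++ msupp q).
have us : uniq s by apply: undup_uniq.
rewrite !(@fischer_widen s) //; try by
  move=> m hm; rewrite mem_undup !mem_cat hm ?orbT.
rewrite rmorph_sum; apply: eq_bigr => m _.
by rewrite !rmorphM /= conjCK conjC_nat [q@_m * _]mulrC.
Qed.

Lemma fischer_pos p : p != 0 -> 0 < fischer p p.
Proof.
move=> p0; have ge0 m : 0 <= p@_m * (p@_m)^* * (mnm_fact m)%:R.
  by rewrite mulr_ge0 ?ler0n // mul_conjC_ge0.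
rewrite lt0r sumr_ge0 // andbT; apply: contraNneq p0 => /eqP.
rewrite psumr_eq0 // => /allP h; apply/eqP/mpolyP => m; rewrite mcoeff0.
have [mp|/memN_msupp_eq0//] := boolP (m \in msupp p).
have := h m mp; rewrite /= mulf_eq0 mul_conjC_eq0 => /orP[/eqP//|].
by rewrite pnatr_eq0 (gtn_eqF (prodn_gt0 _)) // => i; apply: fact_gt0.
Qed.

Lemma fischer_suml I (r : seq I) (F : I -> {mpoly C[n]}) q :
  fischer (\sum_(i <- r) F i) q = \sum_(i <- r) fischer (F i) q.
Proof.
have f0 : fischer 0 q = 0 by rewrite /fischer msupp0 big_nil.
elim: r => [|i r IHr]; first by rewrite !big_nil.
by rewrite !big_cons -IHr -[F i]scale1r fischer_lin mul1r scale1r.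
Qed.

Lemma fischerX m q : fischer 'X_[m] q = (q@_m)^* * (mnm_fact m)%:R.
Proof. by rewrite /fischer msuppX big_seq1 mcoeffX eqxx mul1r. Qed.

Lemma mnm_factU m i : mnm_fact (m + U_(i)) = ((m i).+1 * mnm_fact m)%N.
Proof.
rewrite /mnm_fact (bigD1 i) //= [in RHS](bigD1 i) //= mulnA.
congr (_ * _)%N; first by rewrite mnmDE mnm1E eqxx addn1 factS.
apply: eq_bigr => j /negPf ji; rewrite mnmDE mnm1E eq_sym ji addn0 //.
Qed.

(** On monomials, (m + U_i)! = (m_i + 1) m!, and m_i + 1 is the factor produced by the derivative.
    This is the reason for the weights [mnm_fact]. *)
Lemma fischer_mulX i p q : fischer ('X_i * p) q = fischer p q^`M(i).
Proof.
rewrite [p]mpolyE mulr_sumr !fischer_suml; apply: eq_bigr => m _.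
rewrite -scalerAr -mpolyXD.
rewrite !fischerZ !fischerX mcoeff_mderiv addmC mnm_factU rmorphMn /=.
congr (_ * _); rewrite natrM mulrA; congr (_ * _).
by rewrite mulr_natr.
Qed.

Lemma fischer_mderiv i p q : fischer p^`M(i) q = fischer p ('X_i * q).
Proof. by rewrite fischer_conj -fischer_mulX -fischer_conj. Qed.

End Fischer.

(** * The symmetric or exterior square on the Lie algebra of a form *)

Lemma mpoly_alg_ind (R : comNzRingType) (n : nat) (P : {mpoly R[n]} -> Prop) :
  P 1 -> (forall a p q, P p -> P q -> P (a *: p + q)) ->
  (forall i p, P p -> P ('X_i * p)) -> forall p, P p.
Proof.
move=> P1 Plin PX.
have P0 : P 0.
  have e : -1 *: (1 : {mpoly R[n]}) + 1 = 0 by rewrite scaleN1r addNr.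
  by rewrite -e; apply: Plin.
have Pm m : P 'X_[m].
  have [k] := ubnP (mdeg m); elim: k m => // k IHk m mk.
  have [->|] := eqVneq m 0%MM; first by rewrite mpolyX0.
  rewrite -mdeg_eq0 mdegE => /eqP; have [i mi|m0] := pickP (fun i => m i != 0%N).
    have Ule : (U_(i) <= m)%MM.
      by apply/mnm_lepP => l; rewrite mnm1E; case: eqP => // <-; rewrite lt0n.
    rewrite -(submK Ule) addmC mpolyXD => _; apply: PX; apply: IHk.
    by move: mk; rewrite -{1}(submK Ule) mdegD mdeg1 addn1 ltnS.
  by case; apply: big1 => i _; apply/eqP; move: (m0 i) => /negbFE.
apply: mpolyind => [//|c m p _ _ Pp]; exact: Plin.
Qed.

(** Two module structures on one space may differ off g, while weight spaces see only the Cartan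
    subalgebra. *)
Lemma char_eq_act (C : fieldType) (N : nat) (g : mxLie C N) n (V : vectType C)
    (a a' : 'M[C]_N -> 'End(V)) l b l' b' :
  {in g, a =1 a'} ->
  char n (@LieMod C N g V a l b) = char n (@LieMod C N g V a' l' b').
Proof.
move=> aa'; rewrite /char; apply: eq_fsbigr => mu _.
have /vspaceP e : forall v : V, (v \in weight_space (@LieMod C N g V a l b) mu)
    = (v \in weight_space (@LieMod C N g V a' l' b') mu).
  move=> v; apply/idP/idP => /weight_spaceP hv; apply/weight_spaceP => h hc.
    by have := hv h hc; rewrite /= aa' // cartan_sub.
  by have := hv h hc; rewrite /= aa' // cartan_sub.
by rewrite [weight_space _ _]e.
Qed.

Section FormModule.
Variables (C : fieldType) (N : nat) (J : 'M[C]_N) (eta : C).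
Hypotheses (J_unit : J \in unitmx) (J_tr : J^T = - (eta *: J)) (eta2 : eta * eta = 1).
Local Notation g := (form_lie J).

(* For y = z J in g this is (x z + z x^T) J; on x in g it is the bracket. *)
Definition twist (x y : 'M[C]_N) : 'M[C]_N :=
  x *m y + y *m (invmx J *m x^T *m J).

Lemma twist_linl a x x' y : twist (a *: x + x') y = a *: twist x y + twist x' y.
Proof.
rewrite /twist linearP /= mulmxDr -scalemxAr !mulmxDl !mulmxDr -!scalemxAl.
by rewrite -scalemxAr scalerDr addrACA.
Qed.

Lemma twist_linr a x y y' : twist x (a *: y + y') = a *: twist x y + twist x y'.
Proof.
by rewrite /twist mulmxDr mulmxDl -scalemxAr -scalemxAl scalerDr addrACA.
Qed.

Lemma in_form (y : 'M[C]_N) : (y \in g) = (y^T *m J == - (J *m y)).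
Proof. by rewrite -addr_eq0; apply/form_spaceP/eqP. Qed.

(** In the coordinate z = y J^-1 the Lie algebra consists of the symmetric (eta = 1) or skew (eta =
    -1) matrices. *)
Lemma in_form_mul (z : 'M[C]_N) : (z *m J \in g) = (z^T == eta *: z).
Proof.
rewrite in_form trmx_mul J_tr !mulNmx eqr_opp -!scalemxAl -mulmxA scalemxAr.
rewrite (can_eq (mulKmx J_unit)) scalemxAl (can_eq (mulmxK J_unit)).
apply/eqP/eqP => [e|->]; last by rewrite scalerA eta2 scale1r.
by rewrite -[in RHS]e scalerA eta2 scale1r.
Qed.

Lemma twist_mul x z : twist x (z *m J) = (x *m z + z *m x^T) *m J.
Proof. by rewrite /twist mulmxDl !mulmxA mulmxK. Qed.

Lemma twist_closed x y : y \in g -> twist x y \in g.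
Proof.
rewrite -[y](mulmxKV J_unit); move: (y *m invmx J) => z.
rewrite twist_mul !in_form_mul => /eqP ez.
rewrite linearD /= !trmx_mul trmxK ez -scalemxAl -scalemxAr scalerDr.
by rewrite addrC.
Qed.

Lemma twist_bracket x y : x \in g -> twist x y = brmx x y.
Proof.
rewrite in_form /twist /brmx => /eqP ex; congr (_ + _).
by rewrite -mulmxA ex mulmxN (mulKmx J_unit) mulmxN.
Qed.

Definition twist_fun (x : 'M[C]_N) (y : subvs_of g) : subvs_of g :=
  vsproj g (twist x (vsval y)).

Lemma val_twist_fun x y : vsval (twist_fun x y) = twist x (vsval y).
Proof. by rewrite vsprojK // twist_closed // subvsP. Qed.

Lemma twist_fun_is_linear x : linear (twist_fun x).
Proof.
move=> a y z; apply: val_inj; rewrite [LHS]val_twist_fun linearP /=.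
by rewrite !val_twist_fun twist_linr.
Qed.

HB.instance Definition _ x :=
  GRing.isLinear.Build C (subvs_of g) (subvs_of g) _ (twist_fun x)
    (twist_fun_is_linear x).

Lemma twist_mod_lin : {in gl C N &, forall x y, forall a : C,
  linfun (twist_fun (a *: x + y))
    = a *: linfun (twist_fun x) + linfun (twist_fun y)}.
Proof.
move=> x y _ _ a; apply/lfunP => z; apply: val_inj.
rewrite add_lfunE scale_lfunE !lfunE [LHS]val_twist_fun /=.
by rewrite !val_twist_fun twist_linl.
Qed.

Lemma twist_mod_br : {in gl C N &, forall x y, linfun (twist_fun (brmx x y)) =
  ((linfun (twist_fun x) \o linfun (twist_fun y))
   - (linfun (twist_fun y) \o linfun (twist_fun x)))%VF}.
Proof.
move=> x y _ _; apply/lfunP => z; apply: val_inj.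
rewrite add_lfunE opp_lfunE !comp_lfunE !lfunE /= !val_twist_fun.
rewrite -[vsval z](mulmxKV J_unit); move: (vsval z *m invmx J) => u.
rewrite !twist_mul -mulmxBl; congr (_ *m J).
rewrite /brmx linearB /= !trmx_mul !(mulNmx, mulmxBr, mulmxDl, mulmxDr) !mulmxA.
by apply/matrixP => i j; rewrite !mxE; ring.
Qed.

(* S^2 or Lambda^2 of the vector representation of gl_N, realised on g. *)
Definition form_mod : lieMod (gl C N) :=
  @LieMod C N (gl C N) (subvs_of g) (fun x => linfun (twist_fun x))
    twist_mod_lin twist_mod_br.

Lemma val_form_mod_act x (y : subvs_of g) :
  vsval (mod_act form_mod x y) = twist x (vsval y).
Proof. by rewrite lfunE val_twist_fun. Qed.

Lemma sym_power_adjoint_act k x : x \in g ->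
  mod_act (sym_power (adjoint g) k) x = mod_act (sym_power form_mod k) x.
Proof.
move=> xg.
have e : @sym_fun C N g (adjoint g) k x = @sym_fun C N (gl C N) form_mod k x.
  apply/funext => p; apply: val_inj; rewrite /= /sym_der.
  apply: eq_bigr => i _; congr (_ * _).
  have -> : mod_act (adjoint g) x (vbasis {:adjoint g})`_i
      = mod_act form_mod x (vbasis {:form_mod})`_i.
    by rewrite !lfunE /= /ad_fun /twist_fun twist_bracket.
  by [].
exact: (congr1 (fun f : hompoly (\dim {:adjoint g}) C k -> hompoly (\dim {:adjoint g}) C k
  => linfun f) e).
Qed.

Lemma char_sym_power_adjoint n k :
  char n (sym_power (adjoint g) k) = char n (restrict g (sym_power form_mod k)).
Proof.
apply: char_eq_act => x xg; exact: sym_power_adjoint_act.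
Qed.

End FormModule.

Section SymForm.
Variables (C : numClosedFieldType) (N : nat) (J : 'M[C]_N) (eta : C).
Hypotheses (J_unit : J \in unitmx) (J_tr : J^T = - (eta *: J)) (eta2 : eta * eta = 1).
Local Notation g := (form_lie J).
Local Notation V := (form_mod J_unit J_tr eta2).
Local Notation d := (\dim {:V}).
Local Notation S := {mpoly C[d]}.
Local Notation der i j := (sym_der (V := V) (delta_mx i j)).

(** The image of e_a e_b in S^2 or Lambda^2. All ordered pairs are kept, so the family is redundant:
    (b, a) gives eta times (a, b). The variables x_ab of the overview are the [genx a b]. *)
Definition gen (p : 'I_N * 'I_N) : V :=
  vsproj g ((delta_mx p.1 p.2 + eta *: delta_mx p.2 p.1) *m J).

Definition genx (a b : 'I_N) : S := sym_lin (gen (a, b)).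

Lemma genxE a b : genx a b = sym_lin (gen (a, b)).
Proof. by []. Qed.

Lemma val_gen a b :
  vsval (gen (a, b)) = (delta_mx a b + eta *: delta_mx b a) *m J.
Proof.
rewrite vsprojK // (in_form_mul J_unit J_tr eta2) linearD /= linearZ /=.
by rewrite !trmx_delta scalerDr scalerA eta2 scale1r addrC.
Qed.

Lemma genC a b : gen (b, a) = eta *: gen (a, b).
Proof.
apply: val_inj; rewrite linearZ /= !val_gen scalemxAl scalerDr scalerA eta2.
by rewrite scale1r addrC.
Qed.

Lemma genxC a b : genx b a = eta *: genx a b.
Proof. by rewrite /genx genC linearZ. Qed.

Lemma sym_der_is_linear x a (p q : S) :
  sym_der (V := V) x (a *: p + q) = a *: sym_der (V := V) x p + sym_der (V := V) x q.
Proof.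
rewrite /sym_der scaler_sumr -big_split /=; apply: eq_bigr => i _.
by rewrite linearP mulrDr scalerAr.
Qed.

Lemma sym_derM x (p q : S) : sym_der (V := V) x (p * q) =
  sym_der (V := V) x p * q + p * sym_der (V := V) x q.
Proof.
rewrite /sym_der mulr_suml mulr_sumr -big_split /=; apply: eq_bigr => i _.
by rewrite mderivM mulrDr; ring.
Qed.

Lemma der_genx i j a b :
  der i j (genx a b) = genx i b *+ (j == a) + genx a i *+ (j == b).
Proof.
have e : mod_act V (delta_mx i j) (gen (a, b))
    = gen (i, b) *+ (j == a) + gen (a, i) *+ (j == b).
  apply: val_inj; rewrite [LHS]val_form_mod_act linearD !linearMn /= !val_gen.
  rewrite twist_mul // trmx_delta.
  rewrite !(mulmxDl, mulmxDr) -!scalemxAl -!scalemxAr !mul_delta_mx_cond.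
  rewrite (eq_sym b j) (eq_sym a j) -!scalemxAl.
  case: (j == a); case: (j == b);
    rewrite ?mulr1n ?mulr0n ?scaler0 ?addr0 ?add0r ?mul0mx ?scaler0 ?addr0 ?add0r //.
    by rewrite addrACA [X in _ + X]addrC addrACA.
  by rewrite addrC.
by rewrite /genx sym_der_lin e linearD !linearMn.
Qed.

Definition genx_prod (s : seq ('I_N * 'I_N)) : S := \prod_(p <- s) genx p.1 p.2.

Lemma genx_prodE s : genx_prod s = \prod_(p <- s) genx p.1 p.2.
Proof. by []. Qed.

Definition entry (v : V) (a b : 'I_N) : C := (vsval v *m invmx J) a b.

Lemma entry_gen a b a' b' : entry (gen (a, b)) a' b'
  = ((a' == a) && (b' == b))%:R + eta * ((a' == b) && (b' == a))%:R.
Proof. by rewrite /entry val_gen mulmxK // !mxE. Qed.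

(** The factor 1/2 is there because (a, b) and (b, a) contribute the same term. *)
Lemma entry_sum v : v = 2^-1 *: \sum_a \sum_b entry v a b *: gen (a, b).
Proof.
have z_tr : (vsval v *m invmx J)^T = eta *: (vsval v *m invmx J).
  by apply/eqP; rewrite -(in_form_mul J_unit J_tr eta2) mulmxKV // subvsP.
have key : vsval v = 2^-1 *: \sum_a \sum_b
    entry v a b *: ((delta_mx a b + eta *: delta_mx b a) *m J).
  rewrite -[LHS](mulmxKV J_unit) /entry; move: (vsval v *m invmx J) z_tr => z z_tr.
  under eq_bigr do under eq_bigr do rewrite scalemxAl scalerDr.
  under eq_bigr do rewrite -mulmx_suml big_split /=.
  rewrite -mulmx_suml big_split /= -matrix_sum_delta scalemxAl; congr (_ *m J).
  rewrite exchange_big /= [X in z + X](_ : _ = z).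
    by rewrite -mulr2n -scaler_nat scalerA mulVf ?scale1r // pnatr_eq0.
  rewrite [RHS]matrix_sum_delta; apply: eq_bigr => i _; apply: eq_bigr => j _.
  rewrite scalerA; congr (_ *: _).
  have /matrixP/(_ j i) := z_tr; rewrite !mxE => ->.
  exact: mulrC.
apply: val_inj; rewrite [LHS]key [RHS]linearZ /=; congr (_ *: _).
rewrite linear_sum; apply: eq_bigr => a _; rewrite linear_sum; apply: eq_bigr => b _.
by rewrite linearZ /= val_gen.
Qed.

Lemma sym_lin_genx v : sym_lin v = 2^-1 *: \sum_a \sum_b entry v a b *: genx a b.
Proof.
rewrite {1}[v]entry_sum linearZ /=; congr (_ *: _).
rewrite linear_sum; apply: eq_bigr => a _ /=; rewrite linear_sum; apply: eq_bigr => b _.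
by rewrite linearZ.
Qed.

Lemma sym_linX (i : 'I_d) : sym_lin (vbasis {:V})`_i = 'X_i :> S.
Proof.
rewrite /sym_lin (bigD1 i) //= big1 ?addr0 => [|j ji];
  rewrite coord_free ?(basis_free (vbasisP _)) //.
  by rewrite eqxx scale1r.
by rewrite eq_sym (negPf ji) scale0r.
Qed.

(** The variables of [S] belong to an arbitrary basis of V; rewriting each as a combination of
    generators shows that products of [k] generators span degree [k]. *)
Lemma homog_genx_ind k (P : S -> Prop) : P 0 ->
  (forall a p q, P p -> P q -> P (a *: p + q)) ->
  (forall s, size s = k -> P (genx_prod s)) ->
  forall p, p \is k.-homog -> P p.
Proof.
move=> P0 Plin Ps p /dhomogP pk.
(* [Q] is generalised so that the factor already treated can be absorbed into the predicate. *)
have PX l (m : 'X_{1..d}) : mdeg m = l -> forall Q : S -> Prop, Q 0 ->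
    (forall a p q, Q p -> Q q -> Q (a *: p + q)) ->
    (forall s, size s = l -> Q (genx_prod s)) -> Q 'X_[m].
  elim: l m => [|l IHl] m ml Q Q0 Qlin Qs.
    move/eqP: ml; rewrite mdeg_eq0 => /eqP ->; rewrite mpolyX0.
    by have := Qs [::] erefl; rewrite /genx_prod big_nil.
  have [i mi|m0] := pickP (fun i => m i != 0%N); last first.
    by move: ml; rewrite mdegE big1 // => i _; apply/eqP; move: (m0 i) => /negbFE.
  have Ule : (U_(i) <= m)%MM.
    by apply/mnm_lepP => j; rewrite mnm1E; case: eqP => // <-; rewrite lt0n.
  rewrite -(submK Ule) addmC mpolyXD -sym_linX sym_lin_genx.
  apply: (IHl (m - U_(i))%MM _ (fun q => Q (_ * q))).
  - by move: ml; rewrite -{1}(submK Ule) mdegD mdeg1 addn1 => -[].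
  - by rewrite mulr0.
  - by move=> a q r Qq Qr; rewrite mulrDr -scalerAr; apply: Qlin.
  move=> s sl; rewrite -scalerAl -[_ *: _]addr0; apply (Qlin) => //.
  rewrite mulr_suml; have Qsum (F : 'I_N -> S) : (forall a, Q (F a)) -> Q (\sum_a F a).
    move=> QF; apply: big_ind => // q r Qq Qr.
    by rewrite -[q]scale1r; apply (Qlin).
  apply/Qsum => a; rewrite mulr_suml; apply/Qsum => b.
  rewrite -scalerAl -[_ *: _]addr0; apply (Qlin) => //.
  by have := Qs ((a, b) :: s); rewrite /genx_prod big_cons /= sl; apply.
rewrite [p]mpolyE big_seq; apply: big_ind => // [q r Pq Pr|m mp].
  by rewrite -[q]scale1r; apply: Plin.
rewrite -[_ *: _]addr0; apply (Plin) => //; by apply: (PX k) => //; exact: (pk m mp).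
Qed.

End SymForm.

(** * The Hermitian form on the symmetric powers *)

Lemma leibniz1 (R : pzRingType) (f : R -> R) :
  (forall p q, f (p * q) = f p * q + p * f q) -> f 1 = 0.
Proof.
move=> /(_ 1 1); rewrite !mulr1 mul1r => /eqP.
by rewrite -subr_eq0 opprD addrA subrr sub0r oppr_eq0 => /eqP.
Qed.

Lemma mderivXU (R : nzRingType) n (i j : 'I_n) : ('X_j : {mpoly R[n]})^`M(i) = (i == j)%:R.
Proof.
rewrite mderivX mnm1E eq_sym; case: eqP => [->|_]; last by rewrite scale0r.
have -> : (U_(j) - U_(j))%MM = 0%MM by apply/mnmP => l; rewrite mnmBE subnn mnm0E.
by rewrite mpolyX0 scale1r.
Qed.

(** This is the gl_N-weight of the monomial [genx_prod s]; a pair (i, i) counts twice. *)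
Definition weight_count (N : nat) (s : seq ('I_N * 'I_N)) (i : 'I_N) : nat :=
  (\sum_(p <- s) ((i == p.1) + (i == p.2)))%N.

Lemma sum_weight_count N (s : seq ('I_N * 'I_N)) :
  (\sum_i weight_count s i = 2 * size s)%N.
Proof.
rewrite /weight_count exchange_big /=; elim: s => [|q s IHs]; first by rewrite big_nil.
rewrite big_cons IHs mulnS; congr (_ + _)%N; rewrite big_split /=.
suff one x : (\sum_(i < N) (i == x) = 1)%N by rewrite !one.
by rewrite (bigD1 x) //= eqxx big1 // => i /negPf ->.
Qed.

Lemma weight_count_bound N (s : seq ('I_N * 'I_N)) i : (weight_count s i <= 2 * size s)%N.
Proof.
rewrite /weight_count; elim: s => [|p s IHs]; first by rewrite big_nil.
rewrite big_cons mulnS; apply: leq_add => //.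
by case: (i == p.1); case: (i == p.2).
Qed.

Section SymUnitary.
Variables (C : numClosedFieldType) (N : nat) (J : 'M[C]_N) (eta : C).
Hypotheses (J_unit : J \in unitmx) (J_tr : J^T = - (eta *: J)) (eta2 : eta * eta = 1).
Local Notation g := (form_lie J).
Local Notation V := (form_mod J_unit J_tr eta2).
Local Notation d := (\dim {:V}).
Local Notation S := {mpoly C[d]}.
Local Notation der i j := (sym_der (V := V) (delta_mx i j)).
Local Notation genx := (genx J_unit J_tr eta2).
Local Notation genx_prod := (genx_prod J_unit J_tr eta2).
Local Notation D := #|{: 'I_N * 'I_N}|.
Local Notation T := {mpoly C[D]}.

Definition matx (a b : 'I_N) : T := 'X_(enum_rank (a, b)).

Definition matx_lin (v : V) : T := \sum_a \sum_b entry v a b *: matx a b.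

Lemma matx_lin_is_linear : linear matx_lin.
Proof.
move=> c v w; rewrite /matx_lin scaler_sumr -big_split /=.
apply: eq_bigr => a _; rewrite scaler_sumr -big_split /=; apply: eq_bigr => b _.
rewrite scalerA -scalerDl; congr (_ *: _).
by rewrite /entry linearP /= mulmxDl -scalemxAl !mxE.
Qed.

HB.instance Definition _ := GRing.isLinear.Build C V T _ matx_lin matx_lin_is_linear.

(** The embedding of S(g) into polynomials in N^2 independent variables; the basis underlying [S] is
    arbitrary, whereas that of the target is adapted to the matrix units. *)
Definition mat_poly (p : S) : T :=
  p \mPo [tuple matx_lin (vbasis {:V})`_i | i < d].

Lemma mat_poly_lin v : mat_poly (sym_lin v) = matx_lin v.
Proof.
rewrite [in RHS](coord_vbasis (memvf v)) linear_sum /mat_poly /sym_lin raddf_sum /=.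
apply: eq_bigr => i _; rewrite comp_mpolyZ comp_mpolyXU nth_mktuple linearZ.
by [].
Qed.

Lemma mat_poly_genx a b : mat_poly (genx a b) = matx a b + eta *: matx b a.
Proof.
rewrite mat_poly_lin /matx_lin.
have entryE a' b' := entry_gen J_unit J_tr eta2 a b a' b'.
transitivity (\sum_a' \sum_b' ((((a' == a) && (b' == b))%:R *: matx a' b'
   + eta *: (((a' == b) && (b' == a))%:R *: matx a' b')))).
  apply: eq_bigr => a' _; apply: eq_bigr => b' _.
  by rewrite entryE scalerDl scalerA.
have pick2 x y (F : 'I_N -> 'I_N -> T) :
    \sum_a' \sum_b' ((a' == x) && (b' == y))%:R *: F a' b' = F x y.
  rewrite (bigD1 x) //= [X in _ + X]big1 => [|a' /negPf ax]; last first.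
    by apply: big1 => b' _; rewrite ax scale0r.
  rewrite (bigD1 y) //= [X in _ + X + _]big1 => [|b' /negPf bx]; last first.
    by rewrite bx andbF scale0r.
  by rewrite !eqxx scale1r !addr0.
under eq_bigr do rewrite big_split /=.
rewrite big_split /= pick2; congr (_ + _).
under eq_bigr do rewrite -scaler_sumr.
by rewrite -scaler_sumr pick2.
Qed.

Definition mat_der (i j : 'I_N) (p : T) : T :=
  \sum_b matx i b * p^`M(enum_rank (j, b))
  + \sum_a matx a i * p^`M(enum_rank (a, j)).

Lemma mat_der_is_linear i j c (p q : T) :
  mat_der i j (c *: p + q) = c *: mat_der i j p + mat_der i j q.
Proof.
rewrite /mat_der scalerDr addrACA.
by congr (_ + _); rewrite scaler_sumr -big_split /=; apply: eq_bigr => a _;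
  rewrite linearP mulrDr scalerAr.
Qed.

Lemma mat_derM i j (p q : T) :
  mat_der i j (p * q) = mat_der i j p * q + p * mat_der i j q.
Proof.
rewrite /mat_der mulrDl mulrDr addrACA.
by congr (_ + _); rewrite mulr_suml mulr_sumr -big_split /=;
  apply: eq_bigr => a _; rewrite mderivM mulrDr; ring.
Qed.

Lemma mat_der_matx i j a b :
  mat_der i j (matx a b) = matx i b *+ (j == a) + matx a i *+ (j == b).
Proof.
rewrite /mat_der /matx; congr (_ + _).
  rewrite (bigD1 b) //= big1 => [|b' /negPf bb]; rewrite mderivXU (can_eq enum_rankK).
    by rewrite xpair_eqE eqxx andbT addr0 mulr_natr.
  by rewrite xpair_eqE bb andbF mulr0.
rewrite (bigD1 a) //= big1 => [|b' /negPf bb]; rewrite mderivXU (can_eq enum_rankK).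
  by rewrite xpair_eqE eqxx addr0 mulr_natr.
by rewrite xpair_eqE bb mulr0.
Qed.

Lemma mat_polyM (q r : S) : mat_poly (q * r) = mat_poly q * mat_poly r.
Proof. by rewrite /mat_poly rmorphM. Qed.

Lemma mat_poly_is_linear c (q r : S) :
  mat_poly (c *: q + r) = c *: mat_poly q + mat_poly r.
Proof. by rewrite /mat_poly linearP. Qed.

(** Both sides obey the Leibniz rule along [mat_poly], so it is enough to compare them on the
    generators [genx a b]. *)
Lemma mat_poly_der i j (p : S) : mat_poly (der i j p) = mat_der i j (mat_poly p).
Proof.
pose P (q : S) := mat_poly (der i j q) = mat_der i j (mat_poly q).
have Plin c q r : P q -> P r -> P (c *: q + r).
  by rewrite /P sym_der_is_linear !mat_poly_is_linear mat_der_is_linear => -> ->.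
have PM q r : P q -> P r -> P (q * r).
  rewrite /P sym_derM !mat_polyM mat_derM => <- <-.
  by have := mat_poly_is_linear 1 (der i j q * r) (q * der i j r); rewrite !scale1r !mat_polyM.
have P1 : P 1.
  rewrite /P (leibniz1 (sym_derM _)) /mat_poly raddf0 rmorph1.
  by rewrite (leibniz1 (mat_derM i j)).
have P0 : P 0.
  have e : -1 *: (1 : S) + 1 = 0 by rewrite scaleN1r addNr.
  by rewrite -e; apply: Plin.
have Pgen a b : P (genx a b).
  have mMn (c : bool) q : mat_poly (q *+ c) = mat_poly q *+ c.
    by case: c => //; rewrite /mat_poly raddf0.
  rewrite /P der_genx mat_poly_genx.
  have := mat_poly_is_linear 1 (genx i b *+ (j == a)) (genx a i *+ (j == b)).
  rewrite !scale1r => ->; rewrite !mMn !mat_poly_genx.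
  rewrite [matx a b + _]addrC mat_der_is_linear !mat_der_matx.
  by case: (j == a); case: (j == b); rewrite ?mulr1n ?mulr0n ?scaler0 ?addr0 ?add0r
    ?scalerDr //; ring.
have Psum I (r : seq I) F : (forall i, P (F i)) -> P (\sum_(i <- r) F i).
  move=> PF; elim: r => [|x r IHr]; first by rewrite big_nil; exact: P0.
  by rewrite big_cons -[F x]scale1r; apply: Plin IHr; exact: PF.
apply: (mpoly_alg_ind P1 Plin) p => l p; apply: PM.
rewrite -sym_linX sym_lin_genx -[_ *: _]addr0; apply (Plin _ _ _) => [|]; last exact P0.
apply/Psum => a; apply/Psum => b.
by rewrite -[_ *: _]addr0; apply: Plin P0; exact: Pgen.
Qed.

Definition half_gen (r : 'I_D) : S := 2^-1 *: genx (enum_val r).1 (enum_val r).2.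

(** Replacing x_ab by half of [genx a b] undoes the embedding, by [sym_lin_genx]. The resulting
    injectivity gives the positivity of [sym_form]. *)
Lemma mat_polyK (p : S) : mat_poly p \mPo [tuple half_gen r | r < D] = p.
Proof.
move: p; apply: mpoly_alg_ind => [|c p q IHp IHq|l p IHp].
- by rewrite /mat_poly !rmorph1.
- by rewrite mat_poly_is_linear linearP /= IHp IHq.
rewrite mat_polyM rmorphM /= IHp; congr (_ * _).
rewrite -sym_linX mat_poly_lin sym_lin_genx /matx_lin scaler_sumr raddf_sum.
apply: eq_bigr => a _; rewrite /= scaler_sumr raddf_sum; apply: eq_bigr => b _ /=.
rewrite comp_mpolyZ comp_mpolyXU nth_mktuple /half_gen enum_rankK /=.
by rewrite !scalerA mulrC.
Qed.

Lemma mat_poly_eq0 (p : S) : mat_poly p = 0 -> p = 0.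
Proof. by move=> p0; rewrite -[p]mat_polyK p0 raddf0. Qed.

(** Multiplication by a variable is adjoint to its derivative, so x_ib d/dx_jb is adjoint to x_jb
    d/dx_ib, and likewise for the second index. *)
Lemma mat_der_adjoint i j (p q : T) :
  fischer (mat_der i j p) q = fischer p (mat_der j i q).
Proof.
have fD p1 p2 q' : fischer (p1 + p2) q' = fischer p1 q' + fischer p2 q' :> C.
  by rewrite -[p1]scale1r fischer_lin mul1r scale1r.
rewrite [RHS]fischer_conj /mat_der !fD rmorphD !fischer_suml !rmorph_sum.
by congr (_ + _); apply: eq_bigr => a _; rewrite /= -fischer_conj fischer_mulX
  fischer_mderiv.
Qed.

Section Power.
Variable k : nat.
Local Notation W := (sym_power V k).

Lemma val_elt i j (u : W) : val (elt W i j u) = der i j (val u).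
Proof. by rewrite /elt lfunE. Qed.

Definition sym_form (u v : W) : C := fischer (mat_poly (val u)) (mat_poly (val v)).

Lemma sym_form_lin a x y z : sym_form (a *: x + y) z = a * sym_form x z + sym_form y z.
Proof. by rewrite /sym_form linearP mat_poly_is_linear fischer_lin. Qed.

Lemma sym_form_conj x y : sym_form y x = (sym_form x y)^*.
Proof. exact: fischer_conj. Qed.

Lemma sym_form_pos x : x != 0 -> 0 < sym_form x x.
Proof.
move=> x0; apply: fischer_pos; apply: contraNneq x0 => /mat_poly_eq0 x0.
by apply/eqP/val_inj.
Qed.

Lemma sym_form_adjoint i j x y :
  sym_form (elt W i j x) y = sym_form x (elt W j i y).
Proof. by rewrite /sym_form !val_elt !mat_poly_der mat_der_adjoint. Qed.

Lemma genx_homog a b : genx a b \is 1.-homog.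
Proof.
rewrite genxE /sym_lin; apply: rpred_sum => l _; apply: rpredZ.
by rewrite dhomogX /= mdeg1.
Qed.

Lemma genx_prod_homog s : genx_prod s \is (size s).-homog.
Proof.
rewrite genx_prodE; elim: s => [|p s IHs]; first by rewrite big_nil dhomog1.
by rewrite big_cons -[size _]add1n; apply: dhomogM => //; apply: genx_homog.
Qed.

Lemma sym_power_ind (P : W -> Prop) : P 0 ->
  (forall a u v, P u -> P v -> P (a *: u + v)) ->
  (forall (u : W) s, size s = k -> val u = genx_prod s -> P u) -> forall u, P u.
Proof.
move=> P0 Plin Ps u.
have [||s sk|v /val_inj <- //] := @homog_genx_ind _ _ _ _ J_unit J_tr eta2 k
  (fun p => exists2 v : W, val v = p & P v) _ _ _ (val u) (dhomog_is_dhomog u).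
- by exists 0.
- by move=> a _ _ [v <- Pv] [w <- Pw]; exists (a *: v + w); [rewrite linearP|apply: Plin].
have h : genx_prod s \is k.-homog by rewrite -sk genx_prod_homog.
by exists (DHomog h) => //; apply: (Ps _ s).
Qed.

Lemma der_torus_genx_prod i s :
  der i i (genx_prod s) = (weight_count s i)%:R *: genx_prod s.
Proof.
rewrite genx_prodE /weight_count; elim: s => [|[a b] s IHs].
  by rewrite !big_nil scale0r (leibniz1 (sym_derM _)).
rewrite !big_cons sym_derM IHs der_genx natrD scalerDl -scalerAr; congr (_ + _).
rewrite scalerAl; congr (_ * _) => /=; rewrite natrD scalerDl.
by congr (_ + _); case: eqP => [<-|_]; rewrite ?scale1r ?scale0r.
Qed.

(** A monomial of degree k has 2k indices, so the eigenvalues of E_ii on monomials lie between 0 and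
    2k. *)
Lemma sym_torus_bound i (x : W) : torus_falling i (2 * k).+1 x = 0.
Proof.
move: x; apply: sym_power_ind => [|a u v u0 v0|u s sk us].
- have := torus_falling_lin i (2 * k).+1 (-1) (0 : W) 0.
  by rewrite !scaleN1r oppr0 addr0 addNr.
- by rewrite torus_falling_lin u0 v0 scaler0 addr0.
apply: (@torus_falling_eq0 _ _ _ _ _ _ (weight_count s i)).
  by rewrite ltnS -sk weight_count_bound.
by apply: val_inj; rewrite val_elt us der_torus_genx_prod linearZ /= us.
Qed.

End Power.
End SymUnitary.

(** * Straightening modulo the image of the lowering operators *)

Section Straightening.
Variables (C : numClosedFieldType) (N : nat) (J : 'M[C]_N) (eta : C).
Hypotheses (J_unit : J \in unitmx) (J_tr : J^T = - (eta *: J)) (eta2 : eta * eta = 1).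
Local Notation V := (form_mod J_unit J_tr eta2).
Local Notation d := (\dim {:V}).
Local Notation S := {mpoly C[d]}.
Local Notation der i j := (sym_der (V := V) (delta_mx i j)).
Local Notation genx := (genx J_unit J_tr eta2).
Local Notation genx_prod := (genx_prod J_unit J_tr eta2).

(** A subspace as a predicate. Below, [Z] is any subspace that contains the image of the lowering
    operators; it will be the annihilator of a highest weight vector. *)
Definition lin_pred (P : S -> Prop) : Prop :=
  P 0 /\ forall a p q, P p -> P q -> P (a *: p + q).

Lemma lin_predZ P a p : lin_pred P -> P p -> P (a *: p).
Proof. by move=> [P0 PD] Pp; rewrite -[_ *: _]addr0; apply: PD. Qed.

Lemma lin_predD P p q : lin_pred P -> P p -> P q -> P (p + q).
Proof. by move=> [P0 PD] Pp Pq; rewrite -[p]scale1r; apply: PD. Qed.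

Lemma lin_pred_mul P r : lin_pred P -> lin_pred (fun p => P (r * p)).
Proof.
move=> [P0 PD]; split; first by rewrite mulr0.
by move=> a p q Pp Pq; rewrite mulrDr -scalerAr; apply: PD.
Qed.

Lemma genx_prod_cat s t : genx_prod (s ++ t) = genx_prod s * genx_prod t.
Proof. exact: big_cat. Qed.

Lemma genx_prod_cons p s : genx_prod (p :: s) = genx p.1 p.2 * genx_prod s.
Proof. exact: big_cons. Qed.

Lemma genx_prod_pair a b s : genx_prod ((a, b) :: s) = genx a b * genx_prod s.
Proof. exact: big_cons. Qed.

Lemma genx_prod_nil : genx_prod [::] = 1.
Proof. exact: big_nil. Qed.

Definition indices_ge (i : nat) (s : seq ('I_N * 'I_N)) : bool :=
  all (fun p : 'I_N * 'I_N => (i <= p.1)%N && (i <= p.2)%N) s.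

Lemma der_genx_prod0 (i j : 'I_N) s :
  all (fun p => (j != p.1) && (j != p.2)) s -> der i j (genx_prod s) = 0.
Proof.
elim: s => [|p s IHs] /=; first by rewrite genx_prod_nil (leibniz1 (sym_derM _)).
move=> /andP[/andP[/negPf jp1 /negPf jp2] /IHs e].
by rewrite genx_prod_cons sym_derM e mulr0 der_genx jp1 jp2 !mulr0n !addr0 mul0r.
Qed.

Lemma der_genx_prod_nseq (i j : 'I_N) n p :
  der i j (genx_prod (nseq n.+1 p))
    = n.+1%:R *: (der i j (genx p.1 p.2) * genx_prod (nseq n p)).
Proof.
elim: n => [|n IHn].
  by rewrite genx_prod_cons genx_prod_nil !mulr1 scale1r.
rewrite [genx_prod (nseq n.+2 p)](genx_prod_cons p (nseq n.+1 p)) sym_derM IHn.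
rewrite [genx_prod (nseq n.+1 p)](genx_prod_cons p (nseq n p)) -scalerAr.
rewrite [genx _ _ * (_ * _)]mulrCA -[X in X + _]scale1r -scalerDl.
by rewrite -[in RHS]natr1 addrC.
Qed.

Lemma der_genx_prod_ge P (b : nat) (i j : 'I_N) s : lin_pred P -> (b <= i)%N ->
  indices_ge b s ->
  (forall s', size s' = size s -> indices_ge b s' -> P (genx_prod s')) ->
  P (der i j (genx_prod s)).
Proof.
move=> linP bi; elim: s P linP => [|[p q] s IHs] P linP /=.
  by move=> _ _; rewrite genx_prod_nil (leibniz1 (sym_derM _)); case: linP.
move=> /andP[/andP[/= bp bq] bs] Ps; rewrite genx_prod_cons sym_derM.
apply: (lin_predD linP).
  rewrite der_genx mulrDl; apply: (lin_predD linP).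
    case: eqP => _; last by rewrite mulr0n mul0r; case: linP.
    by have := Ps ((i, q) :: s); rewrite genx_prod_cons; apply; rewrite //= bi bq.
  case: eqP => _; last by rewrite mulr0n mul0r; case: linP.
  by have := Ps ((p, i) :: s); rewrite genx_prod_cons; apply; rewrite //= bi bp.
apply: (IHs (fun r => P (genx p q * r))) => //; first exact: lin_pred_mul.
move=> s' ss bs'; have := Ps ((p, q) :: s'); rewrite genx_prod_cons; apply.
  by rewrite /= ss.
by rewrite /= bp bq.
Qed.

Variable Z : S -> Prop.
Hypothesis linZ : lin_pred Z.
Hypothesis Z_low : forall (i j : 'I_N) p, (i < j)%N -> Z (der j i p).

Lemma Z_cancel a p q : a != 0 -> Z (a *: p + q) -> Z q -> Z p.
Proof.
move=> a0 Zpq Zq; have -> : p = a^-1 *: (a *: p + q + -1 *: q).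
  by rewrite scaleN1r addrK scalerA mulVf // scale1r.
by apply: lin_predZ => //; apply: lin_predD => //; apply: lin_predZ.
Qed.

Lemma Zeq p q : Z q -> p = q -> Z p.
Proof. by move=> Zq ->. Qed.

Definition row_pairs (i : 'I_N) (L : seq 'I_N) := [seq (i, l) | l <- L].

(** E_li turns one factor x_il' into x_ll', both of whose indices exceed i as soon as l does. *)
Lemma der_row P (i l : 'I_N) L : lin_pred P -> all (fun l' : 'I_N => i < l')%N L ->
  (forall (l' : 'I_N) L', (size L').+1 = size L -> (i < l')%N ->
     all (fun l' : 'I_N => i < l')%N L' -> P (genx l l' * genx_prod (row_pairs i L'))) ->
  P (der l i (genx_prod (row_pairs i L))).
Proof.
elim: L P => [|l1 L IHL] P linP /=.
  by move=> _ _; rewrite genx_prod_nil (leibniz1 (sym_derM _)); case: linP.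
move=> /andP[il1 iL] PL; rewrite genx_prod_cons sym_derM der_genx eqxx mulr1n /=.
rewrite [i == l1](ltn_eqF il1) mulr0n addr0.
apply: (lin_predD linP); first exact: PL.
apply: (IHL (fun r => P (genx i l1 * r))) => //; first exact: lin_pred_mul.
move=> l' L' sL il' iL'; rewrite mulrCA.
by have := PL l' (l1 :: L'); rewrite genx_prod_cons /=; apply; rewrite ?sL ?il1.
Qed.

(** * Straightening for symmetric matrices: reduction to diagonal variables *)

Section Symmetric.
Hypothesis eta1 : eta = 1.
Variable k : nat.
Hypothesis Z_diag : forall s, size s = k -> all (fun p => p.1 == p.2) s ->
  Z (genx_prod s).

(** Apply E_li to x_ii^(a+1) times the rest of the row: one term is a multiple of x_ii^a x_il times
    that rest, and each other term replaces some x_il' by x_ll'. The latter have shorter rows, and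
    induction applies. *)
Lemma straighten_sym_row (i : 'I_N) (T : seq ('I_N * 'I_N)) :
  all (fun p : 'I_N * 'I_N => (p.1 < i)%N && (p.2 < i)%N) T ->
  (forall a s, indices_ge i.+1 s -> (size T + a + size s)%N = k ->
     Z (genx_prod (T ++ nseq a (i, i) ++ s))) ->
  forall L a s, all (fun l : 'I_N => i < l)%N L -> indices_ge i.+1 s ->
    (size T + a + size L + size s)%N = k ->
    Z (genx_prod T * genx_prod (nseq a (i, i)) * genx_prod (row_pairs i L) * genx_prod s).
Proof.
move=> Ti Z0 L; have [n] := ubnP (size L); elim: n L => // n IHn [|l L] /= Ln a s.
  move=> _ si sz; rewrite /row_pairs genx_prod_nil mulr1 -!genx_prod_cat -catA.
  by apply: Z0 => //; rewrite -sz addn0.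
move=> /andP[il iL] si sz.
have := Z_low (genx_prod T * genx_prod (nseq a.+1 (i, i))
  * genx_prod (row_pairs i L) * genx_prod s) il.
have T0 : der l i (genx_prod T) = 0.
  apply: der_genx_prod0; apply: sub_all Ti => p /andP[p1 p2].
  by rewrite [i == p.1](gtn_eqF p1) [i == p.2](gtn_eqF p2).
have s0 : der l i (genx_prod s) = 0.
  apply: der_genx_prod0; apply: sub_all si => p /andP[p1 p2].
  by rewrite [i == p.1](ltn_eqF p1) [i == p.2](ltn_eqF p2).
have d_ii : der l i (genx i i) = 2%:R *: genx i l.
  rewrite der_genx eqxx mulr1n genxC (congr1 (fun c => c *: genx i l) eta1).
  by rewrite scale1r -mulr2n scaler_nat.
rewrite sym_derM s0 mulr0 addr0 sym_derM [der _ _ (_ * _)]sym_derM T0 mul0r add0r.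
rewrite der_genx_prod_nseq /= d_ii mulrDl => h.
(* The power gives a + 1, and E_li x_ii = x_li + x_il = 2 x_il gives 2. *)
pose c : C := (a.+1 * 2)%:R.
apply: (@Z_cancel c _ (genx_prod T * genx_prod (nseq a.+1 (i, i)) *
  der l i (genx_prod (row_pairs i L)) * genx_prod s)).
- by rewrite pnatr_eq0.
- move: h; congr Z; congr (_ + _); rewrite genx_prod_cons /= /c natrM.
  rewrite -!scalerAl -!scalerAr -!scalerAl scalerA; congr (_ *: _); ring.
have linP : lin_pred (fun r => Z (genx_prod T * genx_prod (nseq a.+1 (i, i)) * r * genx_prod s)).
  split; first by rewrite mulr0 mul0r; case: linZ.
  move=> b p q Zp Zq; rewrite mulrDr mulrDl -scalerAr -scalerAl.
  by case: linZ => _; apply.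
apply: (der_row linP) => // l' L' sL il' iL'.
have := IHn L' _ a.+1 ((l, l') :: s) iL'.
rewrite genx_prod_cons /= => /(_ _ _ _) H.
have -> : genx_prod T * genx_prod (nseq a.+1 (i, i))
      * (genx l l' * genx_prod (row_pairs i L')) * genx_prod s
    = genx_prod T * genx_prod (nseq a.+1 (i, i))
      * genx_prod (row_pairs i L') * (genx l l' * genx_prod s).
  ring.
apply: H.
- by move: Ln; rewrite -sL !ltnS => /ltnW.
- by rewrite il il'.
- by rewrite -sz -sL; lia.
Qed.

(** [T] holds the finished factors, with indices below i. The factors of [t] are sorted into x_ii,
    the row x_il with l > i, and those with both indices above i, collected in [a], [L] and [s]. *)
Lemma straighten_sym_step (i : 'I_N) (T : seq ('I_N * 'I_N)) :
  all (fun p : 'I_N * 'I_N => (p.1 < i)%N && (p.2 < i)%N) T ->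
  (forall a s, indices_ge i.+1 s -> (size T + a + size s)%N = k ->
     Z (genx_prod (T ++ nseq a (i, i) ++ s))) ->
  forall t, indices_ge i t -> (size T + size t)%N = k -> Z (genx_prod (T ++ t)).
Proof.
move=> Ti Z0 t ti sz.
suff gen : forall a L s, all (fun l : 'I_N => i < l)%N L -> indices_ge i.+1 s ->
    (size T + a + size L + size s + size t)%N = k ->
    Z (genx_prod T * genx_prod (nseq a (i, i)) * genx_prod (row_pairs i L) * genx_prod s
       * genx_prod t).
  have := gen 0%N [::] [::] isT isT; rewrite !genx_prod_nil !mulr1 genx_prod_cat.
  by apply; rewrite /= !addn0.
elim: t ti {sz} => [|[p q] t IHt] ti a L s iL si sz.
  by rewrite genx_prod_nil mulr1; apply: straighten_sym_row => //; rewrite -sz addn0.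
move: ti => /= /andP[/andP[ip iq] ti]; rewrite genx_prod_cons /=.
have [ep|np] := eqVneq p i; have [eq|nq] := eqVneq q i.
- subst p q; have := IHt ti a.+1 L s iL si.
  rewrite [genx_prod (nseq a.+1 _)](genx_prod_pair i i (nseq a (i, i))).
  by move=> H; apply: (Zeq (H _)); [rewrite -sz /=; lia|ring].
- subst p; have iq' : (i < q)%N by rewrite ltn_neqAle iq andbT eq_sym.
  have := IHt ti a (q :: L) s.
  rewrite [genx_prod (row_pairs i _)](genx_prod_pair i q (row_pairs i L)) /= iq' iL.
  move=> /(_ isT si).
  by move=> H; apply: (Zeq (H _)); [rewrite -sz /=; lia|ring].
- subst q; have ip' : (i < p)%N by rewrite ltn_neqAle ip andbT eq_sym.
  have := IHt ti a (p :: L) s.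
  rewrite [genx_prod (row_pairs i _)](genx_prod_pair i p (row_pairs i L)) /= ip' iL.
  move=> /(_ isT si).
  rewrite [genx p i]genxC.
  move=> H; apply: (Zeq (lin_predZ eta linZ (H _))); first by rewrite -sz /=; lia.
  by rewrite -!scalerAl -!scalerAr; congr (_ *: _); ring.
have ip' : (i < p)%N by rewrite ltn_neqAle ip andbT eq_sym.
have iq' : (i < q)%N by rewrite ltn_neqAle iq andbT eq_sym.
have := IHt ti a L ((p, q) :: s) iL; rewrite genx_prod_cons /= ip' iq' => /(_ si).
by move=> H; apply: (Zeq (H _)); [rewrite -sz /=; lia|ring].
Qed.

Lemma straighten_sym t : size t = k -> Z (genx_prod t).
Proof.
suff gen : forall n b, (N - b <= n)%N -> forall T t,
    all (fun p : 'I_N * 'I_N => (p.1 < b)%N && (p.2 < b)%N) T ->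
    all (fun p => p.1 == p.2) T -> indices_ge b t -> (size T + size t)%N = k ->
    Z (genx_prod (T ++ t)).
  by move=> tk; apply: (gen N 0%N _ [::]) => //; [rewrite subn0|apply/allP].
elim=> [|n IHn] b bn T {}t Tb Td tb sz.
  case: t tb sz => [|[p q] t] /= tb sz.
    by rewrite cats0; apply: Z_diag => //; rewrite -sz addn0.
  move: bn; rewrite leqn0 subn_eq0 => Nb; case/andP: tb => /andP[bp _] _.
  by have := leq_trans (leq_trans (ltn_ord p) Nb) bp; rewrite ltnn.
have [bN|Nb] := ltnP b N; last first.
  by apply: (IHn b) => //; move: Nb; rewrite -subn_eq0 => /eqP ->.
pose i := Ordinal bN; apply: (@straighten_sym_step i) => // a s si sz'.
rewrite catA; apply: (IHn b.+1) => //.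
- by rewrite subnS -ltnS; case: (N - b)%N bn => // m; rewrite ltnS.
- rewrite all_cat all_nseq /= ltnSn orbT andbT.
  by apply: sub_all Tb => p /andP[p1 p2]; rewrite ltnS (ltnW p1) ltnS (ltnW p2).
- by rewrite all_cat Td all_nseq /= eqxx orbT.
- by rewrite size_cat size_nseq.
Qed.

End Symmetric.

(** * Straightening for skew matrices: reduction to consecutive pairs *)

Section Skew.
Hypothesis eta1 : eta = -1.
Variable k : nat.

(** Indices start at 0, so these are the pairs (0, 1), (2, 3), ..., that is x_12, x_34, ... in the
    overview. *)
Definition skew_slice (p : 'I_N * 'I_N) := ~~ odd p.1 && (p.2 == p.1.+1 :> nat).

Hypothesis Z_slice : forall s, size s = k -> all skew_slice s -> Z (genx_prod s).

Lemma genx_diag i : genx i i = 0.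
Proof.
have := genxC J_unit J_tr eta2 i i.
rewrite [RHS](congr1 (fun c => c *: genx i i) eta1) scaleN1r => /eqP.
by rewrite -addr_eq0 -mulr2n -scaler_nat scaler_eq0 pnatr_eq0 => /eqP.
Qed.

Section Step.
Variables (i j : 'I_N) (T : seq ('I_N * 'I_N)).
Hypothesis ij : j = i.+1 :> nat.
Hypothesis Ti : all (fun p : 'I_N * 'I_N => (p.1 < i)%N && (p.2 < i)%N) T.
Hypothesis Z0 : forall a s, indices_ge j.+1 s -> (size T + a + size s)%N = k ->
  Z (genx_prod (T ++ nseq a (i, j) ++ s)).

Let lt_ij : (i < j)%N. Proof. by rewrite ij. Qed.

Lemma der_below (l l' : 'I_N) : (i <= l')%N -> der l l' (genx_prod T) = 0.
Proof.
move=> il; apply: der_genx_prod0; apply: sub_all Ti => p /andP[p1 p2].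
by rewrite [l' == p.1](gtn_eqF (leq_trans p1 il)) [l' == p.2](gtn_eqF (leq_trans p2 il)).
Qed.

(** Apply E_ji to the product with x_il in place of x_jl: since E_ji x_ij = x_jj = 0, only that
    factor changes, and the monomial lies in [Z] outright. *)
Lemma straighten_second_row (l : 'I_N) a r : (j < l)%N -> indices_ge j r ->
  Z (genx_prod T * genx_prod (nseq a (i, j)) * (genx j l * genx_prod r)).
Proof.
move=> jl rj.
have := Z_low (genx_prod T * genx_prod (nseq a (i, j)) * (genx i l * genx_prod r)) lt_ij.
have a0 : der j i (genx_prod (nseq a (i, j))) = 0.
  case: a => [|a]; first by rewrite genx_prod_nil (leibniz1 (sym_derM _)).
  rewrite der_genx_prod_nseq der_genx /= eqxx genx_diag.
  by rewrite [i == j](ltn_eqF lt_ij) mulr0n mulr1n addr0 mul0r scaler0.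
have r0 : der j i (genx_prod r) = 0.
  apply: der_genx_prod0; apply: sub_all rj => p /andP[p1 p2].
  by rewrite [i == p.1](ltn_eqF (leq_trans lt_ij p1)) [i == p.2](ltn_eqF (leq_trans lt_ij p2)).
rewrite sym_derM [der _ _ (genx_prod T * _)]sym_derM der_below // a0 mul0r mulr0 addr0.
rewrite mul0r add0r sym_derM r0 mulr0 addr0 der_genx eqxx mulr1n.
by rewrite [i == l](ltn_eqF (ltn_trans lt_ij jl)) mulr0n addr0.
Qed.

(** The factors of [m] are inspected one by one and stored in [m1]. A factor with index j falls
    under [straighten_second_row]; if there is none, all indices exceed j and [Z0] applies. *)
Lemma straighten_skew_tail a m1 m : indices_ge j.+1 m1 -> indices_ge j m ->
  (size T + a + size m1 + size m)%N = k ->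
  Z (genx_prod T * genx_prod (nseq a (i, j)) * genx_prod m1 * genx_prod m).
Proof.
elim: m m1 => [|[p q] m IHm] m1 m1j.
  move=> _ sz; rewrite genx_prod_nil mulr1 -!genx_prod_cat -catA.
  by apply: Z0 => //; rewrite -sz addn0.
move=> /= /andP[/andP[/= jp jq] mj] sz; rewrite genx_prod_pair.
have m1m : indices_ge j (m1 ++ m).
  rewrite /indices_ge all_cat; apply/andP; split=> //.
  by apply: sub_all m1j => r /andP[r1 r2]; rewrite (ltnW r1) (ltnW r2).
have [ep|np] := eqVneq p j; have [eq|nq] := eqVneq q j.
- by subst p q; rewrite genx_diag mul0r mulr0; case: linZ.
- subst p; have jq' : (j < q)%N by rewrite ltn_neqAle jq andbT eq_sym.
  by apply: (Zeq (straighten_second_row a jq' m1m)); rewrite genx_prod_cat; ring.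
- subst q; have jp' : (j < p)%N by rewrite ltn_neqAle jp andbT eq_sym.
  apply: (Zeq (lin_predZ eta linZ (straighten_second_row a jp' m1m))).
  rewrite [genx p j]genxC genx_prod_cat -!scalerAl -!scalerAr.
  by congr (_ *: _); ring.
have jp' : (j < p)%N by rewrite ltn_neqAle jp andbT eq_sym.
have jq' : (j < q)%N by rewrite ltn_neqAle jq andbT eq_sym.
have := IHm ((p, q) :: m1); rewrite genx_prod_pair /= jp' jq' => /(_ m1j mj) H.
by apply: (Zeq (H _)); [rewrite -sz /=; lia|ring].
Qed.

(** Apply E_lj to x_ij^(a+1) times the rest: E_lj x_ij = x_il, the row x_iL has no index j, and [m]
    keeps its indices at least j. So x_il is traded for one more x_ij and a shorter row. *)
Lemma straighten_first_row L a m : all (fun l : 'I_N => j < l)%N L ->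
  indices_ge j m -> (size T + a + size L + size m)%N = k ->
  Z (genx_prod T * genx_prod (nseq a (i, j)) * genx_prod (row_pairs i L) * genx_prod m).
Proof.
elim: L a m => [|l L IHL] /= a m.
  move=> _ mj sz; rewrite genx_prod_nil.
  have := @straighten_skew_tail a [::] m isT mj; rewrite genx_prod_nil; apply.
  by rewrite -sz /=; lia.
move=> /andP[jl jL] mj sz.
have := Z_low (genx_prod T * genx_prod (nseq a.+1 (i, j))
  * genx_prod (row_pairs i L) * genx_prod m) jl.
have L0 : der l j (genx_prod (row_pairs i L)) = 0.
  apply: der_genx_prod0; rewrite all_map; apply: sub_all jL => l' /= jl'.
  by rewrite [j == i](gtn_eqF lt_ij) [j == l'](ltn_eqF jl').
rewrite sym_derM sym_derM [der _ _ (_ * _)]sym_derM L0 mulr0 addr0 der_below 1?ltnW // mul0r add0r.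
rewrite der_genx_prod_nseq /= der_genx eqxx [j == i](gtn_eqF lt_ij) mulr0n mulr1n add0r => h.
apply: (@Z_cancel a.+1%:R _ (genx_prod T * genx_prod (nseq a.+1 (i, j)) *
  genx_prod (row_pairs i L) * der l j (genx_prod m))).
- by rewrite pnatr_eq0.
- apply: (Zeq h); congr (_ + _); rewrite genx_prod_pair.
  by rewrite -!scalerAr -!scalerAl; congr (_ *: _); ring.
have linP := lin_pred_mul (genx_prod T * genx_prod (nseq a.+1 (i, j)) *
  genx_prod (row_pairs i L)) linZ.
apply: (der_genx_prod_ge _ linP (ltnW jl) mj) => m' sm m'j.
by apply: IHL => //; rewrite sm -sz; lia.
Qed.

Lemma straighten_skew_step t : indices_ge i t -> (size T + size t)%N = k ->
  Z (genx_prod (T ++ t)).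
Proof.
move=> ti sz.
suff gen : forall a L s, all (fun l : 'I_N => j < l)%N L -> indices_ge j s ->
    (size T + a + size L + size s + size t)%N = k ->
    Z (genx_prod T * genx_prod (nseq a (i, j)) * genx_prod (row_pairs i L) * genx_prod s
       * genx_prod t).
  have := gen 0%N [::] [::] isT isT; rewrite !genx_prod_nil !mulr1 genx_prod_cat.
  by apply; rewrite /= !addn0.
have gt_i (p : 'I_N) : (i <= p)%N -> p != i -> p != j -> (j < p)%N.
  move=> ip pi pj; rewrite ltn_neqAle eq_sym [(p != j :> nat)]pj ij.
  by rewrite ltn_neqAle eq_sym [(p != i :> nat)]pi.
elim: t ti {sz} => [|[p q] t IHt] ti a L s jL sj sz.
  by rewrite genx_prod_nil mulr1; apply: straighten_first_row => //; rewrite -sz addn0.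
move: ti => /= /andP[/andP[/= ip iq] ti]; rewrite genx_prod_pair.
have first (q' : 'I_N) : (i <= q')%N -> Z (genx_prod T * genx_prod (nseq a (i, j)) *
    genx_prod (row_pairs i L) * genx_prod s * (genx i q' * genx_prod t)).
  move=> iq'; have [eq|nq] := eqVneq q' i.
    by rewrite eq genx_diag mul0r mulr0; case: linZ.
  have [eq|nqj] := eqVneq q' j.
    have := IHt ti a.+1 L s jL sj.
    rewrite [genx_prod (nseq a.+1 _)](genx_prod_pair i j (nseq a (i, j))) => H.
    by rewrite eq; apply: (Zeq (H _)); [rewrite -sz /=; lia|ring].
  have := IHt ti a (q' :: L) s.
  rewrite [genx_prod (row_pairs i _)](genx_prod_pair i q' (row_pairs i L)) /= gt_i // jL.
  move=> /(_ isT sj) H.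
  by apply: (Zeq (H _)); [rewrite -sz /=; lia|ring].
have [ep|np] := eqVneq p i; first by rewrite ep; apply: first.
have [eq|nq] := eqVneq q i.
  rewrite eq [genx p i]genxC; apply: (Zeq (lin_predZ eta linZ (first p ip))).
  by rewrite -!scalerAl -!scalerAr; congr (_ *: _); ring.
have jp : (j <= p)%N by rewrite ij ltn_neqAle ip andbT eq_sym.
have jq : (j <= q)%N by rewrite ij ltn_neqAle iq andbT eq_sym.
have := IHt ti a L ((p, q) :: s) jL; rewrite genx_prod_pair /= jp jq => /(_ sj) H.
by apply: (Zeq (H _)); [rewrite -sz /=; lia|ring].
Qed.

End Step.

(** Rows are cleared two at a time, so the first uncleared index [b] stays even. *)
Lemma straighten_skew t : size t = k -> Z (genx_prod t).
Proof.
suff gen : forall n b, ~~ odd b -> (N - b <= n)%N -> forall T t,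
    all (fun p : 'I_N * 'I_N => (p.1 < b)%N && (p.2 < b)%N) T ->
    all skew_slice T -> indices_ge b t -> (size T + size t)%N = k ->
    Z (genx_prod (T ++ t)).
  by move=> tk; apply: (gen N 0%N _ _ [::]) => //; [rewrite subn0|apply/allP].
have nil b T t' : (N <= b)%N -> all skew_slice T -> indices_ge b t' ->
    (size T + size t')%N = k -> Z (genx_prod (T ++ t')).
  case: t' => [|[p q] t'] /= Nb Td.
    by move=> _ sz; rewrite cats0; apply: Z_slice => //; rewrite -sz addn0.
  case/andP => /andP[bp _] _.
  by have := leq_trans (leq_trans (ltn_ord p) Nb) bp; rewrite ltnn.
elim=> [|n IHn] b b_even bn T {}t Tb Td tb sz.
  by apply: (nil b) => //; rewrite -subn_eq0 -leqn0.
have [bN|Nb] := ltnP b N; last exact: (nil b).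
(* For odd N the last index is left alone; a factor with both indices equal to it is zero. *)
have [b1N|Nb1] := ltnP b.+1 N; last first.
  case: t tb sz => [|[p q] t] tb sz; first exact: (nil N).
  case/andP: tb => /andP[/= bp bq] _.
  have -> : q = p.
    by apply/val_inj; move: (ltn_ord p) (ltn_ord q) => /= *; lia.
  by rewrite genx_prod_cat genx_prod_pair genx_diag mul0r mulr0; case: linZ.
apply: (@straighten_skew_step (Ordinal bN) (Ordinal b1N)) => // a s si sz'.
rewrite catA; apply: (IHn b.+2) => //.
- by rewrite /= negbK.
- by move: bn; clear; lia.
- rewrite all_cat all_nseq /= !ltnS leqnn leqnSn orbT andbT.
  by apply: sub_all Tb => p /andP[p1 p2]; rewrite !ltnS (leqW (ltnW p1)) (leqW (ltnW p2)).
- by rewrite all_cat Td all_nseq /skew_slice /= b_even eqxx orbT.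
- by rewrite size_cat size_nseq.
Qed.

End Skew.

End Straightening.

(** * Highest weight vectors in the symmetric power *)

Section HighestWeightsOfSym.
Variables (C : numClosedFieldType) (N : nat) (J : 'M[C]_N) (eta : C).
Hypotheses (J_unit : J \in unitmx) (J_tr : J^T = - (eta *: J)) (eta2 : eta * eta = 1).
Local Notation V := (form_mod J_unit J_tr eta2).
Local Notation d := (\dim {:V}).
Local Notation S := {mpoly C[d]}.
Local Notation der i j := (sym_der (V := V) (delta_mx i j)).
Local Notation genx_prod := (genx_prod J_unit J_tr eta2).
Variable k : nat.
Local Notation W := (sym_power V k).

Definition pairing (u : W) (p : S) : C := fischer (mat_poly (val u)) (mat_poly p).

Lemma pairing0l p : pairing 0 p = 0.
Proof. by rewrite /pairing /mat_poly raddf0 /fischer msupp0 big_nil. Qed.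

Lemma pairing0r u : pairing u 0 = 0.
Proof.
by rewrite /pairing /mat_poly raddf0 fischer_conj /fischer msupp0 big_nil conjC0.
Qed.

Lemma pairing_lin u a p q : pairing u (a *: p + q) = a^* * pairing u p + pairing u q.
Proof.
rewrite /pairing fischer_conj mat_poly_is_linear fischer_lin rmorphD rmorphM /=.
by rewrite -!fischer_conj.
Qed.

Lemma pairing_der u i j p : pairing u (der i j p) = pairing (elt W j i u) p.
Proof. by rewrite /pairing val_elt !mat_poly_der mat_der_adjoint. Qed.

Lemma pairing_linl a u v p : pairing (a *: u + v) p = a * pairing u p + pairing v p.
Proof. by rewrite /pairing linearP mat_poly_is_linear fischer_lin. Qed.

Variable slice : pred ('I_N * 'I_N).
Hypothesis straighten : forall Z : S -> Prop, lin_pred Z ->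
  (forall (i j : 'I_N) p, (i < j)%N -> Z (der j i p)) ->
  (forall s, size s = k -> all slice s -> Z (genx_prod s)) ->
  forall t, size t = k -> Z (genx_prod t).
Hypothesis slice_weight : forall s t, all slice s -> all slice t ->
  weight_count s =1 weight_count t -> perm_eq s t.

(** The annihilator of [u] contains the image of each lowering operator, because the adjoint raising
    operator kills [u]. By straightening it is then everything. *)
Lemma hwv_slice_eq0 m (u : W) : hwv m u ->
  (forall s, size s = k -> all slice s -> pairing u (genx_prod s) = 0) -> u = 0.
Proof.
move=> hu us; have linZ : lin_pred (fun p => pairing u p = 0).
  split; first exact: pairing0r.
  by move=> a p q p0 q0; rewrite pairing_lin p0 q0 mulr0 addr0.
apply: (herm_eq0 (@sym_form_pos _ _ _ _ J_unit J_tr eta2 k)).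
apply: (homog_genx_ind linZ.1 linZ.2 _ (dhomog_is_dhomog u)).
apply: (straighten linZ) => // i j p ij.
by rewrite pairing_der hu.2 // pairing0l.
Qed.

(** Some slice monomial pairs nontrivially with [u]; as E_ii is self-adjoint, that monomial must
    have the weight of [u]. *)
Lemma hwv_slice m (u : W) : u != 0 -> hwv m u -> exists s,
  [/\ size s = k, all slice s, m =1 weight_count s & pairing u (genx_prod s) != 0].
Proof.
move=> u0 hu; apply: contrapT => nos; move/eqP: u0; apply.
apply: (hwv_slice_eq0 hu) => s sk ss; apply/eqP; apply: contrapT => /negP us.
apply: nos; exists s; split=> // i.
have := pairing_der u i i (genx_prod s); rewrite hu.1 der_torus_genx_prod.
rewrite -[_ *: genx_prod s]addr0 -[_ *: u]addr0 pairing_lin pairing_linl conjC_nat.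
rewrite pairing0r pairing0l !addr0 => /(mulIf us)/eqP.
by rewrite eqr_nat => /eqP.
Qed.

(** [c] makes y - c x orthogonal to the only slice monomial of weight [m], up to reordering, so the
    difference vanishes. *)
Lemma sym_hwv_unique m (x y : W) : x != 0 -> hwv m x -> hwv m y ->
  exists c, y = c *: x.
Proof.
move=> x0 hx hy; have [s [sk ss ms xs]] := hwv_slice x0 hx.
pose c := pairing y (genx_prod s) / pairing x (genx_prod s).
exists c; apply/eqP; rewrite -subr_eq0; apply/eqP.
have hyx : hwv m (y - c *: x).
  split=> [i|i j ij]; first by rewrite linearB linearZ /= hx.1 hy.1 scalerBr !scalerA mulrC.
  by rewrite linearB linearZ /= hx.2 // hy.2 // scaler0 subr0.
apply: contrapT => /eqP/hwv_slice/(_ hyx)[t [tk ts mt /eqP]]; apply.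
have <- : genx_prod s = genx_prod t.
  by apply: perm_big; apply: slice_weight => // i; rewrite -ms mt.
rewrite addrC -scaleNr pairing_linl /c mulNr divfK // addNr //.
Qed.

End HighestWeightsOfSym.

(** * Signs in the Pfaffian *)

Section PfaffianTerms.
Variable r : nat.
Local Notation l := (@lshift r r).
Local Notation h := (@rshift r r).

(* The entries of the block matrix [[0, 1], [-1, 0]]. *)
Definition std_form (a b : 'I_(r + r)) : int :=
  (val b == val a + r)%N%:R - (val a == val b + r)%N%:R.

Lemma std_formC a b : std_form b a = - std_form a b.
Proof. by rewrite /std_form opprB. Qed.

Lemma std_form1 a b : (val a < r)%N -> val b = (val a + r)%N -> std_form a b = 1.
Proof.
move=> ar e; rewrite /std_form e eqxx; case: eqP => [|_]; last by rewrite subr0.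
by move: ar => /= ?; lia.
Qed.

Lemma std_form_neq0 a b : std_form a b != 0 ->
  val b = (val a + r)%N \/ val a = (val b + r)%N.
Proof.
rewrite /std_form; case: (val b =P _) => [->|_]; first by left.
by case: (val a =P _) => [->|_]; [right|rewrite subrr eqxx].
Qed.

Definition pf_term (s : 'S_(r + r)) : int :=
  (-1) ^+ s * \prod_(t < r) std_form (s (l t)) (s (h t)).

Lemma pf_term1 : pf_term 1 = 1.
Proof.
rewrite /pf_term odd_perm1 expr0 mul1r big1 // => t _.
by rewrite !perm1 std_form1 //= addnC.
Qed.

(** The permutation matrix is block diagonal with two equal blocks, so its determinant, the sign of
    [s], is a square. *)
Lemma pf_term_unflipped (s : 'S_(r + r)) : (forall t, std_form (s (l t)) (s (h t)) != 0) ->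
  (forall t, (s (l t) < r)%N) -> pf_term s = 1.
Proof.
move=> s0 sr.
have sE t : val (s (h t)) = (val (s (l t)) + r)%N.
  by have [//|e] := std_form_neq0 (s0 t); have := sr t; rewrite e; lia.
rewrite /pf_term big1 => [|t _]; last exact: std_form1 (sr t) (sE t).
rewrite mulr1; pose P : 'M[int]_(r + r) := perm_mx s.
have detP : \det P = (-1) ^+ s by apply: det_perm.
have ur0 : ursubmx P = 0.
  apply/matrixP => a b; rewrite !mxE; case: eqP => // e.
  by have := sr a; rewrite e /= -ltn_subRL subnn.
have dr : drsubmx P = ulsubmx P.
  apply/matrixP => a b; rewrite !mxE; congr (_%:R); congr nat_of_bool.
  apply/eqP/eqP => e; apply: val_inj; have := sE a; rewrite e /=; lia.
move: detP; rewrite -[P]submxK ur0 dr det_lblock; case: (odd_perm s) => //.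
rewrite expr1 => e; have : 0 <= \det (ulsubmx P) * \det (ulsubmx P) by rewrite -expr2 sqr_ge0.
by rewrite e.
Qed.

(** Exchanging the two members of a flipped pair changes the sign of [s] and of one factor, hence
    not the term, and removes a flip. No cancellation can thus occur in the Pfaffian sum. *)
Lemma pf_term_ge0 s : 0 <= pf_term s.
Proof.
have [n] := ubnP (\sum_(t < r) (r <= s (l t)))%N; elim: n s => // n IHn s sn.
have [/forallP s0|] := boolP [forall t, std_form (s (l t)) (s (h t)) != 0]; last first.
  rewrite negb_forall => /existsP[t]; rewrite negbK => /eqP t0.
  by rewrite /pf_term (bigD1 t) //= t0 mul0r mulr0.
have [/forallP sr|] := boolP [forall t, (s (l t) < r)%N].
  by rewrite pf_term_unflipped.
rewrite negb_forall => /existsP[t0]; rewrite -leqNgt => rt0.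
pose s' := (tperm (l t0) (h t0) * s)%g.
have lh : l t0 != h t0 by rewrite -val_eqE /= neq_ltn ltn_addr.
have s't0 : s' (l t0) = s (h t0) /\ s' (h t0) = s (l t0).
  by rewrite !permM tpermL tpermR.
have s't t : t != t0 -> s' (l t) = s (l t) /\ s' (h t) = s (h t).
  by move=> tt0; rewrite !permM !tpermD //
    ?eq_lrshift ?eq_rlshift ?eq_lshift ?eq_rshift // eq_sym.
have -> : pf_term s = pf_term s'.
  rewrite /pf_term odd_mul_tperm lh signr_addb expr1 (bigD1 t0) //=.
  rewrite [in RHS](bigD1 t0) //= !s't0.1 !s't0.2 [in RHS]std_formC.
  rewrite mulN1r !mulNr mulrN opprK.
  congr (_ * (_ * _)); apply: eq_bigr => t /s't[-> ->] //.
apply: IHn; move: sn; rewrite !ltnS; apply: leq_trans.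
rewrite (bigD1 t0) //= [X in (_ <= X)%N](bigD1 t0) //= rt0 add1n.
have -> : (r <= s' (l t0))%N = false.
  rewrite s't0.1; apply/negbTE; rewrite -ltnNge; have [/= e|/= e] := std_form_neq0 (s0 t0).
    by have := ltn_ord (s (h t0)); rewrite e ltn_add2r ltnNge rt0.
  by have := ltn_ord (s (l t0)); rewrite e ltn_add2r.
by rewrite add0n ltnS; apply: leq_sum => t /s't[-> _].
Qed.

End PfaffianTerms.

(** * Leading minors and Pfaffians as highest weight vectors *)

Lemma leibniz_prod (R : comPzRingType) (f : R -> R) (I : eqType) (s : seq I) (F : I -> R) :
  (forall p q, f (p * q) = f p * q + p * f q) -> uniq s ->
  f (\prod_(t <- s) F t) = \sum_(t <- s) f (F t) * \prod_(t' <- s | t' != t) F t'.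
Proof.
move=> fM; elim: s => [|x s IHs] /=; first by rewrite !big_nil (leibniz1 fM).
move=> /andP[xs us]; rewrite !big_cons fM IHs // eqxx /=; congr (_ * _ + _).
  rewrite big_seq [RHS]big_seq_cond; apply: eq_bigl => t.
  by case: (boolP (t \in s)) => // ts; rewrite (memPn xs).
rewrite mulr_sumr; apply: eq_big_seq => t ts.
by rewrite big_cons ifT 1?mulrCA // eq_sym (memPn xs).
Qed.

Section HighestWeightPolynomials.
Variables (C : numClosedFieldType) (N : nat) (J : 'M[C]_N) (eta : C).
Hypotheses (J_unit : J \in unitmx) (J_tr : J^T = - (eta *: J)) (eta2 : eta * eta = 1).
Local Notation V := (form_mod J_unit J_tr eta2).
Local Notation d := (\dim {:V}).
Local Notation S := {mpoly C[d]}.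
Local Notation der i j := (sym_der (V := V) (delta_mx i j)).
Local Notation genx := (genx J_unit J_tr eta2).
Local Notation genx_prod := (genx_prod J_unit J_tr eta2).

(** Highest weight vectors without a fixed degree, so that they can be multiplied. *)
Definition hwp (m : 'I_N -> nat) (p : S) : Prop :=
  (forall i, der i i p = (m i)%:R *: p) /\
  (forall i j : 'I_N, (i < j)%N -> der i j p = 0).

Lemma hwp_ext m m' p : m =1 m' -> hwp m p -> hwp m' p.
Proof. by move=> mm [h1 h2]; split=> // i; rewrite h1 mm. Qed.

Lemma hwp1 : hwp (fun=> 0%N) 1.
Proof. by split=> *; rewrite (leibniz1 (sym_derM _)) ?scale0r. Qed.

Lemma hwpM m m' p q : hwp m p -> hwp m' q -> hwp (fun i => m i + m' i)%N (p * q).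
Proof.
move=> [p1 p2] [q1 q2]; split=> [i|i j ij].
  by rewrite sym_derM p1 q1 -scalerAl -scalerAr -scalerDl natrD.
by rewrite sym_derM p2 // q2 // mul0r mulr0 addr0.
Qed.

Lemma hwpX m p n : hwp m p -> hwp (fun i => n * m i)%N (p ^+ n).
Proof.
move=> hp; elim: n => [|n IHn]; first by rewrite expr0; apply: hwp1.
by rewrite exprS; apply: hwp_ext (hwpM hp IHn) => i; rewrite mulSn.
Qed.

Lemma hwp_prod (I : Type) (r : seq I) (m : I -> 'I_N -> nat) (p : I -> S) :
  (forall t, hwp (m t) (p t)) ->
  hwp (fun i => \sum_(t <- r) m t i)%N (\prod_(t <- r) p t).
Proof.
move=> hp; elim: r => [|t r IHr].
  by rewrite big_nil; apply: hwp_ext hwp1 => i; rewrite big_nil.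
by rewrite big_cons; apply: hwp_ext (hwpM (hp t) IHr) => i; rewrite big_cons.
Qed.

(** Euler's identity: the sum of the E_ii is twice the degree, each generator carrying two
    indices. *)
Lemma hwp_homog_weight m p l : p != 0 -> p \is l.-homog -> hwp m p ->
  (\sum_i m i = 2 * l)%N.
Proof.
move=> p0 pl [hp _].
have euler : \sum_i der i i p = (2 * l)%:R *: p.
  apply: (@homog_genx_ind _ _ _ _ J_unit J_tr eta2 l
    (fun q => \sum_i der i i q = (2 * l)%:R *: q)) pl.
  - rewrite scaler0 big1 // => i _.
    by rewrite /sym_der big1 // => t _; rewrite raddf0 mulr0.
  - move=> a q r hq hr; rewrite scalerDr scalerA mulrC -scalerA -hq -hr scaler_sumr.
    by rewrite -big_split /=; apply: eq_bigr => i _; rewrite sym_der_is_linear.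
  move=> s <-; under eq_bigr do rewrite der_torus_genx_prod.
  rewrite -scaler_suml -natr_sum; congr (_%:R *: _).
  exact: sum_weight_count.
move: euler; rewrite (eq_bigr (fun i => (m i)%:R *: p)) => [|i _]; last exact: hp.
move/eqP; rewrite -scaler_suml -natr_sum -subr_eq0 -scalerBl scaler_eq0 (negPf p0) orbF.
by rewrite subr_eq0 eqr_nat => /eqP.
Qed.

Definition evalx (A : 'I_N -> 'I_N -> C) (p : S) : C :=
  (mat_poly p).@[fun r => A (enum_val r).1 (enum_val r).2].

Lemma evalx_genx A a b : evalx A (genx a b) = A a b + eta * A b a.
Proof.
by rewrite /evalx mat_poly_genx mevalD mevalZ !mevalXU !enum_rankK.
Qed.

Lemma evalxM A p q : evalx A (p * q) = evalx A p * evalx A q.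
Proof. by rewrite /evalx mat_polyM mevalM. Qed.

Lemma evalx_sum A (I : finType) (F : I -> S) :
  evalx A (\sum_i F i) = \sum_i evalx A (F i).
Proof.
apply: (big_morph (evalx A)) => [p q|]; last by rewrite /evalx /mat_poly !raddf0.
by rewrite /evalx -[p]scale1r mat_poly_is_linear !scale1r mevalD.
Qed.

Lemma evalx_prod A (I : finType) (F : I -> S) :
  evalx A (\prod_i F i) = \prod_i evalx A (F i).
Proof.
apply: (big_morph (evalx A)) => [p q|]; first exact: evalxM.
by rewrite /evalx /mat_poly !rmorph1.
Qed.

Lemma evalx_sign A (b : bool) p : evalx A ((-1) ^+ b * p) = (-1) ^+ b * evalx A p.
Proof. by rewrite evalxM; congr (_ * _); rewrite /evalx /mat_poly !rmorph_sign. Qed.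

Lemma der_sum i j (I : finType) (F : I -> S) : der i j (\sum_t F t) = \sum_t der i j (F t).
Proof.
rewrite /sym_der exchange_big /=; apply: eq_bigr => t _.
by rewrite raddf_sum mulr_sumr.
Qed.

Lemma der_sign i j (b : bool) p : der i j ((-1) ^+ b * p) = (-1) ^+ b * der i j p.
Proof.
case: b; last by rewrite !mul1r.
rewrite !mulN1r /sym_der -sumrN; apply: eq_bigr => t _.
by rewrite raddfN mulrN.
Qed.

Lemma der_prod_pairs i j n (x y : 'I_n -> 'I_N) :
  der i j (\prod_t genx (x t) (y t)) =
  \sum_t (genx i (y t) *+ (j == x t) + genx (x t) i *+ (j == y t))
     * \prod_(t' | t' != t) genx (x t') (y t').
Proof.
rewrite (leibniz_prod _ (sym_derM _)) ?index_enum_uniq //.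
by apply: eq_bigr => t _; rewrite der_genx.
Qed.

Definition replace_index n (i j x : 'I_n) : 'I_n := if x == j then i else x.

Lemma replace_index_tperm n (i j x : 'I_n) :
  replace_index i j (tperm i j x) = replace_index i j x.
Proof.
by rewrite /replace_index; case: tpermP => [->|->|] //; rewrite eqxx; case: eqP.
Qed.

Lemma replace_index_id n (i x : 'I_n) : replace_index i i x = x.
Proof. by rewrite /replace_index; case: eqP => // ->. Qed.

Section Minors.
Variables (n : nat) (nN : (n <= N)%N).
Local Notation w := (widen_ord nN).

Lemma w_inj : injective w.
Proof. by move=> x y /(congr1 val) /= xy; apply: val_inj. Qed.

Definition minor_mx (f h : 'I_n -> 'I_n) : 'M[S]_n :=
  \matrix_(a, b) genx (w (f a)) (w (h b)).

Definition minor : S := \det (minor_mx id id).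

(** In each term of the determinant every row index and every column index occurs in exactly one
    factor, so the derivation changes one row, then one column. *)
Lemma der_minor (i' j' : 'I_n) : der (w i') (w j') minor
  = \det (minor_mx (replace_index i' j') id)
    + \det (minor_mx id (replace_index i' j')).
Proof.
rewrite /minor /determinant der_sum -big_split /=; apply: eq_bigr => s _.
rewrite der_sign -mulrDr; congr (_ * _).
rewrite (eq_bigr (fun t => genx (w t) (w (s t)))) => [|t _]; last by rewrite mxE.
rewrite der_prod_pairs (eq_bigr _ (fun t _ => mulrDl _ _ _)) big_split /=.
congr (_ + _).
  rewrite (bigD1 j') //= [X in _ + X]big1 ?addr0 => [|t tj]; last first.
    by rewrite (inj_eq w_inj) eq_sym (negPf tj) mulr0n mul0r.
  rewrite [RHS](bigD1 j') //= mxE /replace_index !eqxx mulr1n; congr (_ * _).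
  by apply: eq_bigr => t /negPf tj; rewrite mxE tj.
pose t0 := (s^-1)%g j'; have st0 : s t0 = j' by rewrite permKV.
rewrite (bigD1 t0) //= [X in _ + X]big1 ?addr0 => [|t tt]; last first.
  by rewrite (inj_eq w_inj) eq_sym -st0 (inj_eq perm_inj) (negPf tt) mulr0n mul0r.
rewrite [RHS](bigD1 t0) //= mxE st0 /replace_index !eqxx mulr1n; congr (_ * _).
by apply: eq_bigr => t /negPf tt; rewrite mxE -st0 (inj_eq perm_inj) tt.
Qed.

Lemma der_minor_out (i j : 'I_N) : (n <= j)%N -> der i j minor = 0.
Proof.
move=> nj; rewrite /minor /determinant der_sum big1 // => s _.
rewrite der_sign (eq_bigr (fun t => genx (w t) (w (s t)))) => [|t _]; last by rewrite mxE.
rewrite der_prod_pairs big1 ?mulr0 // => t _.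
have jw (x : 'I_n) : (j == w x) = false.
  by apply/negbTE; rewrite -val_eqE /= gtn_eqF // (leq_trans _ nj).
by rewrite !jw !mulr0n addr0 mul0r.
Qed.

(** A raising operator inside the block creates two equal rows or columns. An index of the block has
    weight 2, being both a row and a column. *)
Lemma hwp_minor : hwp (fun i => 2 * (i < n))%N minor.
Proof.
split=> [i|i j ij].
  have [im|mi] := ltnP i n; last by rewrite der_minor_out // scale0r.
  have -> : i = w (Ordinal im) by apply: val_inj.
  rewrite der_minor; set i' := Ordinal im.
  have e1 : minor_mx (replace_index i' i') id = minor_mx id id.
    by apply/matrixP => a b; rewrite !mxE replace_index_id.
  have e2 : minor_mx id (replace_index i' i') = minor_mx id id.
    by apply/matrixP => a b; rewrite !mxE replace_index_id.
  by rewrite e1 e2 -mulr2n -scaler_nat.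
have [jm|mj] := ltnP j n; last by rewrite der_minor_out.
have im := ltn_trans ij jm; have -> : i = w (Ordinal im) by apply: val_inj.
have -> : j = w (Ordinal jm) by apply: val_inj.
rewrite der_minor; set i' := Ordinal _; set j' := Ordinal jm.
have ij' : i' != j' by rewrite -val_eqE /= (ltn_eqF ij).
rewrite (determinant_alternate ij') => [|b]; last first.
  by rewrite !mxE /replace_index eqxx (negPf ij').
rewrite -det_tr (determinant_alternate ij') ?addr0 // => b.
by rewrite !mxE /replace_index eqxx (negPf ij').
Qed.

Lemma sign_homog (b : bool) l (p : S) : p \is l.-homog -> (-1) ^+ b * p \is l.-homog.
Proof. by case: b => ph; rewrite ?mul1r // mulN1r rpredN. Qed.

Lemma minor_homog : minor \is n.-homog.
Proof.
apply: rpred_sum => s _; apply: sign_homog.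
have -> : \prod_i minor_mx id id i (s i) = genx_prod [seq (w i, w (s i)) | i : 'I_n].
  rewrite genx_prodE big_image /=; apply: eq_bigr => i _; by rewrite mxE.
have := genx_prod_homog J_unit J_tr eta2 [seq (w i, w (s i)) | i : 'I_n].
by rewrite size_image card_ord.
Qed.

Lemma minor_neq0 : eta = 1 -> minor != 0.
Proof.
move=> eta1; apply/eqP => m0.
(* At half the identity the matrix of generators becomes the identity. *)
pose A (a b : 'I_N) : C := 2^-1 *+ (a == b).
have : evalx A minor = 1; last first.
  by rewrite m0 /evalx /mat_poly !raddf0 => /eqP; rewrite eq_sym oner_eq0.
rewrite /minor /determinant evalx_sum.
rewrite -[RHS](det1 C n) /determinant; apply: eq_bigr => s _.
rewrite evalx_sign evalx_prod; congr (_ * _); apply: eq_bigr => a _.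
rewrite !mxE evalx_genx (congr1 (fun c => c * A (w (s a)) (w a)) eta1) mul1r /A.
rewrite !(inj_eq w_inj) [s a == a]eq_sym; case: (a == s a); last by rewrite addr0.
by rewrite !mulr1n [RHS]splitr mul1r.
Qed.
End Minors.

Section Pfaffians.
Variables (n : nat) (nN : (n + n <= N)%N).
Local Notation w := (widen_ord nN).
Local Notation l := (@lshift n n).
Local Notation h := (@rshift n n).

(* For [f = id] this is 2^n n! times the Pfaffian of the leading block. *)
Definition pf_at (f : 'I_(n + n) -> 'I_(n + n)) : S :=
  \sum_(s : 'S_(n + n)) (-1) ^+ s * \prod_(t < n) genx (w (f (s (l t)))) (w (f (s (h t)))).

Definition pf : S := pf_at id.

(** In each term every index occurs exactly once, on the left or on the right of one factor: the two
    cases for [p]. *)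
Lemma der_pf (i' j' : 'I_(n + n)) : der (w i') (w j') pf = pf_at (replace_index i' j').
Proof.
rewrite /pf /pf_at der_sum; apply: eq_bigr => s _; rewrite der_sign; congr (_ * _).
rewrite (der_prod_pairs _ _ (fun t => w (s (l t))) (fun t => w (s (h t)))).
pose p := (s^-1)%g j'; have sp : s p = j' by rewrite permKV.
have jE x : (w j' == w (s x)) = (p == x) by rewrite (inj_eq (@w_inj _ nN)) -sp (inj_eq perm_inj).
have rE x : replace_index i' j' (s x) = if p == x then i' else s x.
  by rewrite /replace_index -sp (inj_eq perm_inj) eq_sym.
under eq_bigr do rewrite !jE; under [RHS]eq_bigr do rewrite !rE.
case: (splitP p) => t0 ep.
  have {}ep : p = l t0 by apply: val_inj.
  rewrite ep (bigD1 t0) //= [X in _ + X]big1 ?addr0 => [|t tt]; last first.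
    by rewrite eq_lshift eq_lrshift eq_sym (negPf tt) !mulr0n addr0 mul0r.
  rewrite [RHS](bigD1 t0) //= eq_lshift eq_lrshift eqxx mulr1n mulr0n addr0.
  congr (_ * _); apply: eq_bigr => t /negPf tt.
  by rewrite eq_lshift eq_lrshift eq_sym tt.
have {}ep : p = h t0 by apply: val_inj.
rewrite ep (bigD1 t0) //= [X in _ + X]big1 ?addr0 => [|t tt]; last first.
  by rewrite eq_rshift eq_rlshift eq_sym (negPf tt) !mulr0n addr0 mul0r.
rewrite [RHS](bigD1 t0) //= eq_rshift eq_rlshift eqxx mulr1n mulr0n add0r.
congr (_ * _); apply: eq_bigr => t /negPf tt.
by rewrite eq_rshift eq_rlshift eq_sym tt.
Qed.

Lemma der_pf_out (i j : 'I_N) : (n + n <= j)%N -> der i j pf = 0.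
Proof.
move=> nj; rewrite /pf /pf_at der_sum big1 // => s _; rewrite der_sign.
rewrite der_prod_pairs big1 ?mulr0 // => t _.
have jw x : (j == w x) = false.
  by apply/negbTE; rewrite -val_eqE /= gtn_eqF // (leq_trans _ nj).
by rewrite !jw !mulr0n addr0 mul0r.
Qed.

Lemma hwp_pf : hwp (fun i => (i < n + n)%N : nat) pf.
Proof.
split=> [i|i j ij].
  have [im|mi] := ltnP i (n + n); last by rewrite der_pf_out // scale0r.
  have -> : i = w (Ordinal im) by apply: val_inj.
  rewrite der_pf scale1r; apply: eq_bigr => s _; congr (_ * _).
  by apply: eq_bigr => t _; rewrite !replace_index_id.
have [jm|mj] := ltnP j (n + n); last by rewrite der_pf_out.
have im := ltn_trans ij jm; have -> : i = w (Ordinal im) by apply: val_inj.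
have -> : j = w (Ordinal jm) by apply: val_inj.
rewrite der_pf; set i' := Ordinal _; set j' := Ordinal jm.
have ij' : i' != j' by rewrite -val_eqE /= (ltn_eqF ij).
set f := replace_index i' j'.
(* Once j' is replaced by i', composing with their transposition changes only the sign of a term. *)
have e : pf_at f = - pf_at f.
  rewrite {1}/pf_at (reindex_inj (mulIg (tperm i' j'))) /= -sumrN.
  apply: eq_bigr => s _; rewrite odd_permM odd_tperm ij' signr_addb expr1 mulrN1 mulNr.
  by congr (- (_ * _)); apply: eq_bigr => t _; rewrite !permM /f !replace_index_tperm.
move/eqP: e; rewrite -addr_eq0 -mulr2n -scaler_nat scaler_eq0 pnatr_eq0.
by move/eqP.
Qed.

Lemma pf_homog : pf \is n.-homog.
Proof.
apply: rpred_sum => s _; apply: sign_homog.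
have -> : \prod_(t < n) genx (w (s (l t))) (w (s (h t)))
    = genx_prod [seq (w (s (l t)), w (s (h t))) | t : 'I_n].
  by rewrite genx_prodE big_image.
have := genx_prod_homog J_unit J_tr eta2 [seq (w (s (l t)), w (s (h t))) | t : 'I_n].
by rewrite size_image card_ord.
Qed.

Lemma pf_neq0 : eta = -1 -> pf != 0.
Proof.
move=> eta1; apply/eqP => p0.
(* With eta = -1 the generators take the values [std_form], so the terms are nonnegative and the
   identity contributes 1. *)
pose A (a b : 'I_N) : C := (val b == val a + n)%N%:R.
have : evalx A pf = (\sum_(s : 'S_(n + n)) pf_term s)%:~R.
  rewrite /pf /pf_at evalx_sum raddf_sum; apply: eq_bigr => s _ /=.
  rewrite evalx_sign evalx_prod /pf_term rmorphM rmorph_sign rmorph_prod /=.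
  congr (_ * _); apply: eq_bigr => t _.
  rewrite evalx_genx (congr1 (fun c => c * A (w (s (h t))) (w (s (l t)))) eta1).
  by rewrite mulN1r /std_form rmorphB /= !rmorph_nat.
rewrite p0 /evalx /mat_poly !raddf0 => /esym/eqP; rewrite intr_eq0.
rewrite psumr_eq0 => [/allP/(_ 1%g)|s _]; last exact: pf_term_ge0.
by rewrite mem_index_enum pf_term1 => /(_ isT).
Qed.

End Pfaffians.

End HighestWeightPolynomials.

(** * The decomposition of the symmetric power *)

Lemma finite_sumn (m s : nat) : finite_set [set nu : m.-tuple nat | sumn nu = s].
Proof.
pose F (f : {ffun 'I_m -> 'I_s.+1}) := [tuple (f i : nat) | i < m].
apply: (sub_finite_set (B := range F)); last exact/finite_image/finite_finset.
move=> nu /= nus.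
have le i : (tnth nu i < s.+1)%N.
  rewrite ltnS -nus sumnE big_tuple (bigD1 i) //= leq_addr //.
exists [ffun i => Ordinal (le i)] => //.
by apply: eq_from_tnth => i; rewrite tnth_mktuple ffunE.
Qed.

(** Conjugation of partitions: the count is the length of column j. The default 0 agrees with a row
    beyond the end. *)
Lemma ltn_count_sorted (s : seq nat) (i j : nat) : sorted geq s ->
  (i < count (fun r => j < r) s)%N = (j < nth 0%N s i)%N.
Proof.
elim: s i => [|x s IHs] i; first by rewrite nth_nil.
move=> /= xs; have ss := path_sorted xs.
have sx : all (fun y => y <= x)%N s.
  by apply: order_path_min xs => a b c /= ba cb; apply: leq_trans cb ba.
have [jx|xj] := ltnP j x; first by case: i => [|i]; rewrite ?add1n ?ltnS ?IHs //=.
have c0 : count (fun r => j < r)%N s = 0%N.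
  by apply/eqP; rewrite -leqn0 leqNgt -has_count -all_predC;
    apply: sub_all sx => y /= yx; rewrite -leqNgt (leq_trans yx).
rewrite c0; case: i => [|i] /=; first by rewrite addn0 ltnn ltnNge xj.
by rewrite -IHs // c0.
Qed.

Lemma sorted_nth_drop (s : seq nat) r : sorted geq s -> (nth 0 s r.+1 <= nth 0 s r)%N.
Proof.
move=> ss; rewrite leqNgt -ltn_count_sorted //; apply/negP => /ltnW.
by rewrite ltn_count_sorted // ltnn.
Qed.

(** If row 2t were longer than row 2t + 1, some column would have length exactly 2t + 1; conversely
    a column of odd length separates two such rows. *)
Lemma even_cols_pairs (s : seq nat) : sorted geq s ->
  (forall j : nat, ~~ odd (count (fun r => (j < r)%N) s)) <->
  (forall t, nth 0%N s t.*2 = nth 0%N s t.*2.+1).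
Proof.
move=> ss; split=> [ev t|pairs j].
  have cE := ltn_count_sorted _ _ ss.
  apply/eqP; rewrite eqn_leq sorted_nth_drop // andbT.
  rewrite leqNgt -cE; apply/negP; set c := count _ _ => tc.
  have : (c <= t.*2.+1)%N by rewrite leqNgt cE ltnn.
  move=> ct; have ec : c = t.*2.+1 by apply/eqP; rewrite eqn_leq ct tc.
  by have := ev (nth 0%N s t.*2.+1); rewrite -/c ec /= odd_double.
apply/negP => oc; set c := count _ _ in oc.
have ec : c = c./2.*2.+1 by rewrite -{1}[c]odd_double_half oc.
have : (c./2.*2 < c)%N by rewrite [X in (_ < X)%N]ec.
rewrite ltn_count_sorted // pairs -ltn_count_sorted // -ec.
by rewrite ltnn.
Qed.

(** Telescoping: it writes a partition as a sum of columns, column length r + 1 occurring f r - f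
    r.+1 times. These multiplicities yield the exponents of the minors and Pfaffians. *)
Lemma sum_drops (f : nat -> nat) (i M : nat) : (forall r, f r.+1 <= f r)%N ->
  (i <= M)%N -> (\sum_(r < M) (f r - f r.+1) * (i < r.+1) = f i - f M)%N.
Proof.
move=> fd; elim: M => [|M IHM] iM.
  by move: iM; rewrite leqn0 => /eqP ->; rewrite big_ord0 subnn.
rewrite big_ord_recr /=; have [iM'|Mi] := leqP i M; last first.
  have -> : i = M.+1 by apply/eqP; rewrite eqn_leq iM Mi.
  rewrite subnn ltnn muln0 addn0 big1 // => r _.
  by rewrite ltnNge (leq_trans (ltn_ord r)) // muln0.
rewrite IHM // ltnS iM' muln1.
have fmono : (f M <= f i)%N.
  by rewrite -(subnKC iM'); elim: (M - i)%N => [|u]; rewrite ?addn0 // addnS; exact: leq_trans.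
by move: (fd M) fmono; lia.
Qed.

Section Assembly.
Variables (C : numClosedFieldType) (N : nat) (J : 'M[C]_N) (eta : C).
Hypotheses (J_unit : J \in unitmx) (J_tr : J^T = - (eta *: J)) (eta2 : eta * eta = 1).
Local Notation g := (form_lie J).
Local Notation V := (form_mod J_unit J_tr eta2).
Local Notation d := (\dim {:V}).
Local Notation S := {mpoly C[d]}.
Local Notation der i j := (sym_der (V := V) (delta_mx i j)).
Local Notation genx_prod := (genx_prod J_unit J_tr eta2).
Variables (n k : nat).

Hypothesis separated : forall i : 'I_n, exists2 h, h \in cartan g &
  forall mu : n.-tuple int, weight_form mu h = (tnth mu i)%:~R.

Section Generic.
Variable slice : pred ('I_N * 'I_N).
Hypothesis straighten : forall Z : S -> Prop, lin_pred Z ->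
  (forall (i j : 'I_N) p, (i < j)%N -> Z (der j i p)) ->
  (forall s, size s = k -> all slice s -> Z (genx_prod s)) ->
  forall t, size t = k -> Z (genx_prod t).
Hypothesis slice_weight : forall s t, all slice s -> all slice t ->
  weight_count s =1 weight_count t -> perm_eq s t.
Variable A : set (N.-tuple nat).
Hypothesis A_size : forall nu, A nu -> sumn nu = (2 * k)%N.
Hypothesis A_slice : forall s, size s = k -> all slice s ->
  (forall i j : 'I_N, (i < j)%N -> (weight_count s j <= weight_count s i)%N) ->
  A [tuple weight_count s i | i < N].
Hypothesis A_hwp : forall nu, A nu -> exists (p : S) l,
  [/\ p != 0, p \is l.-homog & hwp (tnth nu) p].

Lemma char_sym_power_form (Vgl : N.-tuple nat -> lieMod (gl C N))
    (X : choiceType) (P : set X) (L : X -> lieMod g) (b : N.-tuple nat -> X -> nat) :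
  (forall nu, A nu -> irreducible_of_highest_weight (Vgl nu) (weight_of nu)) ->
  (forall nu, A nu -> decomposes_as P L (b nu) (restrict g (Vgl nu))) ->
  char n (sym_power (adjoint g) k) =
    \sum_(la \in P) \sum_(nu \in A) char n (L la) *+ b nu la.
Proof.
move=> irr dec; rewrite (char_sym_power_adjoint J_unit J_tr eta2).
have finA : finite_set A by apply: sub_finite_set (finite_sumn N (2 * k)) => nu /A_size.
have [s As] := (finite_seqP _).1 finA.
have AQ nu : A nu <-> nu \in undup s by rewrite mem_undup As.
apply: (char_restrict separated finA _ dec).
apply: (unitary_decomposition (@sym_form_lin _ _ _ _ J_unit J_tr eta2 k)
  (@sym_form_conj _ _ _ _ J_unit J_tr eta2 k) (@sym_form_pos _ _ _ _ J_unit J_tr eta2 k)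
  (@sym_form_adjoint _ _ _ _ J_unit J_tr eta2 k) (@sym_torus_bound _ _ _ _ J_unit J_tr eta2 k)
  (undup_uniq s) _ _ _ _ AQ).
- by move=> nu /AQ; apply: irr.
- move=> nu /AQ Anu; have [p [l [p0 pl hp]]] := A_hwp Anu.
  (* The size of the weight is 2l by homogeneity and 2k by membership in [A]. *)
  have lk : l = k.
    have := hwp_homog_weight p0 pl hp; have := A_size Anu.
    by rewrite sumnE big_tuple => ->; lia.
  rewrite lk in pl; exists (DHomog pl).
    by apply: contraNneq p0 => /(congr1 val) /= ->.
  split=> [i|i j ij]; apply: val_inj; rewrite val_elt.
    by rewrite linearZ /= hp.1.
  by rewrite /= hp.2.
- move=> m x x0 hx m_dom.
  have [t [tk ts mt _]] := hwv_slice straighten x0 hx.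
  exists [tuple weight_count t i | i < N]; last by move=> i; rewrite tnth_mktuple mt.
  by apply/AQ; apply: A_slice => // i j ij; rewrite -!mt; apply: m_dom.
- exact: sym_hwv_unique straighten slice_weight.
Qed.

End Generic.

End Assembly.

Lemma sorted_weight_tuple N (m : 'I_N -> nat) :
  (forall i j : 'I_N, (i < j)%N -> (m j <= m i)%N) -> sorted geq [tuple m i | i < N].
Proof.
move=> md; apply/(sortedP 0%N) => i; rewrite size_tuple => iN.
have i'N := ltnW iN.
rewrite -!(tnth_nth 0%N _ (Ordinal iN)) -(tnth_nth 0%N _ (Ordinal i'N)) !tnth_mktuple /=.
exact: md.
Qed.

Lemma nth_weight_tuple N (m : 'I_N -> nat) (i : 'I_N) :
  nth 0%N [tuple m i | i < N] i = m i.
Proof. by rewrite -tnth_nth tnth_mktuple. Qed.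

(** The multiplicity of a slice pair is read off from the weight at its first index; c + 1 is 2 for
    the pairs (i, i) and 1 for the pairs (2t, 2t + 1). *)
Lemma perm_of_slice_count N (slice : pred ('I_N * 'I_N)) c
    (s t : seq ('I_N * 'I_N)) :
  (forall u p, all slice u -> slice p -> weight_count u p.1 = (c.+1 * count_mem p u)%N) ->
  all slice s -> all slice t -> weight_count s =1 weight_count t -> perm_eq s t.
Proof.
move=> cE ss st st_eq; apply/allP => p _; apply/eqP => /=.
have [sp|nsp] := boolP (slice p).
  by apply/eqP; rewrite -(eqn_pmul2l (ltn0Sn c)) -!cE // st_eq.
have nmem u : all slice u -> p \notin u.
  by move=> /allP su; apply: contraNN nsp; apply: su.
by rewrite !(count_memPn (nmem _ _)).
Qed.

(** The witness is E_ii - E_i'i' with i' opposite to i. As 2n <= N, i' is at least n, where the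
    padded weight is 0. *)
Lemma separated_form (C : numFieldType) (N n : nat) (J : 'M[C]_N) :
  (2 * n <= N)%N -> (forall i j, j != rev_ord i -> J i j = 0) ->
  forall i : 'I_n, exists2 h, h \in cartan (form_lie J) &
    forall mu : n.-tuple int, weight_form mu h = (tnth mu i)%:~R.
Proof.
move=> nN J0 i; have iN : (i < N)%N by move: (ltn_ord i); lia.
pose i0 : 'I_N := Ordinal iN; pose i1 := rev_ord i0.
have i10 : i1 != i0 by rewrite -val_eqE /=; move: (ltn_ord i); lia.
pose h : 'M[C]_N := delta_mx i0 i0 - delta_mx i1 i1.
have hE a b : h a b = ((a == i0)%:R - (a == i1)%:R) *+ (a == b).
  rewrite !mxE; have [<-|ab] := eqVneq a b; first by rewrite !andbb mulr1n.
  have e x : (a == x) && (b == x) = false.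
    by apply: contraNF ab => /andP[/eqP -> /eqP ->].
  by rewrite !e subrr mulr0n.
have h_diag M a b : (h^T *m M) a b = ((a == i0)%:R - (a == i1)%:R) * M a b.
  rewrite mxE (bigD1 a) //= big1 ?addr0 => [|c ca]; first by rewrite mxE hE eqxx mulr1n.
  by rewrite mxE hE (negPf ca) mulr0n mul0r.
have h_diag' M a b : (M *m h) a b = M a b * ((b == i0)%:R - (b == i1)%:R).
  rewrite mxE (bigD1 b) //= big1 ?addr0 => [|c cb]; first by rewrite hE eqxx mulr1n.
  by rewrite hE (negPf cb) mulr0n mulr0.
exists h.
  rewrite memv_cap; apply/andP; split.
    apply/form_spaceP/matrixP => a b; rewrite mxE h_diag h_diag' mxE.
    have [->|/J0 ->] := eqVneq b (rev_ord a); last by rewrite mulr0 mul0r addr0.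
    have e0 : (rev_ord a == i0) = (a == i1) by rewrite (can2_eq rev_ordK rev_ordK).
    have e1 : (rev_ord a == i1) = (a == i0) by rewrite (inj_eq rev_ord_inj).
    by rewrite e0 e1; ring.
  by rewrite rpredB // memv_span //; apply/imageP; [exists i0|exists i1].
move=> mu; rewrite /weight_form (bigD1 i0) //= (bigD1 i1) //= big1 ?addr0.
  rewrite !hE !eqxx (negPf i10) eq_sym (negPf i10) !mulr1n subr0 sub0r mulr1.
  rewrite [mu`_(N - _)]nth_default; last by rewrite size_tuple; move: (ltn_ord i); lia.
  by rewrite mulr0z mul0r addr0 (tnth_nth 0).
move=> a /andP[/negPf a0 /negPf a1]; by rewrite hE a0 a1 subrr mul0rn mulr0.
Qed.

(** * The symplectic case: even rows and minors *)

Section SymplecticCase.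
Variables (C : numClosedFieldType) (N : nat) (J : 'M[C]_N).
Hypotheses (J_unit : J \in unitmx) (J_tr : J^T = - (1 *: J)).
Variables (n k : nat).
Hypothesis separated : forall i : 'I_n, exists2 h, h \in cartan (form_lie J) &
  forall mu : n.-tuple int, weight_form mu h = (tnth mu i)%:~R.

Let diag (p : 'I_N * 'I_N) := p.1 == p.2.

Lemma diag_weight_count u p : all diag u -> diag p ->
  weight_count u p.1 = (2 * count_mem p u)%N.
Proof.
rewrite /weight_count; elim: u => [|q u IHu] /=; first by rewrite big_nil muln0.
move=> /andP[dq du] dp; rewrite big_cons IHu // mulnDr; congr (_ + _)%N.
move: q p dq dp {IHu} => [a b] [c e] /eqP /= <- /eqP /= <-.
by rewrite xpair_eqE andbb eq_sym addnn mul2n.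
Qed.

Lemma even_weight_count u i : all diag u -> ~~ odd (weight_count u i).
Proof.
move=> du; have /= -> := @diag_weight_count u (i, i) du (eqxx i).
by rewrite mul2n odd_double.
Qed.

Lemma char_sym_power_sym (Vgl : N.-tuple nat -> lieMod (gl C N))
    (X : choiceType) (P : set X) (L : X -> lieMod (form_lie J))
    (b : N.-tuple nat -> X -> nat) :
  (forall nu, parts N nu -> irreducible_of_highest_weight (Vgl nu) (weight_of nu)) ->
  (forall nu, parts_even_rows N (2 * k)%N nu ->
     decomposes_as P L (b nu) (restrict (form_lie J) (Vgl nu))) ->
  char n (sym_power (adjoint (form_lie J)) k) =
    \sum_(la \in P) \sum_(nu \in parts_even_rows N (2 * k)%N) char n (L la) *+ b nu la.
Proof.
move=> irr dec; have eta2 : (1 : C) * 1 = 1 by rewrite mulr1.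
apply: (char_sym_power_form (J_unit := J_unit) (J_tr := J_tr) (eta2 := eta2)
  separated (slice := diag) (A := parts_even_rows N (2 * k)%N) _ _ _ _ _ _ dec).
- move=> Z linZ Z_low Zs; exact: straighten_sym linZ Z_low _ _ Zs.
- by move=> s t; apply: (perm_of_slice_count (c := 1)) => u p; apply: diag_weight_count.
- by move=> nu [].
- move=> s sk ds dom; split; first exact: sorted_weight_tuple.
    by rewrite sumnE big_tuple -sk -sum_weight_count; apply: eq_bigr => i _; rewrite tnth_mktuple.
  by move=> r /tnthP[i ->]; rewrite tnth_mktuple even_weight_count.
- move=> nu [ss _ ev]; pose f := nth 0%N nu.
  have f_ev r : ~~ odd (f r).
    rewrite /f; have [rN|Nr] := ltnP r N; first by apply/ev/mem_nth; rewrite size_tuple.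
    by rewrite nth_default // size_tuple.
  (* The minor of size r + 1 has weight 2 on its indices, so its exponent is half of the drop after
     row r, which is even because the rows are. *)
  pose a r := ((f r - f r.+1)./2)%N.
  have a2 r : (a r * 2 = f r - f r.+1)%N.
    by rewrite muln2 -[RHS]odd_double_half oddB ?sorted_nth_drop //
      (negPf (f_ev _)) (negPf (f_ev _)).
  exists (\prod_(r < N) minor J_unit J_tr eta2 (ltn_ord r) ^+ a r), (\sum_(r < N) r.+1 * a r)%N.
  split.
  + by apply/prodf_neq0 => r _; rewrite expf_neq0 // minor_neq0.
  + apply: (big_ind2 (fun p l => p \is l.-homog)) => [||r _].
    * exact: dhomog1.
    * by move=> p1 l1 p2 l2; apply: dhomogM.
    * by apply: dhomogMn; apply: minor_homog.
  + have := hwp_prod (index_enum 'I_N)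
      (fun r : 'I_N => hwpX (a r) (hwp_minor J_unit J_tr eta2 (ltn_ord r))).
    apply: hwp_ext => i.
    transitivity (f i - f N)%N; last first.
      by rewrite {2}/f nth_default ?size_tuple // subn0 (tnth_nth 0%N).
    rewrite -sum_drops => [|r|]; [|exact: sorted_nth_drop|exact: ltnW].
    by apply: eq_bigr => r _; rewrite mulnA a2.
by move=> nu [ss _ _]; apply: irr.
Qed.

End SymplecticCase.

(** * The orthogonal case: even columns and Pfaffians *)

Section OrthogonalCase.
Variables (C : numClosedFieldType) (N : nat) (J : 'M[C]_N).
Hypotheses (J_unit : J \in unitmx) (J_tr : J^T = - (-1 *: J)).
Variables (n k : nat).
Hypothesis separated : forall i : 'I_n, exists2 h, h \in cartan (form_lie J) &
  forall mu : n.-tuple int, weight_form mu h = (tnth mu i)%:~R.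

Local Notation slice := (@skew_slice N).

Lemma skew_weight_count u p : all slice u -> slice p ->
  weight_count u p.1 = (1 * count_mem p u)%N.
Proof.
rewrite /weight_count; elim: u => [|q u IHu] /=; first by rewrite big_nil muln0.
move=> /andP[dq du] dp; rewrite big_cons IHu // mulnDr; congr (_ + _)%N.
move: q p dq dp {IHu} => [a b] [c e] /andP[/= oa /eqP eb] /andP[/= oc /eqP ee].
rewrite xpair_eqE mul1n -!val_eqE /= eb ee.
have -> : (val c == a.+1) = false.
  by apply/negP => /eqP ec; move: oc; rewrite [odd _](congr1 odd ec) /= oa.
by rewrite addn0 eqSS andbb eq_sym.
Qed.

Lemma skew_weight_count_pair u (i : 'I_N) t : all slice u -> i = t.*2 :> nat ->
  weight_count u i = nth 0%N [tuple weight_count u j | j < N] t.*2.+1.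
Proof.
move=> su it; have [tN|Nt] := ltnP t.*2.+1 N.
  rewrite (nth_weight_tuple _ (Ordinal tN)) /weight_count.
  elim: u su => [|[a b] u IHu] /=; first by rewrite !big_nil.
  move=> /andP[/andP[/= oa /eqP eb] /IHu e]; rewrite !big_cons e /=; congr (_ + _)%N.
  rewrite -!val_eqE /= eb it eqSS.
  have -> : (t.*2 == a.+1) = false.
    by apply/negP => /eqP ta; have := odd_double t; rewrite ta /= oa.
  have -> : (t.*2.+1 == a) = false.
    by apply/negP => /eqP ta; move: oa; rewrite -ta /= odd_double.
  by rewrite addn0 add0n.
(* Here N is odd and i is its last index: no slice pair contains it, so its weight is 0, like the
   default. *)
rewrite nth_default ?size_tuple // /weight_count big_seq big1 // => -[a b] /(allP su).
move=> /andP[/= oa /eqP eb]; have := ltn_ord b; rewrite eb => aN.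
rewrite -!val_eqE /= eb it.
by apply/eqP; rewrite addn_eq0 !eqb0; apply/andP; split; apply/eqP;
  move: oa aN Nt; case: {eb su} a => a ?  /=; lia.
Qed.

Lemma char_sym_power_skew (Vgl : N.-tuple nat -> lieMod (gl C N))
    (X : choiceType) (P : set X) (L : X -> lieMod (form_lie J))
    (b : N.-tuple nat -> X -> nat) :
  (forall nu, parts N nu -> irreducible_of_highest_weight (Vgl nu) (weight_of nu)) ->
  (forall nu, parts_even_cols N (2 * k)%N nu ->
     decomposes_as P L (b nu) (restrict (form_lie J) (Vgl nu))) ->
  char n (sym_power (adjoint (form_lie J)) k) =
    \sum_(la \in P) \sum_(nu \in parts_even_cols N (2 * k)%N) char n (L la) *+ b nu la.
Proof.
move=> irr dec; have eta2 : (-1 : C) * -1 = 1 by rewrite mulrNN mulr1.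
apply: (char_sym_power_form (J_unit := J_unit) (J_tr := J_tr) (eta2 := eta2)
  separated (slice := slice) (A := parts_even_cols N (2 * k)%N) _ _ _ _ _ _ dec).
- move=> Z linZ Z_low Zs; exact: straighten_skew linZ Z_low _ _ Zs.
- by move=> s t; apply: (perm_of_slice_count (c := 0)) => u p; apply: skew_weight_count.
- by move=> nu [].
- move=> s sk ds dom; have ss := sorted_weight_tuple dom; split=> //.
    by rewrite sumnE big_tuple -sk -sum_weight_count; apply: eq_bigr => i _; rewrite tnth_mktuple.
  apply/even_cols_pairs => // t; have [tN|Nt] := ltnP t.*2 N; last first.
    by rewrite !nth_default ?size_tuple // ltnW.
  by rewrite (nth_weight_tuple _ (Ordinal tN)) (skew_weight_count_pair (t := t)).
- move=> nu [ss _ /(even_cols_pairs ss) pairs]; pose f t := nth 0%N nu t.*2.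
  have fd r : (f r.+1 <= f r)%N.
    rewrite /f doubleS.
    exact: leq_trans (sorted_nth_drop _ ss) (sorted_nth_drop _ ss).
  (* For odd N the last row is paired with the default 0, so it is empty too. *)
  have f0 : f N./2 = 0%N.
    rewrite /f; have := odd_double_half N; case: (odd N) => /= e.
      by rewrite pairs nth_default // size_tuple -{1}e.
    by rewrite nth_default // size_tuple -{1}e.
  have leN (r : 'I_N./2) : (r.+1 + r.+1 <= N)%N.
    by have := odd_double_half N; move: (ltn_ord r); lia.
  exists (\prod_(r < N./2) pf J_unit J_tr eta2 (leN r) ^+ (f r - f r.+1)),
    (\sum_(r < N./2) r.+1 * (f r - f r.+1))%N.
  split.
  + by apply/prodf_neq0 => r _; rewrite expf_neq0 // pf_neq0.
  + apply: (big_ind2 (fun p l => p \is l.-homog)) => [||r _].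
    * exact: dhomog1.
    * by move=> p1 l1 p2 l2; apply: dhomogM.
    * by apply: dhomogMn; apply: pf_homog.
  + have := hwp_prod (index_enum 'I_N./2)
      (fun r : 'I_N./2 => hwpX (f r - f r.+1) (hwp_pf J_unit J_tr eta2 (leN r))).
    apply: hwp_ext => i.
    (* The Pfaffian of size 2(r + 1) involves i exactly when i/2 < r + 1. *)
    transitivity (\sum_(r < N./2) (f r - f r.+1) * (i./2 < r.+1))%N.
      by apply: eq_bigr => r _; congr (_ * nat_of_bool _)%N; lia.
    rewrite sum_drops //; last by move: (ltn_ord i); lia.
    rewrite f0 subn0 (tnth_nth 0%N) /f.
    rewrite -[X in _ = nth _ _ X]odd_double_half.
    by case: (odd i); rewrite ?add0n // add1n pairs.
by move=> nu [ss _ _]; apply: irr.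
Qed.

End OrthogonalCase.

Definition antidiag (C : numFieldType) (N : nat) (e : 'I_N -> C) : 'M[C]_N :=
  \matrix_(i, j) (e i *+ (j == rev_ord i)).

Lemma antidiag_unit (C : numFieldType) N (e : 'I_N -> C) :
  (forall i, e i != 0) -> antidiag e \in unitmx.
Proof.
move=> e0; suff h : antidiag e *m antidiag (fun i => (e (rev_ord i))^-1) = 1%:M.
  by case/mulmx1_unit: h.
apply/matrixP => i j; rewrite !mxE (bigD1 (rev_ord i)) //= big1 ?addr0.
  rewrite !mxE eqxx mulr1n rev_ordK mulrnAr mulfV // eq_sym //.
by move=> l /negPf li; rewrite mxE li mulr0n mul0r.
Qed.

Lemma antidiag_tr (C : numFieldType) N (e : 'I_N -> C) (eta : C) :
  (forall i, e (rev_ord i) = - (eta * e i)) ->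
  (antidiag e)^T = - (eta *: antidiag e).
Proof.
move=> eE; apply/matrixP => i j; rewrite !mxE.
have -> : (i == rev_ord j) = (j == rev_ord i) by rewrite [LHS]eq_sym (can2_eq rev_ordK rev_ordK).
case: eqP => [->|_]; last by rewrite !mulr0n mulr0 oppr0.
by rewrite !mulr1n eE.
Qed.

Theorem proposition3p1p1 (R : realType) (n k : nat) :
  (* so_N, N = 2n or 2n+1 *)
  (forall N : nat,
    (N = (2 * n)%N /\ (4 <= n)%N) \/ (N = (2 * n).+1 /\ (2 <= n)%N) ->
    forall (Vgl : N.-tuple nat -> lieMod (gl R[i] N))
           (Vso : n.-tuple nat -> lieMod (so R[i] N))
           (b : N.-tuple nat -> n.-tuple nat -> nat),
    (forall nu, parts N nu ->
       irreducible_of_highest_weight (Vgl nu) (weight_of nu)) ->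
    (forall la, parts n la ->
       irreducible_of_highest_weight (Vso la) (weight_of la)) ->
    (forall nu, parts_even_cols N (2 * k)%N nu ->
       decomposes_as (parts n) Vso (b nu) (restrict (so R[i] N) (Vgl nu))) ->
    char n (sym_power (adjoint (so R[i] N)) k) =
      \sum_(la \in parts n)
        \sum_(nu \in parts_even_cols N (2 * k)%N) char n (Vso la) *+ b nu la)
  /\
  (* sp_{2n} *)
  ((2 <= n)%N ->
    forall (Vgl : (2 * n)%N.-tuple nat -> lieMod (gl R[i] (2 * n)%N))
           (Vsp : n.-tuple nat -> lieMod (sp R[i] n))
           (b : (2 * n)%N.-tuple nat -> n.-tuple nat -> nat),
    (forall nu, parts (2 * n)%N nu ->
       irreducible_of_highest_weight (Vgl nu) (weight_of nu)) ->
    (forall la, parts n la ->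
       irreducible_of_highest_weight (Vsp la) (weight_of la)) ->
    (forall nu, parts_even_rows (2 * n)%N (2 * k)%N nu ->
       decomposes_as (parts n) Vsp (b nu) (restrict (sp R[i] n) (Vgl nu))) ->
    char n (sym_power (adjoint (sp R[i] n)) k) =
      \sum_(la \in parts n)
        \sum_(nu \in parts_even_rows (2 * n)%N (2 * k)%N)
          char n (Vsp la) *+ b nu la)
  /\
  (* so_{2n} again, with the highest weights ranging over all the dominant
     weights, so that the decompositions exist for every nu *)
  ((4 <= n)%N ->
    forall (Vgl : (2 * n)%N.-tuple nat -> lieMod (gl R[i] (2 * n)%N))
           (Vso : n.-tuple int -> lieMod (so R[i] (2 * n)%N))
           (b : (2 * n)%N.-tuple nat -> n.-tuple int -> nat),
    (forall nu, parts (2 * n)%N nu ->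
       irreducible_of_highest_weight (Vgl nu) (weight_of nu)) ->
    (forall mu, dominantD n mu ->
       irreducible_of_highest_weight (Vso mu) mu) ->
    (forall nu, parts_even_cols (2 * n)%N (2 * k)%N nu ->
       decomposes_as (dominantD n) Vso (b nu)
         (restrict (so R[i] (2 * n)%N) (Vgl nu))) ->
    char n (sym_power (adjoint (so R[i] (2 * n)%N)) k) =
      \sum_(mu \in dominantD n)
        \sum_(nu \in parts_even_cols (2 * n)%N (2 * k)%N)
          char n (Vso mu) *+ b nu mu).

Proof.
(* The set of labels is kept arbitrary, to serve both partitions and all dominant weights of
   SO_2n. *)
have soP N (X : choiceType) (P : set X) (Vgl : N.-tuple nat -> lieMod (gl R[i] N))
    (Vso : X -> lieMod (so R[i] N)) (b : N.-tuple nat -> X -> nat) :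
    (2 * n <= N)%N ->
    (forall nu, parts N nu -> irreducible_of_highest_weight (Vgl nu) (weight_of nu)) ->
    (forall nu, parts_even_cols N (2 * k)%N nu ->
       decomposes_as P Vso (b nu) (restrict (so R[i] N) (Vgl nu))) ->
    char n (sym_power (adjoint (so R[i] N)) k) = \sum_(la \in P)
      \sum_(nu \in parts_even_cols N (2 * k)%N) char n (Vso la) *+ b nu la.
  move=> nN; apply: char_sym_power_skew.
  - by apply: (@antidiag_unit R[i] N (fun=> 1)) => i; apply: oner_neq0.
  - apply: (@antidiag_tr R[i] N (fun=> 1)) => i; by rewrite mulN1r opprK.
  - by apply: separated_form => // i j /negPf ij; rewrite mxE ij.
split; last split.
- move=> N hN Vgl Vso b irr _; apply: soP => //.
  by case: hN => -[-> _].
- move=> _ Vgl Vsp b irr _; apply: char_sym_power_sym => //.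
  + apply: (@antidiag_unit R[i] (2 * n) (fun i => (-1) ^+ (n <= i)%N)) => i.
    by rewrite expf_neq0 // oppr_eq0 oner_neq0.
  + apply: (@antidiag_tr R[i] (2 * n) (fun i => (-1) ^+ (n <= i)%N)) => i.
    (* Reversal exchanges the two halves of the indices, which flips the sign and makes the form
       skew. *)
    rewrite mul1r /= -signrN; congr (_ ^+ nat_of_bool _).
    by have := ltn_ord i; lia.
  + by apply: separated_form => // i j /negPf ij; rewrite mxE ij.
by move=> _ Vgl Vso b irr _; apply: soP => //.
Qed.
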